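(* Let $d\geq 1$ and fix $r>0$. Let $f:\mathbb{R}^d\to\mathbb{C}$ be the spherical wave $f(x)=e^{2\pi i r\|x\|}$, where $\|\cdot\|$ is the Euclidean norm. Then the natural autocorrelation $\eta$ of $f$ exists for every $x\in\mathbb{R}^d$, and is given by \[ \eta(x)\,=\,\Gamma\Bigl(\frac{d}{2}\Bigr)\,\frac{J_{\frac d2-1}\bigl(2\pi r\|x\|\bigr)}{\bigl(\pi r\|x\|\bigr)^{\frac d2-1}} . \] Moreover, as $r\to 0^{+}$ this expression converges to the constant function $1$; correspondingly, for $r=0$ (i.e. $f\equiv 1$) one has $\eta(x)\equiv 1$ and $\widehat{\eta}=\delta_0$.
   Context: For a bounded, locally integrable function $g:\mathbb{R}^d\to\mathbb{C}$, its natural autocorrelation (natural Patterson function) is \[ \eta(x)\,=\,\lim_{R\to\infty}\frac{\bigl(g_R*\widetilde{g_R}\bigr)(x)}{\operatorname{vol}(B_R)}, \] provided the limit exists, where $B_R$ is the closed Euclidean ball of radius $R$ centred at $0$, $g_R=g\cdot 1_{B_R}$ is the restriction of $g$ to $B_R$, $*$ denotes convolution, and $\widetilde h(x)=\overline{h(-x)}$. Here $\Gamma$ is the Gamma function and $J_\nu$ is the Bessel function of the first kind of (integral or half-integral) order $\nu$, $J_\nu(z)=(z/2)^\nu\sum_{m\ge0}\frac{(-1)^m}{m!\,\Gamma(\nu+m+1)}(z/2)^{2m}$; the quotient $J_{\nu}(z)/z^{\nu}$ is entire, so the formula for $\eta$ is understood by continuity at $x=0$ (value $1$). The Fourier transform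 is $\widehat f(x)=\int_{\mathbb{R}^d}e^{-2\pi i x y}f(y)\,dy$, extended to tempered distributions; $\delta_0$ is the Dirac measure at $0$. *)

(* Defs.v *)
From HB Require Import structures.
From mathcomp Require Import all_boot all_order all_algebra.
From mathcomp Require Import all_classical all_reals all_analysis.
From mathcomp Require Import complex.

Set Implicit Arguments.
Unset Strict Implicit.
Unset Printing Implicit Defensive.

Import Order.TTheory GRing.Theory Num.Theory.
Import numFieldNormedType.Exports.
Local Open Scope classical_set_scope.
Local Open Scope ring_scope.
Local Open Scope complex_scope.

Section Defs.
Variable R : realType.

Definition vsub d (x y : d.-tuple R) : d.-tuple R :=
  [tuple tnth x i - tnth y i | i < d].
Definition vopp d (x : d.-tuple R) : d.-tuple R := [tuple - tnth x i | i < d].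
Definition vzero d : d.-tuple R := [tuple 0 | i < d].
Definition dotp d (x y : d.-tuple R) : R := \sum_(i < d) tnth x i * tnth y i.
Definition enorm d (x : d.-tuple R) : R := Num.sqrt (dotp x x).
Definition cball d (rad : R) : set (d.-tuple R) := [set x | enorm x <= rad].

Definition setcoord d (x : d.-tuple R) (i : 'I_d) (t : R) : d.-tuple R :=
  [tuple if j == i then t else tnth x j | j < d].

(* ---------- Lebesgue integral on R^d ----------
   Realised as the iterated one-dimensional Lebesgue integral over the
   coordinates (equal to the d-dimensional Lebesgue integral by Fubini/Tonelli
   for integrable / nonnegative measurable integrands). *)
Fixpoint iint (n : nat) : (n.-tuple R -> R) -> R :=
  match n return (n.-tuple R -> R) -> R with
  | 0 => fun f => f [tuple]
  | n'.+1 => fun f =>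
      Rintegral (@lebesgue_measure R) setT
        (fun t : R => iint (fun x : n'.-tuple R => f [tuple of t :: x]))
  end.

Definition vol d (A : set (d.-tuple R)) : R := iint (fun x => \1_A x).

Definition cint d (g : d.-tuple R -> R[i]) : R[i] :=
  (iint (fun x => complex.Re (g x))) +i* (iint (fun x => complex.Im (g x))).

Definition conv d (g h : d.-tuple R -> R[i]) (x : d.-tuple R) : R[i] :=
  cint (fun y => g y * h (vsub x y)).
Definition tilde d (h : d.-tuple R -> R[i]) (x : d.-tuple R) : R[i] :=
  conjc (h (vopp x)).
Definition restr d (g : d.-tuple R -> R[i]) (rad : R) (x : d.-tuple R) : R[i] :=
  if `[< @cball d rad x >] then g x else 0.

Definition autocorr_approx d (g : d.-tuple R -> R[i]) (x : d.-tuple R) (rad : R)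
  : R[i] :=
  conv (restr g rad) (tilde (restr g rad)) x / (vol (@cball d rad))%:C.

Definition ccvg_to (F : set_system R) (u : R -> R[i]) (l : R[i]) : Prop :=
  (@complex.Re R \o u) @ F --> complex.Re l /\ (@complex.Im R \o u) @ F --> complex.Im l.

Definition has_natural_autocorrelation_at d (g : d.-tuple R -> R[i])
  (x : d.-tuple R) (l : R[i]) : Prop :=
  ccvg_to (+oo%R) (autocorr_approx g x) l.

Definition natural_autocorrelation d (g : d.-tuple R -> R[i]) (x : d.-tuple R)
  : R[i] :=
  lim (@complex.Re R \o autocorr_approx g x @ +oo%R) +i*
  lim (@complex.Im R \o autocorr_approx g x @ +oo%R).

Definition expi (theta : R) : R[i] := cos theta +i* sin theta.

Definition spherical_wave d (r : R) (x : d.-tuple R) : R[i] :=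
  expi (2 * pi * r * enorm x).

Definition Gamma (s : R) : R :=
  Rintegral (@lebesgue_measure R) `]0, +oo[%classic
    (fun t => t `^ (s - 1) * expR (- t)).

(* J_nu(z) = (z/2)^nu sum_{m>=0} (-1)^m / (m! Gamma(nu+m+1)) (z/2)^(2m),
   used for z > 0 *)
Definition besselJ (nu z : R) : R :=
  (z / 2) `^ nu *
  limn (series (fun m : nat =>
      (-1) ^+ m / ((m `!)%:R * Gamma (nu + m%:R + 1)) * (z / 2) ^+ (2 * m))).

(* the closed formula for eta, with value 1 at x = 0 (by continuity) *)
Definition eta_formula d (r : R) (x : d.-tuple R) : R :=
  let nu := d%:R / 2 - 1 in
  if enorm x == 0 then 1
  else Gamma (d%:R / 2) * besselJ nu (2 * pi * r * enorm x)
       / (pi * r * enorm x) `^ nu.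

Definition pderiv d (i : 'I_d) (f : d.-tuple R -> R) (x : d.-tuple R) : R :=
  derive1 (fun t => f (setcoord x i t)) (tnth x i).
Definition pderivable d (i : 'I_d) (f : d.-tuple R -> R) (x : d.-tuple R) :=
  derivable (fun t => f (setcoord x i t)) (tnth x i) 1.
Fixpoint pderivs d (l : seq 'I_d) (f : d.-tuple R -> R) : d.-tuple R -> R :=
  if l is i :: l' then pderiv i (pderivs l' f) else f.

Definition schwartz d (f : d.-tuple R -> R) : Prop :=
  forall l : seq 'I_d,
    (forall (i : 'I_d) x, pderivable i (pderivs l f) x) /\
    forall k : nat, exists C : R, forall x,
      (1 + enorm x) ^+ k * `|pderivs l f x| <= C.

(* a complex Schwartz function is given by its real and imaginary parts *)
Definition cfun_of d (f1 f2 : d.-tuple R -> R) (x : d.-tuple R) : R[i] :=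
  f1 x +i* f2 x.

Definition fourier d (f : d.-tuple R -> R[i]) (xi : d.-tuple R) : R[i] :=
  cint (fun y => expi (- (2 * pi * dotp xi y)) * f y).

(* "the (tempered-distribution) Fourier transform of the function eta is
   the Dirac measure delta_0":  <\hat eta, phi> = <eta, \hat phi> = phi(0)
   for every Schwartz function phi *)
Definition fourier_is_dirac0 d (eta : d.-tuple R -> R[i]) : Prop :=
  forall f1 f2 : d.-tuple R -> R, schwartz f1 -> schwartz f2 ->
    cint (fun xi => eta xi * fourier (cfun_of f1 f2) xi)
    = cfun_of f1 f2 (@vzero d).

End Defs.
Arguments eta_formula {R} d r x.

(* Main.v *)
(**
For [|y| <= R] and [|y - x| <= R] the integrand of [g_R * ~g_R] at [x] is
[exp(2 pi i r (|y| - |y - x|))]. Substitute [y = R u]: the phase [|R u| - |R u - x|]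
tends to [<x, u>/|u|], so by dominated convergence the autocorrelation at [x] is the
mean over the unit ball of [exp(2 pi i r <x, u>/|u|)], where the sine part vanishes by
oddness. Expand the cosine in powers of [<x, u>/|u|]. The moments of [<x, u>] against
the Gaussian [exp(-|u|^2)] are computed coordinate by coordinate, and integrating over
the level sets of [|u|^2] (layer cake) turns them into moments over the ball at the
price of a Gamma factor; summing up gives the Bessel series. The mean of a cosine
of size [O(r)] tends to 1 as [r -> 0].

For [eta = 1] the claim is Fourier inversion at 0. Insert the factor [exp(-h^2 |xi|^2)],
exchange the integrals, use that the Gaussian is (up to scaling) its own Fourier
transform, and let [h -> 0]. The Fourier transform of a Schwartz function is integrable
because two derivatives in each variable bring down the factors [1 + (2 pi xi_i)^2].
*)

Require Import Defs.
From HB Require Import structures.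
From mathcomp Require Import all_boot all_order all_algebra.
From mathcomp Require Import all_classical all_reals all_analysis.
From mathcomp Require Import complex measurable_realfun.
From mathcomp Require Import ring lra.
Set Implicit Arguments.
Unset Strict Implicit.
Unset Printing Implicit Defensive.
Import Order.TTheory GRing.Theory Num.Theory.
Import numFieldNormedType.Exports.
Local Open Scope classical_set_scope.
Local Open Scope ring_scope.

(** * Lebesgue measure on tuples *)

Section tuple_measure.
Context {R : realType}.
Notation lam := (@lebesgue_measure R).
Notation rT := (measurableTypeR R).

(** The integral of the definitions is iterated and gives a value to every function, so Fubini and
    dominated convergence do not apply to it directly. It is compared once with the integral for a
    product measure [mun n] on tuples; the two agree on integrable functions, and the analysis takes
    place for [mun n]. Means of functions of [u/|u|] usually rest on polar coordinates and a
    rotation invariant surface measure. Homogeneity replaces the former: a function of degree [p]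
    has over [|u|^2 <= t] the integral [t^((n+p)/2)] times that over the unit ball, so Tonelli in
    [(u, t)] relates Gaussian integrals to ball integrals. Rotation invariance is replaced by a
    binomial identity between one-dimensional Gaussian moments, which allows an induction on the
    dimension. The definition of a Schwartz function speaks only of derivatives along coordinate
    lines. Measurability is therefore obtained from separate continuity, and continuity at the
    origin from a path that moves one coordinate at a time. *)

Definition tcons n (p : rT * n.-tuple rT) : n.+1.-tuple rT := [tuple of p.1 :: p.2].
Definition tuncons n (x : n.+1.-tuple rT) : rT * n.-tuple rT :=
  (thead x, [tuple of behead x]).

Lemma tconsK n : cancel (@tcons n) (@tuncons n).
Proof.
move=> [a b]; rewrite /tuncons /tcons theadE; congr pair.
by apply/val_inj.
Qed.

Lemma tunconsK n : cancel (@tuncons n) (@tcons n).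
Proof. by move=> x; rewrite /tuncons /tcons/= -tuple_eta. Qed.

Lemma measurable_tcons n : measurable_fun setT (@tcons n).
Proof. exact: measurable_cons. Qed.

Lemma measurable_tuncons n : measurable_fun setT (@tuncons n).
Proof.
apply/measurable_fun_pairP; split; last exact: measurable_behead.
rewrite (_ : _ \o _ = (fun x => tnth x ord0)); first exact: measurable_tnth.
by apply/funext => x /=; rewrite /thead.
Qed.

Section step.
Variables (n : nat) (m : {sigma_finite_measure set (n.-tuple rT) -> \bar R}).

(** Product with one more coordinate, transported from pairs to tuples. Sigma-finiteness is
    established along with it because the next product step requires it. *)
Definition consm : set (n.+1.-tuple rT) -> \bar R := pushforward (lam \x m)%E (@tcons n).

Let consm0 : consm set0 = 0%E.
Proof. by rewrite /consm /pushforward preimage_set0 measure0. Qed.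

Let consm_ge0 A : (0 <= consm A)%E.
Proof.
exact: (measure_ge0 (lam \x m)%E).
Qed.

Let consm_sigma_additive : semi_sigma_additive consm.
Proof.
move=> F mF tF mUF; rewrite /consm /pushforward preimage_bigcup.
apply: measure_semi_sigma_additive.
- by move=> k; rewrite -[X in measurable X]setTI; exact: measurable_tcons.
- apply/trivIsetP => /= i j _ _ ij; rewrite -preimage_setI.
  by move/trivIsetP : tF => /(_ _ _ _ _ ij) ->//; rewrite preimage_set0.
- rewrite -preimage_bigcup -[X in measurable X]setTI; exact: measurable_tcons.
Qed.

HB.instance Definition _ := isMeasure.Build _ _ _ consm
  consm0 consm_ge0 consm_sigma_additive.

Let consm_sigma_finite : sigma_finite setT consm.
Proof.
have /sigma_finiteP[F [TF ndF Foo]] := sigma_finiteT lam.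
have /sigma_finiteP[G [TG ndG Goo]] := sigma_finiteT m.
(* The boxes [F k x G k] exhaust the product because both sequences increase: a point of [F i x G j]
   lies in the box of index [maxn i j]. *)
exists (fun k => @tuncons n @^-1` (F k `*` G k)).
  apply/esym/seteqP; split=> // x _.
  have [i _ Fi] : (\bigcup_i F i) (tuncons x).1 by rewrite -TF.
  have [j _ Gj] : (\bigcup_i G i) (tuncons x).2 by rewrite -TG.
  exists (maxn i j) => //; split.
    by move: Fi; exact/subsetPset/ndF/leq_maxl.
  by move: Gj; exact/subsetPset/ndG/leq_maxr.
move=> k; have [mF Fo] := Foo k; have [mG Go] := Goo k; split.
  rewrite -[X in measurable X]setTI; apply: measurable_tuncons => //.
  exact: measurableX.
rewrite /consm /pushforward (_ : _ @^-1` _ = F k `*` G k).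
  by rewrite product_measure1E// lte_mul_pinfty// ge0_fin_numE.
rewrite -comp_preimage (_ : _ \o _ = id)//.
by apply/funext => p; exact: tconsK.
Qed.

HB.instance Definition _ := Measure_isSigmaFinite.Build _ _ _ consm
  consm_sigma_finite.

Definition consM : {sigma_finite_measure set (n.+1.-tuple rT) -> \bar R} := consm.
End step.

Fixpoint mun n : {sigma_finite_measure set (n.-tuple rT) -> \bar R} :=
  match n with
  | 0 => \d_ ([tuple] : 0.-tuple rT)
  | n'.+1 => consM (mun n')
  end.

Local Open Scope ereal_scope.

Lemma ge0_integral_mun_cons n (f : n.+1.-tuple rT -> \bar R) :
  measurable_fun setT f -> (forall x, 0 <= f x) ->
  \int[mun n.+1]_x f x = \int[lam]_t \int[mun n]_x f (tcons (t, x)).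
Proof.
move=> mf f0; have mt := @measurable_tcons n.
have mft := measurableT_comp mf mt.
rewrite /= -(fubini_tonelli1 (f \o @tcons n)) => [||x]; last exact: f0.
  by rewrite ge0_integral_pushforward.
exact: mft.
Qed.

Lemma integrable_mun_cons n (f : n.+1.-tuple rT -> \bar R) :
  (mun n.+1).-integrable setT f -> (lam \x mun n).-integrable setT (f \o @tcons n).
Proof.
move=> /integrableP[mf foo]; have mt := @measurable_tcons n.
apply/integrableP; split; first exact: (measurableT_comp mf mt).
move: foo; rewrite ge0_integral_pushforward//.
exact: measurableT_comp.
Qed.

Lemma integral_mun_cons n (f : n.+1.-tuple rT -> \bar R) :
  (mun n.+1).-integrable setT f ->
  \int[mun n.+1]_x f x = \int[lam]_t \int[mun n]_x f (tcons (t, x)).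
Proof.
move=> fi; have mt := @measurable_tcons n; have fi2 := integrable_mun_cons fi.
rewrite (integral12_prod_meas1 fi2)/= integral_pushforward//.
exact: measurable_int fi.
Qed.

(** No integrability is assumed: by Tonelli the integrals of the positive and of the negative part
    depend measurably on the parameter, and [fine] of their difference is measurable even where it
    is a default value. *)
Lemma measurable_iint d (T : measurableType d) n (F : T * n.-tuple rT -> R) :
  measurable_fun setT F ->
  measurable_fun setT (fun t => iint (fun x => F (t, x))).
Proof.
elim: n d T F => [|n IH] d T F mF.
  by apply: measurableT_comp mF _; exact: measurable_pair2.
rewrite /=.
pose G (p : T * rT) := iint (fun x : n.-tuple rT => F (p.1, tcons (p.2, x))).
have mG : measurable_fun setT G.
  apply: (IH _ _ (fun q : (T * rT) * n.-tuple rT => F (q.1.1, tcons (q.1.2, q.2)))).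
  apply: measurableT_comp mF _; apply/measurable_fun_pairP; split => /=.
    exact: (measurableT_comp measurable_fst measurable_fst).
  apply: (measurableT_comp (@measurable_tcons n)).
  apply: measurable_fun_pair; last exact: measurable_snd.
  by apply: measurableT_comp; [exact: measurable_snd|exact: measurable_fst].
have mGE : measurable_fun setT (EFin \o G) by exact/measurable_EFinP.
rewrite (_ : (fun _ => _) =
   fine \o (fun t => \int[lam]_s (EFin \o G)^\+ (t, s) - \int[lam]_s (EFin \o G)^\- (t, s))).
  apply: measurableT_comp => //; apply: emeasurable_funB.
    apply: (measurable_fun_fubini_tonelli_F ((EFin \o G)^\+)) => //.
    exact: measurable_funepos.
  apply: (measurable_fun_fubini_tonelli_F ((EFin \o G)^\-)) => //.
  exact: measurable_funeneg.
apply/funext => t; rewrite /= /Rintegral [X in fine X = _]integralE.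
by congr (fine (_ - _)); apply: eq_integral => s _; rewrite ?funeposE ?funenegE.
Qed.

(** Slices of an integrable function are integrable only for almost every first coordinate. On the
    other slices [iint] may be a default value, so the two inner integrals are compared almost
    everywhere. *)
Lemma iintE n (f : n.-tuple rT -> R) :
  (mun n).-integrable setT (EFin \o f) ->
  iint f = (\int[mun n]_x f x)%R.
Proof.
elim: n f => [|n IH] f fi.
  rewrite /= /Rintegral integral_dirac//; last exact: measurable_int fi.
  by rewrite diracT mul1e.
have mf : measurable_fun setT f by apply/measurable_EFinP; exact: measurable_int fi.
have mfc : measurable_fun setT (f \o @tcons n).
  exact: (measurableT_comp mf (@measurable_tcons n)).
rewrite [iint _]/= /Rintegral; congr fine.
rewrite integral_mun_cons//.
have fi2 := integrable_mun_cons fi.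
apply/ae_eq_integral => //.
- by apply/measurable_EFinP; exact: (measurable_iint mfc).
- exact: (measurable_fubini_F fi2).
apply: filterS (ae_integrable1 fi2) => t it _.
rewrite (IH (fun x => f (tcons (t, x)))) //= /Rintegral fineK//.
exact: integrable_fin_num.
Qed.

End tuple_measure.

(** * Change of variables under translations, dilations and the reflection *)

Section affine_change_of_variables.
Context {R : realType}.
Notation lam := (@lebesgue_measure R).
Notation rT := (measurableTypeR R).
Local Open Scope ereal_scope.

Lemma measurable_affine (a b : R) : measurable_fun setT (fun t : rT => (a * t + b)%R : rT).
Proof. by apply: measurable_funD => //; apply: measurable_funM. Qed.

(** Lebesgue measure is determined by its values on half-open intervals. A negative slope exchanges
    the closed and the open end of []u, v]], hence the two cases. *)
Lemma lebesgue_measure_affine (a b : R) (A : set rT) : a != 0%R -> measurable A ->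
  (`|a|%:E * lam ((fun t => (a * t + b)%R) @^-1` A) = lam A)%E.
Proof.
move=> a0 mA; have ma := measurable_affine a b.
pose pm : {measure set rT -> \bar R} :=
  measure_function_pushforward__canonical__measure_function_Measure lam ma.
pose qm : {measure set rT -> \bar R} := mscale (NngNum (normr_ge0 a)) pm.
apply/esym/(@lebesgue_measure_unique R qm) => //= _ [[u v]] _ <-.
rewrite /qm /mscale/= /pushforward.
have [ap|an] : (0 < a)%R \/ (a < 0)%R by case: (ltgtP a 0%R) a0 => // _ _; [right|left].
  rewrite (_ : _ @^-1` _ = `](u - b) / a, (v - b) / a]%classic)%R; last first.
    by apply/seteqP; split => t /=; rewrite !in_itv/= ltr_pdivrMr// ler_pdivlMr//
       ltrBlDr lerBrDr mulrC.
  rewrite !lebesgue_measure_itv/= !lte_fin ltr_pM2r ?invr_gt0// ltrD2r.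
  case: ifPn => // _; last by rewrite mule0.
  by rewrite -EFinM gtr0_norm//; congr EFin; field.
rewrite (_ : _ @^-1` _ = `[(v - b) / a, (u - b) / a[%classic)%R; last first.
  by apply/seteqP; split => t /=; rewrite !in_itv/= ltr_ndivlMr// ler_ndivrMr//
     ltrBlDr lerBrDr mulrC andbC.
rewrite !lebesgue_measure_itv/= !lte_fin ltr_nM2r ?invr_lt0// ltrD2r.
case: ifPn => // _; last by rewrite mule0.
by rewrite -EFinM ltr0_norm//; congr EFin; field.
Qed.

Lemma ge0_integral_affine (a b : R) (f : rT -> \bar R) : a != 0%R ->
  measurable_fun setT f -> (forall t, 0 <= f t) ->
  \int[lam]_t f (a * t + b)%R = (`|a|^-1)%:E * \int[lam]_t f t.
Proof.
move=> a0 mf f0; have ma := measurable_affine a b.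
pose pm : {measure set rT -> \bar R} :=
  measure_function_pushforward__canonical__measure_function_Measure lam ma.
transitivity (\int[pm]_t f t).
  by rewrite ge0_integral_pushforward.
have -> : \int[lam]_t f t = \int[mscale (NngNum (normr_ge0 a)) pm]_t f t.
  apply: eq_measure_integral => A mA _.
  exact/esym/lebesgue_measure_affine.
by rewrite ge0_integral_mscale//= muleA -EFinM mulVf ?mul1e// normr_eq0.
Qed.

(** One family covers all substitutions of the proof: translations ([a = 1]), dilations ([v = 0])
    and the reflection ([a = -1], [v = 0]). *)
Definition taff n (a : R) (v x : n.-tuple rT) : n.-tuple rT :=
  [tuple (a * tnth x i + tnth v i)%R | i < n].

Lemma measurable_taff n a (v : n.-tuple rT) : measurable_fun setT (taff a v).
Proof.
apply/measurable_fun_tnthP => i.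
rewrite (_ : _ \o _ = (fun x => (a * tnth x i + tnth v i)%R)).
  apply: (measurableT_comp (measurable_affine a (tnth v i))).
  exact: measurable_tnth.
by apply/funext => x /=; rewrite tnth_mktuple.
Qed.

Lemma taff_cons n a (v : n.+1.-tuple rT) t (x : n.-tuple rT) :
  taff a v (tcons (t, x)) = tcons ((a * t + thead v)%R, taff a [tuple of behead v] x).
Proof.
apply: eq_from_tnth => i; rewrite tnth_mktuple.
case: (unliftP ord0 i) => [j ->|->]; last by rewrite !tnth0.
by rewrite !tnthS tnth_mktuple tnth_behead; congr (_ + tnth _ _)%R;
  apply/val_inj; rewrite /= inordK ?ltnS.
Qed.

Lemma ge0_integral_taff n (a : R) (v : n.-tuple rT) (f : n.-tuple rT -> \bar R) :
  a != 0%R -> measurable_fun setT f -> (forall t, 0 <= f t) ->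
  \int[mun n]_x f (taff a v x) = (`|a|^-1 ^+ n)%:E * \int[mun n]_x f x.
Proof.
move=> a0; elim: n v f => [|n IH] v f mf f0.
  rewrite expr0 mul1e; apply: eq_integral => x _; congr f.
  by rewrite (tuple0 x) (tuple0 (taff _ _ _)).
have mt := @measurable_tcons R n.
have mft := measurableT_comp mf mt.
have mfa := measurableT_comp mf (measurable_taff a v).
rewrite (ge0_integral_mun_cons mfa)//= (ge0_integral_mun_cons mf)//.
under eq_integral => t _.
  under eq_integral => x _ do rewrite taff_cons.
  rewrite (IH [tuple of behead v] (fun x => f (tcons ((a * t + thead v)%R, x))))//.
  over.
  by apply: (measurableT_comp mft); exact: measurable_pair1.
have c0 : 0 <= (`|a|^-1 ^+ n)%:E by rewrite lee_fin exprn_ge0.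
have mG : measurable_fun setT (fun s : rT => \int[mun n]_x f (tcons (s, x))).
  by apply: (measurable_fun_fubini_tonelli_F (f \o @tcons R n)) => // x; exact: f0.
have G0 s : 0 <= \int[mun n]_x f (tcons (s, x)) by exact: integral_ge0.
rewrite (ge0_integral_affine (thead v)
  (f := fun s => (`|a|^-1 ^+ n)%:E * \int[mun n]_x f (tcons (s, x))))//.
- by rewrite ge0_integralZl// muleA -EFinM -exprS.
- exact: measurable_funeM.
- by move=> t; rewrite mule_ge0.
Qed.

Lemma integrable_taff n (a : R) (v : n.-tuple rT) (f : n.-tuple rT -> \bar R) :
  a != 0%R -> (mun n).-integrable setT f ->
  (mun n).-integrable setT (f \o taff a v).
Proof.
move=> a0 /integrableP[mf foo]; apply/integrableP; split.
  exact: (measurableT_comp mf (measurable_taff a v)).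
rewrite (ge0_integral_taff v a0 (f := fun x => `|f x|))//.
  by rewrite lte_mul_pinfty.
exact: measurableT_comp.
Qed.

Lemma integral_taff n (a : R) (v : n.-tuple rT) (f : n.-tuple rT -> \bar R) :
  a != 0%R -> (mun n).-integrable setT f ->
  \int[mun n]_x f (taff a v x) = (`|a|^-1 ^+ n)%:E * \int[mun n]_x f x.
Proof.
move=> a0 fi; have mf := measurable_int _ fi.
transitivity (\int[mun n]_x f^\+ (taff a v x) - \int[mun n]_x f^\- (taff a v x)).
  transitivity (\int[mun n]_x (f \o taff a v) x); first by [].
  rewrite integralE; under eq_integral do rewrite funepos_comp/=.
  by under [X in _ - X = _]eq_integral do rewrite funeneg_comp/=.
rewrite [in RHS]integralE.
rewrite (ge0_integral_taff v a0 (f := f^\+))//; last exact: measurable_funepos.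
rewrite (ge0_integral_taff v a0 (f := f^\-))//; last exact: measurable_funeneg.
have pf := integrable_pos_fin_num measurableT fi.
move: (\int[mun n]_x f^\+ x) (\int[mun n]_x f^\- x) pf => A B Af.
by rewrite muleBr// fin_num_adde_defr.
Qed.

Lemma Rintegral_taff n (a : R) (v : n.-tuple rT) (f : n.-tuple rT -> R) :
  a != 0%R -> (mun n).-integrable setT (EFin \o f) ->
  (\int[mun n]_x f (taff a v x) = `|a|^-1 ^+ n * \int[mun n]_x f x)%R.
Proof.
move=> a0 fi; rewrite /Rintegral (integral_taff v a0 fi) fineM//.
exact: integrable_fin_num.
Qed.

End affine_change_of_variables.

(** * The Gamma function and Gaussian moments *)

Section layer_cake.
Context {R : realType} d (T : measurableType d).
Notation lam := (@lebesgue_measure R).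
Variable m : {sigma_finite_measure set T -> \bar R}.
Local Open Scope ereal_scope.

(** Both sides integrate [h x * w t] over the set [0 < t], [N x <= t], in the two orders. The
    section over [x] contributes the tail [W x] of the weight, the section at level [t] contributes
    [t^q * c]. Different choices of [w] produce Gaussians, Gamma factors and powers of the norm. *)
Lemma layer_cake (h N W : T -> R) (w : R -> R) (q : R) (c : \bar R) :
  measurable_fun setT h -> measurable_fun setT N -> measurable_fun setT w ->
  (forall x, 0 <= h x)%R -> (forall t, 0 < t -> 0 <= w t)%R -> 0 <= c ->
  (forall t, (0 < t)%R -> \int[m]_(x in [set x | (N x <= t)%R]) (h x)%:E = (t `^ q)%:E * c) ->
  (forall x, \int[lam]_(t in `]0%R, +oo[ `&` `[N x, +oo[) (w t)%:E = (W x)%:E) ->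
  \int[m]_x (h x * W x)%:E = c * \int[lam]_(t in `]0%R, +oo[) (w t * t `^ q)%:E.
Proof.
move=> mh mN mw h0 w0 c0 hc wW.
pose A := [set p : T * R | (0 < p.2)%R /\ (N p.1 <= p.2)%R].
have mA : measurable A.
  have -> : A = (snd @^-1` `]0%R, +oo[) `&` [set p | N p.1 <= p.2]%R.
    by apply/seteqP; split => p /=; rewrite !in_itv/= !andbT.
  apply: measurable_fun_le => //; last 2 first.
  - by apply: measurable_funTS; apply: measurableT_comp.
  - exact: measurable_funTS.
  by rewrite -[X in measurable X]setTI; apply: measurable_snd.
pose F (p : T * R) : \bar R := (h p.1 * w p.2 * \1_A p)%:E.
have mF : measurable_fun setT F.
  apply/measurable_EFinP; apply: measurable_funM; last exact: measurable_indic.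
  by apply: measurable_funM; apply: measurableT_comp.
have F0 p : 0 <= F p.
  rewrite lee_fin indicE; case: (boolP (p \in A)) => [|_]; last by rewrite mulr0.
  by rewrite inE => -[p0 _]; rewrite mulr1 mulr_ge0// w0.
have := fubini_tonelli (m1 := m) (m2 := lam) F mF F0.
rewrite (_ : \int[m]_x _ = \int[m]_x (h x * W x)%:E); last first.
  apply: eq_integral => x _.
  rewrite EFinM -wW [in RHS]integral_mkcond -ge0_integralZl_EFin//; last 2 first.
  - move=> t _; rewrite patchE; case: ifPn => //; rewrite inE => -[/=].
    by rewrite in_itv/= andbT lee_fin => /w0.
  - apply/(measurable_restrictT _ _).1; first exact: measurableI.
    by apply/measurable_EFinP; apply: measurable_funTS.
  apply: eq_integral => t _.
  rewrite /F indicE patchE.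
  have -> : ((x, t) \in A) = (t \in `]0%R, +oo[ `&` `[N x, +oo[).
    by apply/idP/idP; rewrite !inE /A/= !in_itv/= !andbT.
  by case: ifPn => _; rewrite ?mulr1 ?mulr0 ?mule0.
move=> ->.
rewrite -ge0_integralZl//; last 2 first.
- apply/measurable_EFinP; apply: measurable_funM; first exact: measurable_funTS.
  by apply: measurable_funTS; exact: measurable_powR.
- by move=> t/=; rewrite in_itv/= andbT => t0; rewrite lee_fin mulr_ge0// ?powR_ge0// w0.
rewrite [RHS]integral_mkcond; apply: eq_integral => t _.
rewrite patchE; case: ifPn => [|/negP]; rewrite inE/= in_itv/= andbT => t0; last first.
  rewrite integral0_eq// => x _; rewrite /F indicE memNset ?mulr0//.
  by case.
rewrite EFinM muleCA [c * _]muleC -hc// [in RHS]integral_mkcond -ge0_integralZl_EFin//; last first.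
- exact: w0.
- apply/(measurable_restrictT _ _).1.
    by rewrite -[X in measurable X]setTI; apply: measurable_fun_le => //.
  by apply/measurable_EFinP; apply: measurable_funTS.
- move=> x _; rewrite patchE; case: ifPn => // _.
  by rewrite lee_fin.
apply: eq_integral => x _.
rewrite /F indicE patchE.
have -> : ((x, t) \in A) = (x \in [set x | N x <= t]%R).
  by apply/idP/idP; rewrite !inE /A/= ; [case|].
by case: ifPn => _; rewrite ?mulr1 ?mulr0 ?mule0// -EFinM mulrC.
Qed.

End layer_cake.

(** * The functional equation of Gamma and the one-dimensional Gaussian moments *)

Section Gamma_integral.
Context {R : realType}.
Notation lam := (@lebesgue_measure R).
Notation rT := (measurableTypeR R).
Local Open Scope ereal_scope.

(* Extended-real valued, so that Tonelli applies before finiteness is known. *)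
Definition GammaE (s : R) : \bar R :=
  \int[lam]_(t in `]0%R, +oo[) (t `^ (s - 1) * expR (- t))%:E.

(** The tail hypothesis of [layer_cake] for the weight [exp(-t)]: it makes [W = exp(-N)] for a
    nonnegative [N]. *)
Lemma integral_expRN (a : R) : (0 <= a)%R ->
  \int[lam]_(t in `]0%R, +oo[ `&` `[a, +oo[) (expR (- t))%:E = (expR (- a))%:E.
Proof.
move=> a0.
have me : measurable_fun setT (fun t : R => (expR (- t))%:E).
  by apply/measurable_EFinP; apply: measurableT_comp.
have -> : \int[lam]_(t in `]0%R, +oo[ `&` `[a, +oo[) (expR (- t))%:E =
    \int[lam]_(t in `[a, +oo[) (expR (- t))%:E.
  move: a0; rewrite le_eqVlt => /predU1P[<-|a0].
    rewrite (_ : _ `&` _ = `]0%R, +oo[%classic).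
      by rewrite integral_itv_obnd_cbnd//; exact: measurable_funTS.
    apply/seteqP; split => t /=; rewrite !in_itv/= !andbT; first by case.
    by move=> t0; split => //; exact: ltW.
  congr (integral _ _ _); apply/seteqP; split => t /=; rewrite !in_itv/= !andbT; first by case.
  by move=> at_; split => //; exact: lt_le_trans at_.
have cE : continuous (fun t : R => expR (- t)).
  move=> x; apply: (@continuous_comp _ _ _ (-%R) expR); first exact: oppr_continuous.
  exact: continuous_expR.
rewrite (@ge0_continuous_FTC2y _ _ (fun t => - expR (- t))%R a 0%R).
- by rewrite sub0e -EFinN opprK.
- by move=> x _; exact: expR_ge0.
- exact: continuous_subspaceT.
- rewrite -oppr0; apply: cvgN.
  exact: cvgr_expR.
- by move=> x _; exact: ex_derive.
- by apply: cvg_at_right_filter; apply: cvgN; exact: cE.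
- move=> x _; rewrite derive1N// derive1_comp// derive1N// derive1_id mulrN1 opprK.
  by rewrite derive1E; have /funeqP -> := @derive_expR R.
Qed.

(** For [s < 1] the integrand is unbounded at 0, so the fundamental theorem is applied on [[u n, a]]
    and monotone convergence lets [u n] tend to 0. *)
Lemma integral_powR_itv_oc (s a : R) : (0 < s)%R -> (0 < a)%R ->
  \int[lam]_(t in `]0%R, a]) (s * t `^ (s - 1))%:E = (a `^ s)%:E.
Proof.
move=> s0 a0.
(* The shift to [n.+2] makes [u n < a] hold already for [n = 0]. *)
pose u n : R := (a / n.+2%:R)%R.
have u0 n : (0 < u n)%R by rewrite divr_gt0.
have ua n : (u n < a)%R by rewrite /u ltr_pdivrMr// ltr_pMr// ltr1n.
have FTC n : \int[lam]_(t in `[u n, a]) (s * t `^ (s - 1))%:E = (a `^ s - u n `^ s)%:E.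
  have dpow (p x : R) : (0 < x)%R -> derivable (fun t : R => t `^ p)%R x 1%R.
    by move=> x0; have [] := is_derive1_powR p x0.
  have cpow (p x : R) : (0 < x)%R -> {for x, continuous (fun t : R => t `^ p)%R}.
    by move=> x0; apply: differentiable_continuous; apply/derivable1_diffP; exact: dpow.
  rewrite (@continuous_FTC2 _ _ (fun t : R => t `^ s)%R _ _ (ua n)) ?EFinB//.
  - apply: derivable_within_continuous => x; rewrite in_itv/= => /andP[ux _].
    by apply: derivableM => //; apply: dpow; exact: lt_le_trans ux.
  - split.
    + move=> x; rewrite in_itv/= => /andP[ux _].
      by apply: dpow; exact: lt_trans ux.
    + by apply: cvg_at_right_filter; exact: cpow.
    + by apply: cvg_at_left_filter; exact: cpow.
  - move=> x; rewrite in_itv/= => /andP[ux _].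
    have D := is_derive1_powR s (lt_trans (u0 n) ux).
    by rewrite derive1E; exact: derive_val.
have c1 : \int[lam]_(t in `[u n, a]) (s * t `^ (s - 1))%:E @[n --> \oo] -->
    \int[lam]_(t in \bigcup_n `[u n, a]%classic) (s * t `^ (s - 1))%:E.
  apply: ge0_nondecreasing_set_cvg_integral => //.
  - move=> n k nk; apply/subsetPset => t /=; rewrite !in_itv/= => /andP[ut ->].
    rewrite andbT (le_trans _ ut)// ler_pM2l// lef_pV2 ?posrE// ler_nat.
    by rewrite !ltnS.
  - move=> n; apply/measurable_EFinP; apply: measurable_funTS.
    by apply: measurable_funM => //; exact: measurable_powR.
  - by move=> n t _; rewrite lee_fin mulr_ge0 ?powR_ge0// ltW.
rewrite (_ : `]0%R, a]%classic = \bigcup_n `[u n, a]%classic); last first.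
  apply/seteqP; split => t /=; rewrite ?in_itv/=.
    move=> /andP[t0 ta].
    have [n nt] : exists n : nat, (a / t < n%:R)%R.
      by exists (Num.truncn (a / t)).+1; exact: Num.Theory.truncnS_gt.
    exists n => //=; rewrite in_itv/= ta andbT /u ler_pdivrMr//.
    move: nt; rewrite ltr_pdivrMr// mulrC => /ltW /le_trans; apply.
    by rewrite ler_pM2l// ler_nat -addn2 leq_addr.
  by move=> [n _] /=; rewrite in_itv/= => /andP[ut ->]; rewrite (lt_le_trans _ ut).
apply: (cvg_unique _ c1) => //.
rewrite (_ : (fun n => _) = fun n => (a `^ s - u n `^ s)%:E); last exact/funext/FTC.
apply: cvg_EFin; first exact: nearW.
rewrite -[X in _ --> X]subr0; apply: cvgB; first exact: cvg_cst.
have [+ _] := @cvg_at_rightP R (fun t => t `^ s)%R 0%R 0%R.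
move=> /(_ (powR_cvg0 s0)); apply; split => //.
rewrite -[X in _ --> X](mulr0 a); apply: cvgMr.
exact: (cvg_comp (fun n => n.+1) (@harmonic R) (@cvg_addnl 1%N) (@cvg_harmonic R)).
Qed.


(** [layer_cake] takes the place of integration by parts: [h t = s t^(s-1)] on the positive
    half-line has mass [t^s] on []0, t]]. The level function is [|t|] so that it is nonnegative also
    where [h] vanishes. *)
Lemma GammaES (s : R) : (0 < s)%R -> GammaE (s + 1) = s%:E * GammaE s.
Proof.
move=> s0.
pose h (t : R) : R := (s * t `^ (s - 1) * \1_(`]0%R, +oo[%classic) t)%R.
have mh : measurable_fun setT h.
  apply: measurable_funM; last exact: measurable_indic.
  by apply: measurable_funM => //; exact: measurable_powR.
have h0 t : (0 <= h t)%R.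
  by rewrite /h mulr_ge0 ?mulr_ge0 ?powR_ge0// ?ltW// indicE ler0n.
have me : measurable_fun setT (fun t : R => expR (- t)) by apply: measurableT_comp.
have mn : measurable_fun setT (fun t : rT => `|t|%R) by exact: normr_measurable.
have := @layer_cake R _ rT lam h (fun t => `|t|)%R (fun t => expR (- `|t|)) (fun t => expR (- t)) s 1.
rewrite mul1e => LC.
transitivity (\int[lam]_(t in `]0%R, +oo[) (expR (- t) * t `^ s)%:E).
  by apply: eq_integral => t _; rewrite addrK mulrC.
rewrite -LC//; last 2 first.
- move=> t t0; rewrite mule1 -integral_powR_itv_oc// integral_mkcond [RHS]integral_mkcond.
  apply: eq_integral => x _; rewrite !patchE /h indicE.
  have -> : (x \in `]0%R, t]%classic) = (0 < x <= t)%R by rewrite mem_setE in_itv.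
  have -> : (x \in `]0%R, +oo[%classic) = (0 < x)%R by rewrite mem_setE in_itv/= andbT.
  have -> : (x \in [set x | `|x| <= t]%R) = (`|x| <= t)%R by apply/idP/idP; rewrite inE.
  case: (ltP 0%R x) => x0 /=; last by rewrite mulr0 if_same.
  by rewrite gtr0_norm// mulr1.
- by move=> x; exact: integral_expRN.
rewrite -ge0_integralZl_EFin//; last 3 first.
- by move=> t _; rewrite lee_fin mulr_ge0 ?powR_ge0 ?expR_ge0.
- apply/measurable_EFinP; apply: measurable_funM; last exact: measurable_funTS.
  by apply: measurable_funTS; exact: measurable_powR.
- exact: ltW.
rewrite [RHS]integral_mkcond; apply: eq_integral => x _; rewrite patchE /h indicE.
have -> : (x \in `]0%R, +oo[%classic) = (0 < x)%R by rewrite mem_setE in_itv/= andbT.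
case: (ltP 0%R x) => x0 /=; last by rewrite mulr0 mul0r.
by rewrite gtr0_norm// mulr1 -EFinM mulrA.
Qed.

Lemma integral_exprn_sym (j : nat) (a : R) : (0 < a)%R ->
  \int[lam]_(t in `[(- a)%R, a]) (t ^+ j.*2)%:E = (2 / j.*2.+1%:R * a ^+ j.*2.+1)%:E.
Proof.
move=> a0; have aa : (- a < a)%R by rewrite (lt_trans _ a0)// oppr_lt0.
rewrite (@continuous_FTC2 _ _ (fun t : R => (j.*2.+1%:R)^-1 * t ^+ j.*2.+1)%R _ _ aa).
- rewrite -EFinB; congr EFin; rewrite exprNn -signr_odd/= odd_double/= expr1 mulN1r mulrN opprK.
  by ring.
- by apply: continuous_subspaceT; exact: exprn_continuous.
- split.
  + by move=> x _; apply: derivableM => //; exact: exprn_derivable.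
  + apply: cvg_at_right_filter; apply: cvgMr; exact: exprn_continuous.
  + apply: cvg_at_left_filter; apply: cvgMr; exact: exprn_continuous.
- move=> x _; rewrite derive1Ml; last exact: exprn_derivable.
  rewrite exp_derive1.
  by rewrite -[X in (_ * X)%R]/(j.*2.+1%:R * x ^+ j.*2)%R mulKf// pnatr_eq0.
Qed.

(** The level sets of [t^2] are [[-sqrt t, sqrt t]], where [x^(2j)] has integral
    [2/(2j+1) t^(j+1/2)]. Integration against [exp(-t)] gives [2/(2j+1) Gamma(j+3/2)], and the
    functional equation absorbs the factor. *)
Lemma gauss_even_moment (j : nat) :
  \int[lam]_t (t ^+ j.*2 * expR (- t ^+ 2))%:E = GammaE (j%:R + 2^-1).
Proof.
have mX k : measurable_fun setT (fun t : R => t ^+ k)%R by exact: measurable_funX.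
have X0 (t : R) : (0 <= t ^+ j.*2)%R by rewrite -muln2 mulnC exprM exprn_ge0// sqr_ge0.
have me : measurable_fun setT (fun t : R => expR (- t)) by apply: measurableT_comp.
have := @layer_cake R _ rT lam (fun t => t ^+ j.*2)%R (fun t => t ^+ 2)%R
  (fun t => expR (- t ^+ 2)) (fun t => expR (- t)) (j%:R + 2^-1) (2 / j.*2.+1%:R)%:E.
move=> ->//; last 2 first.
- move=> t t0; have st0 : (0 < Num.sqrt t)%R by rewrite sqrtr_gt0.
  rewrite (_ : [set x | _] = `[(- Num.sqrt t)%R, Num.sqrt t]%classic); last first.
    by apply/seteqP; split => x /=; rewrite in_itv/= -ler_norml -sqrtr_sqr ler_sqrt// ltW.
  rewrite integral_exprn_sym// -EFinM; congr EFin; rewrite [RHS]mulrC; congr (_ * _)%R.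
  rewrite exprS -muln2 mulnC exprM sqr_sqrtr ?ltW// powRD; last by rewrite gt_eqF// implybT.
  by rewrite powR_mulrn ?ltW// powR12_sqrt ?ltW// mulrC.
- by move=> x; apply: integral_expRN; exact: sqr_ge0.
transitivity ((2 / j.*2.+1%:R)%:E * GammaE (j%:R + 2^-1 + 1)).
  by congr (_ * _); apply: eq_integral => t _; rewrite addrK mulrC.
rewrite GammaES; last by rewrite ltr_wpDl.
rewrite muleA -EFinM (_ : (_ * _)%R = 1%R) ?mul1e//.
have -> : (j.*2.+1%:R = 2 * j%:R + 1 :> R)%R by rewrite -natr1 -mul2n natrM.
by field; rewrite -natrM natr1 pnatr_eq0.
Qed.

Lemma GammaE_half : GammaE 2^-1 = (Num.sqrt pi)%:E.
Proof.
have := gauss_even_moment 0; rewrite add0r => <-.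
rewrite -integralT_gauss; apply: eq_integral => t _.
by rewrite expr0 mul1r.
Qed.

Lemma GammaE1 : GammaE 1 = 1.
Proof.
have := @integral_expRN 0%R (lexx _); rewrite oppr0 expR0 => <-.
rewrite (_ : _ `&` _ = `]0%R, +oo[%classic).
  by apply: eq_integral => t _; rewrite subrr powRr0 mul1r.
apply/seteqP; split => t /=; rewrite !in_itv/= !andbT; first by case.
by move=> t0; split => //; exact: ltW.
Qed.

End Gamma_integral.

Section Gamma_half_integers.
Context {R : realType}.

(** The arguments of Gamma that arise from dimensions are half-integers. An induction in steps of
    two from [1/2] and [1] yields finiteness and positivity at once, after which [Gamma] and
    [GammaE] may be exchanged. *)
Lemma GammaE_half_int (k : nat) : (0 < k)%N ->
  exists2 g : R, 0 < g & GammaE (k%:R / 2) = g%:E.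
Proof.
elim/ltn_ind: k => -[//|[_ _|[_ _|k IH _]]].
- by exists (Num.sqrt pi); rewrite ?sqrtr_gt0 ?pi_gt0// div1r GammaE_half.
- by exists 1; rewrite // divff// GammaE1.
have [//|//|g g0 gE] := IH k.+1.
exists (k.+1%:R / 2 * g); first by rewrite mulr_gt0// divr_gt0.
have -> : k.+3%:R / 2 = k.+1%:R / 2 + 1 :> R.
  by rewrite -addn2 natrD mulrDl divff.
by rewrite GammaES ?divr_gt0// gE.
Qed.

Lemma Gamma_gt0 (k : nat) : (0 < k)%N -> 0 < Gamma (k%:R / 2 : R).
Proof. by move=> /GammaE_half_int[g g0 gE]; rewrite /Gamma /Rintegral [X in fine X]gE. Qed.

Lemma GammaE_Gamma (k : nat) : (0 < k)%N -> GammaE (k%:R / 2) = (Gamma (k%:R / 2 : R))%:E.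
Proof. by move=> /GammaE_half_int[g g0 gE]; rewrite /Gamma /Rintegral [X in fine X]gE. Qed.

Lemma GammaS (k : nat) : (0 < k)%N ->
  Gamma (k%:R / 2 + 1) = k%:R / 2 * Gamma (k%:R / 2) :> R.
Proof.
move=> k0; rewrite {1}/Gamma /Rintegral [X in fine X](GammaES _) ?divr_gt0 ?ltr0n//.
by rewrite GammaE_Gamma.
Qed.

End Gamma_half_integers.

Section gaussian.
Context {R : realType}.
Notation lam := (@lebesgue_measure R).
Notation rT := (measurableTypeR R).

Definition gauss (n : nat) (u : n.-tuple R) : R := expR (- dotp u u).

Lemma dotp_cons n (t s : R) (x y : n.-tuple R) :
  dotp (tcons (t, x)) (tcons (s, y)) = t * s + dotp x y.
Proof.
rewrite /dotp big_ord_recl !tnth0; congr (_ + _).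
by apply: eq_bigr => i _; rewrite !tnthS.
Qed.

Lemma dotp0 n : n = 0%N -> forall x y : n.-tuple R, dotp x y = 0.
Proof. by move=> -> x y; rewrite /dotp big_ord0. Qed.

Lemma dotpp_ge0 n (x : n.-tuple R) : 0 <= dotp x x.
Proof. by apply: sumr_ge0 => i _; rewrite -expr2 sqr_ge0. Qed.

Lemma measurable_dotp d (T : measurableType d) n (f g : T -> n.-tuple rT) :
  measurable_fun setT f -> measurable_fun setT g ->
  measurable_fun setT (fun x => dotp (f x) (g x)).
Proof.
move=> mf mg; rewrite /dotp; apply: measurable_sum => i.
apply: measurable_funM.
  by apply: (measurableT_comp (measurable_tnth i) mf).
by apply: (measurableT_comp (measurable_tnth i) mg).
Qed.

Lemma measurable_dotpl n (a : n.-tuple R) :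
  measurable_fun setT (fun x : n.-tuple rT => dotp a x).
Proof. by apply: measurable_dotp. Qed.

Lemma measurable_gauss n : measurable_fun setT (@gauss n : n.-tuple rT -> R).
Proof.
apply: measurableT_comp => //; apply: measurableT_comp => //.
exact: measurable_dotp.
Qed.

Lemma gauss_cons n t (x : n.-tuple R) :
  gauss (tcons (t, x)) = expR (- t ^+ 2) * gauss x.
Proof. by rewrite /gauss dotp_cons opprD expRD expr2. Qed.

Lemma gauss_ge0 n (x : n.-tuple R) : 0 <= gauss x.
Proof. exact: expR_ge0. Qed.

Lemma integral_gauss1 : (\int[lam]_t (expR (- t ^+ 2))%:E)%E = (Num.sqrt pi)%:E :> \bar R.
Proof. exact: integralT_gauss. Qed.

Lemma integral_gauss n :
  (\int[@mun R n]_x (gauss x)%:E)%E = (Num.sqrt pi ^+ n)%:E.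
Proof.
elim: n => [|n IH].
  rewrite integral_dirac//; last by apply/measurable_EFinP; exact: measurable_gauss.
  by rewrite diracT mul1e /gauss dotp0// oppr0 expR0 expr0.
rewrite ge0_integral_mun_cons//; last first.
- by move=> x; rewrite lee_fin gauss_ge0.
- by apply/measurable_EFinP; exact: measurable_gauss.
under eq_integral => t _.
  under eq_integral => x _ do rewrite gauss_cons EFinM.
  rewrite ge0_integralZl_EFin ?expR_ge0//; last 2 first.
  - by move=> x _; rewrite lee_fin gauss_ge0.
  - by apply/measurable_EFinP; exact: measurable_gauss.
  rewrite IH muleC; over.
rewrite ge0_integralZl_EFin//.
- by rewrite integral_gauss1 -EFinM exprSr.
- by apply/measurable_EFinP; exact: measurable_gauss_fun.
Qed.

Lemma integrable_gauss n : (@mun R n).-integrable setT (EFin \o @gauss n).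
Proof.
apply/integrableP; split; first by apply/measurable_EFinP; exact: measurable_gauss.
under eq_integral do rewrite /= ger0_norm ?gauss_ge0//.
by rewrite integral_gauss ltry.
Qed.

Lemma Rintegral_gauss n : \int[@mun R n]_x gauss x = Num.sqrt pi ^+ n.
Proof. by rewrite /Rintegral integral_gauss. Qed.

End gaussian.

Lemma eq_oppr_eq0 (R : numDomainType) (a : R) : a = - a -> a = 0.
Proof. by move/eqP; rewrite -subr_eq0 opprK -mulr2n mulrn_eq0 => /eqP. Qed.

(** * Moments of linear forms under the Gaussian *)

Section gaussian_moments.
Context {R : realType}.
Notation lam := (@lebesgue_measure R).
Notation rT := (measurableTypeR R).

Lemma exprn_le_expR (t : R) k : 0 <= t -> t ^+ k <= k`!%:R * expR t.
Proof.
move=> t0; case: k => [|k]; first by rewrite expr0 mul1r -expR0 ler_expR.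
have := expR_ge1Dxn k t0; rewrite -ler_pdivrMl ?ltr0n ?fact_gt0//.
by apply: le_trans; rewrite mulrC lerDr.
Qed.

Lemma norm_dotp_le n (a u : n.-tuple R) :
  `|dotp a u| <= (dotp a a + dotp u u) / 2.
Proof.
rewrite /dotp -big_split/= mulr_suml; apply: le_trans (ler_norm_sum _ _ _) _.
apply: ler_sum => i _; rewrite normrM ler_pdivlMr//.
have := sqr_ge0 (`|tnth a i| - `|tnth u i|).
by rewrite sqrrB -!expr2 -(real_normK (num_real (tnth a i)))
  -(real_normK (num_real (tnth u i))); lra.
Qed.

Definition vscale n (s : R) (u : n.-tuple R) : n.-tuple R :=
  taff s [tuple 0 | i < n] u.

Lemma tnth_vscale n s (u : n.-tuple R) i : tnth (vscale s u) i = s * tnth u i.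
Proof. by rewrite !tnth_mktuple addr0. Qed.

Lemma dotp_vscalel n s (u v : n.-tuple R) : dotp (vscale s u) v = s * dotp u v.
Proof.
by rewrite /dotp mulr_sumr; apply: eq_bigr => i _; rewrite tnth_vscale mulrA.
Qed.

Lemma dotpC n (u v : n.-tuple R) : dotp u v = dotp v u.
Proof. by apply: eq_bigr => i _; rewrite mulrC. Qed.

Lemma dotp_vscaler n s (u v : n.-tuple R) : dotp u (vscale s v) = s * dotp u v.
Proof. by rewrite dotpC dotp_vscalel dotpC. Qed.

(** Since [|<a,u>| <= (|a|^2 + |u|^2)/2], half of the Gaussian exponent absorbs the exponential, and
    what remains, [exp(-|u|^2/2)], is the Gaussian dilated by [1/sqrt 2]. This one majorant
    dominates every moment and every partial sum of the cosine series. *)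
Lemma integrable_expR_gauss n (a : n.-tuple R) :
  (@mun R n).-integrable setT (EFin \o (fun u => expR `|dotp a u| * gauss u)).
Proof.
have s0 : (Num.sqrt 2)^-1 != 0 :> R by rewrite invr_eq0 sqrtr_eq0 -ltNge.
have ig := integrable_taff [tuple 0 | i < n] s0 (integrable_gauss n).
have ig2 := integrableZl measurableT (expR (dotp a a / 2)) ig.
apply: le_integrable ig2 => //.
  apply/measurable_EFinP; apply: measurable_funM; last exact: measurable_gauss.
  apply: measurableT_comp => //; apply: measurableT_comp => //.
  exact: measurable_dotpl.
move=> u _.
have -> : (EFin \o @gauss R n \o taff (Num.sqrt 2)^-1 [tuple 0 | i < n]) u =
    (expR (- (dotp u u / 2)))%:E.
  rewrite /= /gauss -[taff _ _ u]/(vscale _ u) dotp_vscalel dotp_vscaler mulrA.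
  by rewrite -expr2 exprVn sqr_sqrtr// mulrC.
rewrite -EFinM -expRD /= lee_fin /gauss -expRD !(ger0_norm (expR_ge0 _)) ler_expR.
by have := norm_dotp_le a u; lra.
Qed.

Lemma integrable_expn_gauss n (a : n.-tuple R) k :
  (@mun R n).-integrable setT (EFin \o (fun u => dotp a u ^+ k * gauss u)).
Proof.
have ig := integrableZl measurableT k`!%:R (integrable_expR_gauss a).
apply: le_integrable ig => //.
  apply/measurable_EFinP; apply: measurable_funM; last exact: measurable_gauss.
  by apply: measurable_funX; exact: measurable_dotpl.
move=> u _; have g0 := gauss_ge0 u.
have h0 : 0 <= k`!%:R * (expR `|dotp a u| * gauss u) by rewrite !mulr_ge0 ?expR_ge0.
rewrite /= lee_fin (ger0_norm h0) normrM normrX (ger0_norm g0) mulrA ler_wpM2r//.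
exact: exprn_le_expR.
Qed.

(* The moment of order [2m] of the density [exp(-t^2) / sqrt pi]. *)
Definition gmom (m : nat) : R := (m.*2)`!%:R / (4 ^+ m * m`!%:R).

(** The recursion of [Gamma(m + 1/2)]; with the value [sqrt pi] at [m = 0] it identifies [gmom m] as
    [Gamma(m + 1/2) / sqrt pi]. *)
Lemma gmomS m : gmom m.+1 = (m%:R + 2^-1) * gmom m.
Proof.
rewrite /gmom doubleS !factS exprS !natrM -!natr1 -!addnn natrD.
field.
by rewrite expf_neq0//= natr1 !pnatr_eq0 -lt0n fact_gt0.
Qed.

Lemma gauss_moment1 m :
  (\int[lam]_t (t ^+ m.*2 * expR (- t ^+ 2))%:E = (Num.sqrt pi * gmom m)%:E)%E.
Proof.
rewrite gauss_even_moment; elim: m => [|m IH].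
  by rewrite add0r GammaE_half /gmom expr0 fact0 mul1r divr1 mulr1.
rewrite -natr1 -addrA [1 + _]addrC addrA GammaES ?ltr_wpDl// IH -EFinM gmomS.
by congr EFin; rewrite mulrCA.
Qed.

Lemma Rintegral_odd n (g : n.-tuple rT -> R) :
  (@mun R n).-integrable setT (EFin \o g) -> (forall u, g (vscale (-1) u) = - g u) ->
  \int[@mun R n]_u g u = 0.
Proof.
move=> ig go; have n1 : -1 != 0 :> R by rewrite oppr_eq0 oner_eq0.
have := Rintegral_taff [tuple 0 | i < n] n1 ig.
rewrite normrN1 invr1 expr1n mul1r => E; apply: eq_oppr_eq0.
rewrite -{1}E -[RHS]mulN1r -RintegralZl//.
by apply: eq_Rintegral => u _; rewrite -[taff _ _ u]/(vscale _ u) go mulN1r.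
Qed.

Lemma gauss_moment_odd n (a : n.-tuple R) k : odd k ->
  \int[@mun R n]_u (dotp a u ^+ k * gauss u) = 0.
Proof.
move=> ok; apply: Rintegral_odd => [|u]; first exact: integrable_expn_gauss.
rewrite dotp_vscaler mulN1r exprNn -signr_odd ok expr1 /gauss.
by rewrite dotp_vscalel dotp_vscaler mulrA mulrNN !mul1r !mulN1r mulNr.
Qed.

Lemma sum_even_terms m (F : nat -> R) : (forall i, odd i -> F i = 0) ->
  \sum_(i < m.*2.+1) F i = \sum_(l < m.+1) F l.*2.
Proof.
move=> F0; elim: m => [|m IH]; first by rewrite !big_ord1.
by rewrite doubleS 2!big_ord_recr IH [RHS]big_ord_recr /= (F0 m.*2.+1) ?addr0//= odd_double.
Qed.

(** This identity stands in for rotation invariance. It turns the even terms of the expansion of a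
    power [2m] of a sum, once averaged, into the binomial expansion of the power [m] of a sum of
    squares. *)
Lemma bin_gmom m l : (l <= m)%N ->
  'C(m.*2, l.*2)%:R * gmom (m - l) * gmom l = gmom m * 'C(m, l)%:R.
Proof.
move=> lm; have E1 := bin_fact lm.
have lm2 : (l.*2 <= m.*2)%N by rewrite leq_double.
have E2 := bin_fact lm2.
rewrite /gmom -E1 -E2 doubleB !natrM.
have -> : (4 ^+ m = 4 ^+ (m - l) * 4 ^+ l :> R) by rewrite -exprD subnK.
have f0 k : (k`!%:R != 0 :> R) by rewrite pnatr_eq0 -lt0n fact_gt0.
have c0 : ('C(m, l)%:R != 0 :> R) by rewrite pnatr_eq0 -lt0n bin_gt0.
by field; rewrite !f0 c0 !expf_neq0.
Qed.

Lemma Rintegral_sum d (T : measurableType d) (mu : {measure set T -> \bar R})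
    N (c : 'I_N -> R) (f : 'I_N -> T -> R) :
  (forall i, mu.-integrable setT (EFin \o f i)) ->
  mu.-integrable setT (EFin \o (fun x => \sum_(i < N) c i * f i x)) /\
  \int[mu]_x (\sum_(i < N) c i * f i x) = \sum_(i < N) c i * \int[mu]_x f i x.
Proof.
move=> fi.
have I0 i : mu.-integrable setT (EFin \o (fun x => c i * f i x)).
  by rewrite (_ : _ \o _ = (fun x => (c i)%:E * (EFin \o f i) x)%E)//; exact: integrableZl.
have E : EFin \o (fun x => \sum_(i < N) c i * f i x) =
    (fun x => \sum_(i < N) (c i * f i x)%:E)%E.
  by apply/funext => x; rewrite /= sumEFin.
split; first by rewrite E; apply: integrable_sum => // i _; exact: I0.
rewrite /Rintegral [X in fine X](_ : _ = \int[mu]_x (EFin \o (fun x => \sum_(i < N) c i * f i x)%R) x)%E//.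
rewrite E (integral_sum measurableT (f := fun i x => (c i * f i x)%:E))//.
rewrite (eq_bigr (fun i => (c i * Rintegral mu setT (f i))%:E)) ?sumEFin// => i _.
transitivity ((c i)%:E * (Rintegral mu setT (f i))%:E)%E; last by [].
rewrite /Rintegral fineK; last exact: (integrable_fin_num measurableT (fi i)).
by rewrite -(integralZl measurableT (fi i)).
Qed.

(** Induction on the dimension: [<a,u> = a0 t + <a',u'>] is expanded binomially, Fubini separates
    [t] from [u'], and [bin_gmom] reassembles the terms into [(a0^2 + |a'|^2)^m]. *)
Lemma gauss_moment_even n (a : n.-tuple R) m :
  \int[@mun R n]_u (dotp a u ^+ m.*2 * gauss u) =
  Num.sqrt pi ^+ n * dotp a a ^+ m * gmom m.
Proof.
elim: n a m => [|n IH] a m.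
  transitivity (\int[@mun R 0]_u (0 ^+ m * gauss u)).
    by apply: eq_Rintegral => u _; rewrite dotp0//; case: m => //= m; rewrite !expr0n.
  rewrite RintegralZl//; last exact: integrable_gauss.
  rewrite Rintegral_gauss dotp0// expr0 mul1r mulr1.
  case: m => [|m]; last by rewrite !expr0n/= mul0r.
  by rewrite expr0 /gmom fact0 expr0 !mul1r invr1.
set a0 := thead a; set a' := [tuple of behead a].
have aE : a = tcons (a0, a') by rewrite [LHS]tuple_eta.
rewrite {1}/Rintegral integral_mun_cons; last exact: integrable_expn_gauss.
pose M i := \int[@mun R n]_u (dotp a' u ^+ i * gauss u).
have inner t : (\int[@mun R n]_u (dotp a (tcons (t, u)) ^+ m.*2 * gauss (tcons (t, u)))%:E)%E =
    (\sum_(i < m.*2.+1) ((a0 * t) ^+ (m.*2 - i) *+ 'C(m.*2, i) * expR (- t ^+ 2)) * M i)%:E.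
  have [SI SE] := Rintegral_sum (mu := @mun R n)
     (fun i : 'I_m.*2.+1 => (a0 * t) ^+ (m.*2 - i) *+ 'C(m.*2, i) * expR (- t ^+ 2))
     (fun i => integrable_expn_gauss a' i).
  rewrite -SE /Rintegral fineK; last exact: integrable_fin_num.
  apply: eq_integral => u _; congr EFin; rewrite gauss_cons aE dotp_cons exprDn mulr_suml.
  by apply: eq_bigr => i _; rewrite -!mulrnAl !mulrA; congr (_ * _); rewrite mulrAC.
under eq_integral do rewrite inner.
pose c (l : 'I_m.+1) := a0 ^+ (m - l).*2 * 'C(m.*2, l.*2)%:R * M l.*2.
have i1 (j : nat) : lam.-integrable setT (EFin \o (fun t : R => t ^+ j.*2 * expR (- t ^+ 2))).
  apply/integrableP; split.
    apply/measurable_EFinP; apply: measurable_funM; last exact: measurable_gauss_fun.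
    exact: measurable_funX.
  under eq_integral => t _.
    rewrite /= ger0_norm; last by rewrite mulr_ge0 ?expR_ge0// -muln2 mulnC exprM exprn_ge0// sqr_ge0.
    over.
  by rewrite gauss_moment1 ltry.
(* The odd moments of [<a',u'>] vanish, so only even indices [i = 2l] survive; the exponent of [t]
   is then even as well. *)
have inner2 t : \sum_(i < m.*2.+1) ((a0 * t) ^+ (m.*2 - i) *+ 'C(m.*2, i) * expR (- t ^+ 2)) * M i =
    \sum_(l < m.+1) c l * (t ^+ (m - l).*2 * expR (- t ^+ 2)).
  rewrite (sum_even_terms m (F := fun i => (a0 * t) ^+ (m.*2 - i) *+ 'C(m.*2, i) * expR (- t ^+ 2) * M i)).
    apply: eq_bigr => l _; rewrite /c -doubleB exprMn -mulr_natr; ring.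
  by move=> i oi; rewrite [M i]gauss_moment_odd ?mulr0.
under eq_integral do rewrite inner2.
have [_ SE] := Rintegral_sum (mu := lam) c (fun l => i1 (m - l)%N).
rewrite -[LHS]/(Rintegral lam setT _) SE.
transitivity (\sum_(l < m.+1) Num.sqrt pi ^+ n.+1 * gmom m *
    ((a0 ^+ 2) ^+ (m - l) * (dotp a' a') ^+ l *+ 'C(m, l))).
  apply: eq_bigr => l _; rewrite /Rintegral gauss_moment1 /= /c /M IH.
  have lm : (l <= m)%N by rewrite -ltnS.
  rewrite -[X in _ = _ * X]mulr_natr -exprM mul2n exprS.
  have := bin_gmom lm; set g1 := gmom (m - l); set g2 := gmom l => E.
  transitivity (Num.sqrt pi * Num.sqrt pi ^+ n * a0 ^+ (m - l).*2 * dotp a' a' ^+ l * ('C(m.*2, l.*2)%:R * g1 * g2)).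
    by ring.
  by rewrite E; ring.
rewrite -mulr_sumr -exprDn [in RHS]aE dotp_cons -expr2.
by ring.
Qed.

End gaussian_moments.

(** * Term-by-term integration of the cosine series *)

Section cosine_series.
Context {R : realType} d (T : measurableType d).
Variable mu : {measure set T -> \bar R}.

(** The absolute values of the cosine terms are the even terms of the exponential series of
    [|t|]. *)
Lemma norm_cos_coeff'_sum_le (t : R) N :
  `|\sum_(m < N) cos_coeff' t m| <= expR `|t|.
Proof.
apply: le_trans (ler_norm_sum _ _ _) _.
have -> : \sum_(m < N) `|cos_coeff' t m| = \sum_(m < N) exp_coeff `|t| m.*2.
  apply: eq_bigr => m _; rewrite /cos_coeff' /exp_coeff -exprnP /= !normrM normrX.
  by rewrite normfV normr_nat normrX normrN1 expr1n mul1r.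
have le1 : \sum_(m < N) exp_coeff `|t| m.*2 <= \sum_(k < N.*2) exp_coeff `|t| k.
  have e0 k : 0 <= exp_coeff `|t| k by rewrite /exp_coeff/= divr_ge0// exprn_ge0.
  elim: N => [|N IH]; first by rewrite !big_ord0.
  by rewrite doubleS !big_ord_recr /= -addrA lerD// lerDl.
apply: le_trans le1 _; rewrite -(big_mkord xpredT (exp_coeff `|t|)).
apply: (nondecreasing_cvgn_le _ (is_cvg_series_exp_coeff _) N.*2).
by apply/nondecreasing_seqP => k; rewrite /series/= big_nat_recr//= lerDl divr_ge0// exprn_ge0.
Qed.

(** Dominated convergence for the partial sums, with majorant [exp(|t|) w]. It serves twice: with
    the Gaussian as weight it gives the Fourier transform of the Gaussian, with the indicator of the
    unit ball it gives the Bessel series. *)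
Lemma cos_moments (w t : T -> R) (a : nat -> R) :
  measurable_fun setT t -> measurable_fun setT w ->
  mu.-integrable setT (EFin \o (fun x => expR `|t x| * w x)) ->
  (forall x, 0 <= w x) ->
  (forall m, \int[mu]_x (t x ^+ m.*2 * w x) = a m) ->
  mu.-integrable setT (EFin \o (fun x => cos (t x) * w x)) /\
  series (fun m => (-1) ^+ m * a m / m.*2`!%:R) @ \oo --> \int[mu]_x (cos (t x) * w x).
Proof.
move=> mt mw ig w0 ta.
have mterm m : measurable_fun setT (fun x => t x ^+ m * w x).
  by apply: measurable_funM => //; exact: measurable_funX.
have im m : mu.-integrable setT (EFin \o (fun x => t x ^+ m * w x)).
  apply: le_integrable (integrableZl measurableT m`!%:R ig) => //.
    exact/measurable_EFinP.
  move=> x _; have h0 : 0 <= m`!%:R * (expR `|t x| * w x) by rewrite !mulr_ge0 ?expR_ge0.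
  rewrite /= lee_fin (ger0_norm h0) normrM normrX (ger0_norm (w0 x)) mulrA ler_wpM2r//.
  exact: exprn_le_expR.
pose S N (x : T) := \sum_(m < N) ((-1) ^+ m / m.*2`!%:R) * (t x ^+ m.*2 * w x).
have SE N x : S N x = (\sum_(m < N) cos_coeff' (t x) m) * w x.
  rewrite mulr_suml; apply: eq_bigr => m _; rewrite /cos_coeff' -exprnP; ring.
have iS N := (Rintegral_sum (fun m : 'I_N => (-1) ^+ m / m.*2`!%:R) (fun m => im m.*2)).
have mcos : measurable_fun setT (EFin \o (fun x => cos (t x) * w x)).
  apply/measurable_EFinP; apply: measurable_funM => //.
  by apply: measurableT_comp => //; apply: continuous_measurable_fun; exact: continuous_cos.
have mS N : measurable_fun setT (fun x => (S N x)%:E) by exact: (measurable_int _ (iS N).1).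
have cS : {ae mu, forall x, setT x -> (S N x)%:E @[N --> \oo] --> (cos (t x) * w x)%:E}.
  apply: aeW => x _.
  apply: cvg_EFin; first exact: nearW.
  rewrite (_ : _ \o _ = (fun N => series (cos_coeff' (t x)) N * w x)); last first.
    by apply/funext => N; rewrite /= SE /series/= big_mkord.
  by apply: cvgMl; exact: cvg_cos_coeff'.
have dS : {ae mu, forall x N, setT x -> (`|(S N x)%:E| <= (expR `|t x| * w x)%:E)%E}.
  apply: aeW => x N _; rewrite SE /= lee_fin normrM (ger0_norm (w0 x)) ler_wpM2r//.
  exact: norm_cos_coeff'_sum_le.
have [ic _ cv] := dominated_convergence measurableT mS mcos cS ig dS.
split; first exact: ic.
have fc := integrable_fin_num measurableT ic.
rewrite -(fineK fc) in cv.
move/fine_cvg : cv; rewrite (_ : _ \o _ = series (fun m => (-1) ^+ m * a m / m.*2`!%:R)).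
  by [].
apply/funext => N; rewrite /= /series/= big_mkord.
rewrite -[LHS]/(Rintegral mu setT (S N)) (iS N).2; apply: eq_bigr => m _.
by rewrite ta mulrAC.
Qed.

End cosine_series.

Section gaussian_fourier.
Context {R : realType}.

(** The factor [(2m)!] of [gmom m] cancels that of the cosine series, which leaves the exponential
    series of [-|a|^2/4]. *)
Lemma gauss_cos n (a : n.-tuple R) :
  (@mun R n).-integrable setT (EFin \o (fun u => cos (dotp a u) * gauss u)) /\
  \int[@mun R n]_u (cos (dotp a u) * gauss u) = Num.sqrt pi ^+ n * expR (- (dotp a a / 4)).
Proof.
have [ic cv] := cos_moments (measurable_dotpl a) (@measurable_gauss R n)
  (integrable_expR_gauss a) (@gauss_ge0 R n) (gauss_moment_even a).
split => //; apply: (cvg_unique _ cv) => //.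
have := @is_cvg_series_exp_coeff R (- (dotp a a / 4)).
rewrite -[cvgn _]/(series (exp_coeff (- (dotp a a / 4))) @ \oo --> expR (- (dotp a a / 4))) => ce.
rewrite (_ : series _ = (fun N => Num.sqrt pi ^+ n * series (exp_coeff (- (dotp a a / 4))) N)).
  by apply: cvgMr.
apply/funext => N; rewrite /series/= mulr_sumr; apply: eq_bigr => m _.
rewrite /exp_coeff/= /gmom [(- (_ / _)) ^+ m]exprNn exprMn exprVn.
have f0 k : k`!%:R != 0 :> R by rewrite pnatr_eq0 -lt0n fact_gt0.
by field; rewrite !f0 expf_neq0.
Qed.

End gaussian_fourier.

(** * Spherical means *)

Section ball.
Context {R : realType}.
Notation lam := (@lebesgue_measure R).
Notation rT := (measurableTypeR R).
Local Open Scope ereal_scope.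

(** Indexed by the squared radius, so that these are the sublevel sets of [dotp u u] and
    [layer_cake] applies without a square root. *)
Definition sqball n (t : R) : set (n.-tuple rT) := [set u | (dotp u u <= t)%R].

Lemma measurable_sqball n t : measurable (@sqball n t).
Proof.
rewrite -[X in measurable X]setTI; apply: measurable_fun_le => //.
exact: measurable_dotp.
Qed.

Definition ballint n (h : n.-tuple rT -> R) : \bar R :=
  \int[@mun R n]_(u in sqball 1) (h u)%:E.

(** Dilation by [sqrt t] maps the unit ball onto [sqball t]; the Jacobian contributes [sqrt t^n] and
    homogeneity [sqrt t^p]. *)
Lemma integral_sqball_homogeneous n (h : n.-tuple rT -> R) p (t : R) :
  measurable_fun setT h -> (forall u, 0 <= h u)%R ->
  (forall s u, (0 < s)%R -> h (vscale s u) = (s ^+ p * h u)%R) -> (0 < t)%R ->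
  \int[@mun R n]_(u in sqball t) (h u)%:E = (t `^ ((n + p)%:R / 2))%:E * ballint h.
Proof.
move=> mh h0 hp t0; set s := Num.sqrt t.
have s0 : (0 < s)%R by rewrite sqrtr_gt0.
have mf r : measurable_fun setT ((fun u => (h u)%:E) \_ (@sqball n r)).
  apply/(measurable_restrictT _ _).1; first exact: measurable_sqball.
  by apply/measurable_EFinP; exact: measurable_funTS.
have f0 r u : 0 <= ((fun u => (h u)%:E) \_ (@sqball n r)) u.
  by rewrite patchE; case: ifPn => // _; rewrite lee_fin.
have := ge0_integral_taff [tuple 0%R | i < n] (lt0r_neq0 s0) (mf t) (f0 t).
rewrite gtr0_norm// => E.
have E1 : \int[mun n]_x ((fun u => (h u)%:E) \_ (@sqball n t)) (taff s [tuple 0%R | i < n] x) =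
    (s ^+ p)%:E * ballint h.
  rewrite /ballint [in RHS]integral_mkcond.
  rewrite -(ge0_integralZl (mun n) measurableT (mf 1%R) (fun u _ => f0 1%R u)); last first.
    by rewrite lee_fin exprn_ge0// ltW.
  apply: eq_integral => u _; rewrite !patchE.
  have -> : (taff s [tuple 0%R | i < n] u \in @sqball n t) = (u \in @sqball n 1).
    have st : (s * s = t)%R by rewrite -expr2 sqr_sqrtr// ltW.
    apply/idP/idP; rewrite !inE /sqball/= -[taff _ _ u]/(vscale s u);
      by rewrite dotp_vscalel dotp_vscaler mulrA st ger_pMr.
  by case: ifPn => _; rewrite ?mule0// -EFinM -hp.
rewrite E1 -integral_mkcond in E.
have -> : (t `^ ((n + p)%:R / 2) = s ^+ n * s ^+ p)%R.
  rewrite -exprD mulrC powRrM powR12_sqrt ?ltW// powR_mulrn// sqrtr_ge0.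
by rewrite EFinM -muleA E muleA -EFinM exprVn divff ?mul1e// expf_neq0// gt_eqF.
Qed.

Lemma gauss_ballint n (h : n.-tuple rT -> R) p :
  measurable_fun setT h -> (forall u, 0 <= h u)%R ->
  (forall s u, (0 < s)%R -> h (vscale s u) = (s ^+ p * h u)%R) ->
  \int[@mun R n]_u (h u * gauss u)%:E = ballint h * GammaE ((n + p)%:R / 2 + 1).
Proof.
move=> mh h0 hp.
have mN : measurable_fun setT (fun u : n.-tuple rT => dotp u u) by exact: measurable_dotp.
have me : measurable_fun setT (fun t : R => expR (- t)) by apply: measurableT_comp.
have -> := @layer_cake R _ _ (mun n) h (fun u => dotp u u) (@gauss R n)
  (fun t => expR (- t)) ((n + p)%:R / 2) (ballint h) mh mN me h0.
- by congr (_ * _); apply: eq_integral => t _; rewrite addrK mulrC.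
- by move=> t _; exact: expR_ge0.
- by apply: integral_ge0 => u _; rewrite lee_fin.
- by move=> t t0; exact: integral_sqball_homogeneous.
- by move=> u; apply: integral_expRN; exact: dotpp_ge0.
Qed.

(** The weight integral of [layer_cake] for [w = (k+1) t^k] on [[0, 1[], needed with [q = n/2]. *)
Lemma integral_powR_weight (k : nat) (q : R) : (0 <= q)%R ->
  \int[lam]_(t in `]0%R, +oo[) ((k.+1%:R * t ^+ k * \1_(`[0%R, 1%R[%classic) t) * t `^ q)%:E
  = (k.+1%:R / (k.+1%:R + q))%:E.
Proof.
move=> q0; have kq : (0 < k.+1%:R + q)%R by rewrite ltr_pwDl.
transitivity (\int[lam]_(t in `]0%R, 1%R])
    ((k.+1%:R / (k.+1%:R + q))%:E * ((k.+1%:R + q) * t `^ (k.+1%:R + q - 1))%:E)); last first.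
  rewrite ge0_integralZl_EFin//; last 3 first.
  - by move=> t _; rewrite lee_fin mulr_ge0 ?powR_ge0// ltW.
  - by apply/measurable_EFinP; apply: measurable_funTS; apply: measurable_funM.
  - by rewrite divr_ge0// ltW.
  by rewrite integral_powR_itv_oc// powR1 mule1.
rewrite -integral_itv_bndo_bndc; last first.
  apply: measurable_funeM; apply/measurable_EFinP; apply: measurable_funTS.
  by apply: measurable_funM => //; exact: measurable_powR.
rewrite integral_mkcond [RHS]integral_mkcond; apply: eq_integral => t _.
rewrite !patchE !mem_setE !in_itv/= andbT indicE mem_setE in_itv/=.
case: (ltP 0%R t) => //= t0; rewrite (ltW t0)/=.
case: ifPn => _; last by rewrite mulr0 mul0r.
rewrite mulr1 -EFinM; congr EFin.
rewrite mulrA divfK ?gt_eqF// -mulrA; congr (_ * _)%R.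
have -> : (k.+1%:R + q - 1 = k%:R + q)%R by rewrite -natr1; ring.
by rewrite powRD ?(gt_eqF t0) ?implybT// powR_mulrn// ltW.
Qed.

Lemma integral_weight_tail (k : nat) (a : R) : (0 <= a)%R ->
  \int[lam]_(t in `]0%R, +oo[ `&` `[a, +oo[) (k.+1%:R * t ^+ k * \1_(`[0%R, 1%R[%classic) t)%:E
  = (if a <= 1 then 1 - a ^+ k.+1 else 0)%R%:E.
Proof.
move=> a0; have mX : measurable_fun setT (fun t : R => k.+1%:R * t ^+ k)%R.
  by apply: measurable_funM => //; exact: measurable_funX.
have [a1|a1] := ltP a 1%R; last first.
  rewrite integral0_eq; last first.
    move=> t [/=]; rewrite !in_itv/= !andbT => t0 at_.
    by rewrite indicE mem_setE in_itv/= ltNge (le_trans a1 at_) andbF mulr0.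
  have [a1'|//] := ltP a 1%R; first by rewrite ltNge a1 in a1'.
  case: ifPn => // a1''; have -> : a = 1%R by apply/eqP; rewrite eq_le a1 a1''.
  by rewrite expr1n subrr.
rewrite (ltW a1).
transitivity (\int[lam]_(t in `[a, 1%R]) (k.+1%:R * t ^+ k)%:E).
  rewrite -integral_itv_bndo_bndc; last by apply/measurable_EFinP; exact: measurable_funTS.
  rewrite (_ : `]0%R, +oo[ `&` `[a, +oo[ = if a == 0%R then `]a, +oo[%classic else `[a, +oo[%classic); last first.
    case: eqP => [->|/eqP an0].
      apply/seteqP; split => t /=; rewrite !in_itv/= !andbT; first by case.
      by move=> t0; split => //; exact: ltW.
    apply/seteqP; split => t /=; rewrite !in_itv/= !andbT; first by case.
    by move=> at_; split => //; rewrite (lt_le_trans _ at_)// lt0r an0.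
  transitivity (\int[lam]_(t in `[a, +oo[) (k.+1%:R * t ^+ k * \1_(`[0%R, 1%R[%classic) t)%:E).
    case: ifPn => // _; rewrite integral_itv_obnd_cbnd//.
    apply/measurable_EFinP; apply: measurable_funTS; exact: measurable_funM.
  rewrite integral_mkcond [RHS]integral_mkcond; apply: eq_integral => t _.
  rewrite !patchE !mem_setE !in_itv/= andbT indicE mem_setE in_itv/=.
  case: (leP a t) => //= at_; rewrite (le_trans a0 at_)/=.
  by case: ifPn => _; rewrite ?mulr1 ?mulr0.
rewrite (@continuous_FTC2 _ _ (fun t : R => t ^+ k.+1)%R _ _ a1).
- by rewrite expr1n.
- apply: continuous_subspaceT => x; apply: cvgMr; exact: exprn_continuous.
- split.
  + by move=> x _; exact: exprn_derivable.
  + by apply: cvg_at_right_filter; exact: exprn_continuous.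
  + by apply: cvg_at_left_filter; exact: exprn_continuous.
- by move=> x _; rewrite exp_derive1.
Qed.

(* Replaces polar coordinates: layer cake in [|u|^2] with the weight [(k+1) t^k] on
   [0, 1[, whose integral over [a, +oo[ is [1 - a^(k+1)]. *)
Lemma ballint_mul_sqnorm n (h : n.-tuple rT -> R) (k : nat) :
  measurable_fun setT h -> (forall u, 0 <= h u)%R ->
  (forall s u, (0 < s)%R -> h (vscale s u) = h u) ->
  ballint h * (k.+1%:R / (k.+1%:R + n%:R / 2))%:E +
    ballint (fun u => h u * dotp u u ^+ k.+1)%R = ballint h.
Proof.
move=> mh h0 hp.
have mN : measurable_fun setT (fun u : n.-tuple rT => dotp u u) by exact: measurable_dotp.
have mB := @measurable_sqball n 1.
pose w (t : R) := (k.+1%:R * t ^+ k * \1_(`[0%R, 1%R[%classic) t)%R.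
have mw : measurable_fun setT w.
  apply: measurable_funM; last exact: measurable_indic.
  by apply: measurable_funM => //; exact: measurable_funX.
pose W (u : n.-tuple rT) := (if dotp u u <= 1 then 1 - dotp u u ^+ k.+1 else 0)%R.
have := @layer_cake R _ _ (mun n) h (fun u => dotp u u) W w
  (n%:R / 2) (ballint h) mh mN mw h0.
rewrite integral_powR_weight ?divr_ge0// => <-; last 4 first.
- by move=> t t0; rewrite /w !mulr_ge0// ?exprn_ge0// ?ltW// indicE ler0n.
- by apply: integral_ge0 => u _; rewrite lee_fin.
- move=> t t0; rewrite (integral_sqball_homogeneous (p := 0) mh h0 _ t0) ?addn0//.
  by move=> s u s0; rewrite expr0 mul1r hp.
- by move=> u; exact: integral_weight_tail (dotpp_ge0 u).
have mW : measurable_fun setT W.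
  rewrite (_ : W = (fun u => (1 - dotp u u ^+ k.+1) * \1_(@sqball n 1) u)%R).
    apply: measurable_funM; last exact: measurable_indic.
    by apply: measurable_funB => //; exact: measurable_funX.
  apply/funext => u; rewrite /W indicE.
  have -> : (u \in @sqball n 1) = (dotp u u <= 1)%R by apply/idP/idP; rewrite inE.
  by case: ifPn => _; rewrite ?mulr1 ?mulr0.
have W0 u : (0 <= W u)%R.
  by rewrite /W; case: ifPn => // u1; rewrite subr_ge0 exprn_ile1// dotpp_ge0.
have gB u : 0 <= ((fun u => (h u * dotp u u ^+ k.+1)%:E) \_ (@sqball n 1)) u.
  by rewrite patchE; case: ifPn => // _; rewrite lee_fin mulr_ge0// exprn_ge0// dotpp_ge0.
rewrite /ballint [X in _ + X = _]integral_mkcond [RHS]integral_mkcond -ge0_integralD//; last 3 first.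
- by move=> u _; rewrite lee_fin mulr_ge0.
- by apply/measurable_EFinP; exact: measurable_funM.
- apply/(measurable_restrictT _ _).1 => //; apply/measurable_EFinP; apply: measurable_funTS.
  by apply: measurable_funM => //; exact: measurable_funX.
apply: eq_integral => u _; rewrite !patchE /W.
have -> : (u \in @sqball n 1) = (dotp u u <= 1)%R by apply/idP/idP; rewrite inE.
by case: ifPn => _; rewrite ?mulr0 ?adde0// -EFinD -mulrDr subrK mulr1.
Qed.

Lemma enorm_sqr n (u : n.-tuple R) : (enorm u ^+ 2 = dotp u u)%R.
Proof. by rewrite sqr_sqrtr// dotpp_ge0. Qed.

Lemma enorm_ge0 n (u : n.-tuple R) : (0 <= enorm u)%R.
Proof. exact: sqrtr_ge0. Qed.

Lemma tnth_le_enorm n (u : n.-tuple R) i : (`|tnth u i| <= enorm u)%R.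
Proof.
rewrite -sqrtr_sqr ler_sqrt ?dotpp_ge0// /dotp (bigD1 i)//= expr2 lerDl.
by apply: sumr_ge0 => j _; rewrite -expr2 sqr_ge0.
Qed.

(** Cruder than Cauchy-Schwarz, with the [l^1] norm of [a]; it follows coordinate by coordinate and
    suffices for domination. *)
Lemma norm_dotp_le_enorm n (a u : n.-tuple R) :
  (`|dotp a u| <= (\sum_(i < n) `|tnth a i|) * enorm u)%R.
Proof.
rewrite mulr_suml; apply: le_trans (ler_norm_sum _ _ _) _.
apply: ler_sum => i _; rewrite normrM ler_wpM2l//; exact: tnth_le_enorm.
Qed.

Lemma measurable_enorm n : measurable_fun setT (@enorm R n : n.-tuple rT -> R).
Proof.
have msq : measurable_fun setT (@Num.sqrt R).
  by apply: continuous_measurable_fun; exact: sqrt_continuous.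
by apply: (measurableT_comp msq); exact: measurable_dotp.
Qed.

(** The component of [a] in the direction of [u]; [a] is not normalized, so this is [|a|] times a
    cosine. Division by zero makes it 0 at [u = 0], which preserves the bound and the invariance
    under dilations. *)
Definition cosangle n (a u : n.-tuple R) : R := (dotp a u / enorm u)%R.

Lemma cosangle_le n (a u : n.-tuple R) : (`|cosangle a u| <= \sum_(i < n) `|tnth a i|)%R.
Proof.
rewrite /cosangle normrM normfV (ger0_norm (enorm_ge0 u)).
have := enorm_ge0 u; rewrite le_eqVlt => /predU1P[<-|u0].
  by rewrite invr0 mulr0 sumr_ge0.
by rewrite ler_pdivrMr// norm_dotp_le_enorm.
Qed.

Lemma measurable_cosangle n (a : n.-tuple R) :
  measurable_fun setT (cosangle a : n.-tuple rT -> R).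
Proof.
apply: measurable_funM; first exact: measurable_dotpl.
rewrite (_ : (fun u => _) = (fun u : n.-tuple rT => enorm u `^ (-1)))%R; last first.
  by apply/funext => u; rewrite powR_inv1// enorm_ge0.
exact: (measurableT_comp (measurable_powR (-1)%R) (@measurable_enorm n)).
Qed.

Lemma enorm_vscale n s (u : n.-tuple R) : (0 < s)%R -> (enorm (vscale s u) = s * enorm u)%R.
Proof.
move=> s0; rewrite /enorm dotp_vscalel dotp_vscaler mulrA sqrtrM -?expr2 ?sqr_ge0//.
by rewrite sqrtr_sqr gtr0_norm.
Qed.

Lemma cosangle_vscale n s (a u : n.-tuple R) : (0 < s)%R -> cosangle a (vscale s u) = cosangle a u.
Proof.
move=> s0; rewrite /cosangle dotp_vscaler enorm_vscale// invfM mulrACA divff ?mul1r//.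
by rewrite gt_eqF.
Qed.

(** The volume of the unit ball, read off from the Gaussian integral through [gauss_ballint]. An
    infinite volume is excluded because its product with a positive Gamma value would be
    infinite. *)
Lemma ballint1 n : ballint (fun _ : n.-tuple rT => 1%R) = (Num.sqrt pi ^+ n / Gamma (n%:R / 2 + 1))%:E.
Proof.
have G0 : (0 < Gamma (n%:R / 2 + 1 : R))%R.
  rewrite (_ : (_ + 1 = n.+2%:R / 2)%R) ?Gamma_gt0//.
  by rewrite -addn2 natrD; field.
have GE : GammaE (n%:R / 2 + 1) = (Gamma (n%:R / 2 + 1 : R))%:E.
  rewrite (_ : (_ + 1 = n.+2%:R / 2)%R) ?GammaE_Gamma//.
  by rewrite -addn2 natrD; field.
have := @gauss_ballint n (fun=> 1%R) 0 (measurable_cst _) (fun=> ler01) (fun s u _ => esym (mulr1 _)).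
rewrite addn0 GE (_ : \int[mun n]_u _ = (Num.sqrt pi ^+ n)%:E); last first.
  by rewrite -integral_gauss; apply: eq_integral => u _; rewrite mul1r.
case: (ballint _) => [c||].
- by rewrite -EFinM => -[->]; rewrite mulfK// gt_eqF.
- by rewrite gt0_mulye.
- by rewrite gt0_mulNye.
Qed.

(** [gauss_ballint] gives the ball integral of [<a,u>^(2m)] with the factor [1/Gamma((n+2m)/2 + 1)].
    Dividing the integrand by [|u|^(2m)] multiplies the integral by [(n+2m)/n], which lowers the
    Gamma argument by one. *)
Lemma ballint_cosangle n (a : n.-tuple R) m : (0 < n)%N ->
  ballint (fun u : n.-tuple rT => cosangle a u ^+ m.*2)%R =
  (Num.sqrt pi ^+ n / Gamma (n%:R / 2 + 1) *
   (Gamma (n%:R / 2) / Gamma ((n + m.*2)%:R / 2) * dotp a a ^+ m * gmom m))%:E.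
Proof.
move=> n0.
have X0 (t : R) : (0 <= t ^+ m.*2)%R by rewrite -muln2 mulnC exprM exprn_ge0// sqr_ge0.
(* [ballint_mul_sqnorm] has the exponent [k.+1], so [m = 0] is treated apart. *)
case: m X0 => [|k] X0.
  have -> : (fun u : n.-tuple rT => cosangle a u ^+ 0.*2)%R = (fun=> 1%R).
    by apply/funext => u; rewrite expr0.
  rewrite ballint1; congr EFin; rewrite addn0 divff ?gt_eqF ?Gamma_gt0// /gmom.
  by rewrite fact0 !expr0 !mul1r invr1 mulr1.
set h := (fun u : n.-tuple rT => cosangle a u ^+ k.+1.*2)%R.
have mh : measurable_fun setT h by apply: measurable_funX; exact: measurable_cosangle.
have h0 u : (0 <= h u)%R by exact: X0.
have hp s u : (0 < s)%R -> h (vscale s u) = h u by move=> s0; rewrite /h cosangle_vscale.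
have := ballint_mul_sqnorm k mh h0 hp.
have -> : (fun u => h u * dotp u u ^+ k.+1)%R = (fun u : n.-tuple rT => dotp a u ^+ k.+1.*2)%R.
  apply/funext => u; rewrite /h /cosangle -enorm_sqr -exprM mul2n -exprMn.
  have ad := norm_dotp_le_enorm a u.
  have [e0|u0] := eqVneq (enorm u) 0%R; last by rewrite divfK.
  by move: ad; rewrite e0 mulr0 normr_le0 => /eqP->; rewrite !mul0r.
(* Finiteness allows the extended-real identity of [ballint_mul_sqnorm] to be solved for one of its
   terms. *)
have fh : ballint h \is a fin_num.
  rewrite ge0_fin_numE; last by apply: integral_ge0 => u _; rewrite lee_fin.
  pose K := (\sum_(i < n) `|tnth a i|)%R.
  apply: (@le_lt_trans _ _ ((K ^+ k.+1.*2)%:E * ballint (fun _ : n.-tuple rT => 1%R))); last first.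
    by rewrite ballint1 -EFinM ltry.
  have mB := @measurable_sqball n 1.
  have K0 : (0 <= K ^+ k.+1.*2)%R by rewrite exprn_ge0// sumr_ge0.
  rewrite /ballint -ge0_integralZl_EFin//.
  apply: ge0_le_integral => //.
  - by move=> u _; rewrite lee_fin.
  - by apply/measurable_EFinP; exact: measurable_funTS.
  - by move=> u _; rewrite mule1 lee_fin -[h u]ger0_norm// normrX lerXn2r ?nnegrE ?sumr_ge0// cosangle_le.
have mg : measurable_fun setT (fun u : n.-tuple rT => dotp a u ^+ k.+1.*2)%R.
  by apply: measurable_funX; exact: measurable_dotpl.
have := @gauss_ballint n _ k.+1.*2 mg (fun u => X0 _)
   (fun s u _ => etrans (congr1 (fun z => z ^+ _)%R (dotp_vscaler s a u)) (exprMn _ _ _)).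
rewrite (_ : \int[mun n]_u _ = (Num.sqrt pi ^+ n * dotp a a ^+ k.+1 * gmom k.+1)%:E); last first.
  by rewrite -gauss_moment_even /Rintegral fineK//; exact: (integrable_fin_num measurableT (integrable_expn_gauss a _)).
have nk : (0 < n + k.+1.*2)%N by rewrite addn_gt0 n0.
rewrite GammaES ?divr_gt0 ?ltr0n// GammaE_Gamma// -EFinM.
have G0 : 0 < ((n + k.+1.*2)%:R / 2 * Gamma ((n + k.+1.*2)%:R / 2) : R)%:E.
  by rewrite lte_fin mulr_gt0 ?divr_gt0 ?ltr0n// Gamma_gt0.
rewrite GammaS// -(fineK fh); set c := fine _.
case: (ballint _) => [cg| |]; [|by rewrite gt0_mulye|by rewrite gt0_mulNye].
rewrite -!EFinM -EFinD => -[E1] [E2]; congr EFin.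
have G1 := @Gamma_gt0 R _ n0; have G2 := @Gamma_gt0 R _ nk.
have n0R : (n%:R != 0 :> R)%R by rewrite pnatr_eq0 -lt0n.
set x := (Num.sqrt pi ^+ n)%R in E1 *; set y := (dotp a a ^+ k.+1)%R in E1 *.
have nkE : ((n + k.+1.*2)%:R = n%:R + 2 * k.+1%:R :> R)%R by rewrite natrD -mul2n natrM.
(* The identity [c (k+1)/(k+1+n/2) + cg = c], solved for [cg]. *)
have cgE : (cg = c * (n%:R / (n%:R + 2 * k.+1%:R)))%R.
  apply: (addrI (c * (k.+1%:R / (k.+1%:R + n%:R / 2)))%R); rewrite E2.
  have : (0 < k.+1%:R :> R)%R by rewrite ltr0n.
  have : (0 < n%:R :> R)%R by rewrite ltr0n.
  move: (k.+1%:R : R)%R (n%:R : R)%R => K N N0 K0.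
  by field; repeat (apply/andP; split); apply: lt0r_neq0; lra.
apply: (@mulfI _ ((n%:R / 2) * Gamma ((n + k.+1.*2)%:R / 2))%R).
  by apply: lt0r_neq0; rewrite mulr_gt0 ?divr_gt0 ?ltr0n.
transitivity (x * y * gmom k.+1)%R.
  rewrite E1 cgE nkE; move: (Gamma _) => G.
  have : (0 < k.+1%:R :> R)%R by rewrite ltr0n.
  have : (0 < n%:R :> R)%R by rewrite ltr0n.
  move: (k.+1%:R : R)%R (n%:R : R)%R => K N N0 K0.
  by field; repeat (apply/andP; split); apply: lt0r_neq0; lra.
field.
by rewrite n0R !gt_eqF.
Qed.

End ball.

(** * The mean of the cosine as a Bessel series *)

Section spherical_average.
Context {R : realType}.
Notation rT := (measurableTypeR R).

Definition ballvol n : R := Num.sqrt pi ^+ n / Gamma (n%:R / 2 + 1).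

Lemma Gamma_half_succ_gt0 n : 0 < Gamma (n%:R / 2 + 1 : R).
Proof.
rewrite (_ : _ + 1 = n.+2%:R / 2) ?Gamma_gt0//.
by rewrite -addn2 natrD; field.
Qed.

Lemma ballvol_gt0 n : 0 < ballvol n.
Proof. by rewrite divr_gt0 ?Gamma_half_succ_gt0// exprn_gt0// sqrtr_gt0 pi_gt0. Qed.

Lemma ballint_cst n (K : R) : 0 <= K ->
  ballint (fun _ : n.-tuple rT => K) = (K * ballvol n)%:E.
Proof.
move=> K0; have mB := @measurable_sqball R n 1.
rewrite EFinM -ballint1 /ballint -ge0_integralZl_EFin//.
by apply: eq_integral => u _; rewrite mule1.
Qed.

Lemma ballintE n (h : n.-tuple rT -> R) :
  (\int[@mun R n]_u (h u * \1_(sqball 1) u)%:E)%E = ballint h.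
Proof.
rewrite /ballint [in RHS]integral_mkcond; apply: eq_integral => u _.
by rewrite patchE indicE; case: ifPn => _; rewrite ?mulr1 ?mulr0.
Qed.

Lemma integrable_sqball n (h : n.-tuple rT -> R) (K : R) :
  measurable_fun setT h -> (forall u, `|h u| <= K) ->
  (@mun R n).-integrable setT (EFin \o (fun u => h u * \1_(sqball 1) u)).
Proof.
move=> mh hK; have mB := @measurable_sqball R n 1.
have i1 : (@mun R n).-integrable setT (EFin \o (fun u => K * \1_(@sqball R n 1) u)).
  apply/integrableP; split.
    by apply/measurable_EFinP; apply: measurable_funM => //; exact: measurable_indic.
  rewrite (_ : \int[_]_x _ = \int[@mun R n]_u (`|K| * \1_(sqball 1) u)%:E)%E; last first.
    by apply: eq_integral => u _; rewrite /= normrM [X in _ * X]ger0_norm// indicE ler0n.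
  by rewrite (@ballintE n (fun=> `|K|)) ballint_cst// ltry.
apply: le_integrable i1 => //.
  by apply/measurable_EFinP; apply: measurable_funM => //; exact: measurable_indic.
move=> u _; rewrite /= lee_fin !normrM ler_wpM2r//.
by rewrite (le_trans (hK u))// ler_norm.
Qed.

(* [ballvol n] times the mean of [cos <a, u>] over the unit sphere. *)
Definition ballcos n (a : n.-tuple R) : R :=
  \int[@mun R n]_u (cos (cosangle a u) * \1_(sqball 1) u).

Lemma ballcos_series n (a : n.-tuple R) : (0 < n)%N ->
  series (fun m => (-1) ^+ m * (ballvol n *
    (Gamma (n%:R / 2) / Gamma ((n + m.*2)%:R / 2) * dotp a a ^+ m * gmom m)) / m.*2`!%:R)
  @ \oo --> ballcos a.
Proof.
move=> n0; have mB := @measurable_sqball R n 1.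
have mc := measurable_cosangle a.
apply: (cos_moments (mu := mun n) (w := \1_(sqball 1)) mc _ _ _ _).2.
- exact: measurable_indic.
- apply: (integrable_sqball (h := fun u => expR `|cosangle a u|)
    (K := expR (\sum_(i < n) `|tnth a i|))).
    by apply: measurableT_comp => //; apply: measurableT_comp.
  by move=> u; rewrite ger0_norm ?expR_ge0// ler_expR cosangle_le.
- by move=> u; rewrite indicE ler0n.
- by move=> m; rewrite /Rintegral ballintE ballint_cosangle.
Qed.

Lemma ballcos_dotp0 n (a : n.-tuple R) : (forall u, dotp a u = 0) -> ballcos a = ballvol n.
Proof.
move=> a0; rewrite /ballcos /Rintegral.
rewrite (_ : \int[_]_x _ = ballint (fun _ : n.-tuple rT => 1%R))%E.
  by rewrite ballint1.
by rewrite -ballintE; apply: eq_integral => u _; rewrite /cosangle a0 mul0r cos0.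
Qed.

Lemma enorm0_dotp n (x : n.-tuple R) : enorm x = 0 -> forall u, dotp x u = 0.
Proof.
move=> x0 u; have := norm_dotp_le_enorm u x.
by rewrite x0 mulr0 normr_le0 dotpC => /eqP.
Qed.

(** The series of [besselJ] is compared term by term with [ballcos_series]: [n/2 - 1 + m + 1] is the
    Gamma argument [(n+2m)/2] of the ball moments. At [x = 0] both sides are 1. *)
Lemma eta_formula_ballcos n (s : R) (x : n.-tuple R) : (0 < n)%N -> 0 < s ->
  eta_formula n s x = ballcos (vscale (2 * pi * s) x) / ballvol n.
Proof.
move=> n0 s0; have V0 := ballvol_gt0 n; rewrite /eta_formula.
case: eqP => [x0|/eqP xn0].
  rewrite ballcos_dotp0 ?divff ?gt_eqF// => u.
  by rewrite dotp_vscalel enorm0_dotp ?mulr0.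
have e0 : 0 < enorm x by rewrite lt0r xn0 enorm_ge0.
(* [z] is half of the Bessel argument, so the power in front of the series in [besselJ] is the
   denominator of [eta_formula]. *)
set z := pi * s * enorm x; have z0 : 0 < z by rewrite !mulr_gt0// pi_gt0.
have G0 := @Gamma_gt0 R _ n0.
rewrite /besselJ (_ : 2 * pi * s * enorm x / 2 = z); last by rewrite /z; field.
have p0 : 0 < z `^ (n%:R / 2 - 1) by rewrite powR_gt0.
set L := limn _.
suff -> : L = ballcos (vscale (2 * pi * s) x) / (ballvol n * Gamma (n%:R / 2)).
  by field; rewrite !gt_eqF.
apply/cvg_lim => //.
have := @ballcos_series n (vscale (2 * pi * s) x) n0; set S := series _ => cS.
have : (fun N => S N * (ballvol n * Gamma (n%:R / 2))^-1) @ \oo -->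
    ballcos (vscale (2 * pi * s) x) / (ballvol n * Gamma (n%:R / 2)).
  by apply: cvgMl; exact: cS.
apply: cvg_trans; apply: near_eq_cvg; near=> N.
rewrite /S /series/= mulr_suml; apply: eq_bigr => m _.
have f0 k : k`!%:R != 0 :> R by rewrite pnatr_eq0 -lt0n fact_gt0.
have Gm : 0 < Gamma ((n + m.*2)%:R / 2 : R) by rewrite Gamma_gt0// addn_gt0 n0.
have -> : n%:R / 2 - 1 + m%:R + 1 = (n + m.*2)%:R / 2 :> R.
  by rewrite natrD -mul2n natrM; field.
rewrite dotp_vscalel dotp_vscaler -enorm_sqr /gmom.
(* The resulting [4^m] cancels the one in [gmom m], as [(2m)!] does with the cosine coefficient. *)
have -> : 2 * pi * s * (2 * pi * s * enorm x ^+ 2) = 4 * z ^+ 2 by rewrite /z; ring.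
rewrite exprMn -exprM; field.
by rewrite !f0 !gt_eqF ?exprn_gt0.
Unshelve. all: by end_near. Qed.

Lemma norm_cosB1_le (t : R) : `|cos t - 1| <= `|t|.
Proof.
wlog t0 : t / 0 < t => [H|].
  have [->|tn0] := eqVneq t 0; first by rewrite cos0 subrr normr0.
  case: (ltgtP t 0) tn0 => // t0 _; last exact: H.
  by have := H (- t); rewrite cosN normrN oppr_gt0; apply.
have [c _ E] := @MVT R cos (fun x => - sin x) _ _ t0 (fun x _ => is_derive_cos x)
  (continuous_subspaceT (@continuous_cos R)).
rewrite -{1}cos0 E subr0 normrM normrN ler_piMl//.
by rewrite ler_norml sin_geN1 sin_le1.
Qed.

(** The mean of [|cos - 1|] is at most the supremum of [|cosangle a u|]. The bound is linear in [a],
    hence of order [s] when [a] is proportional to [s]. *)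
Lemma ballcos_dist n (a : n.-tuple R) :
  `|ballcos a / ballvol n - 1| <= \sum_(i < n) `|tnth a i|.
Proof.
have V0 := ballvol_gt0 n; have mB := @measurable_sqball R n 1.
set K := \sum_(i < n) _.
have mc := measurable_cosangle a.
have mcos : measurable_fun setT (@cos R).
  by apply: continuous_measurable_fun; exact: continuous_cos.
have mcc : measurable_fun setT (fun u : n.-tuple rT => cos (cosangle a u)).
  exact: (measurableT_comp mcos mc).
have c1 (u : n.-tuple rT) : `|cos (cosangle a u)| <= 1 by rewrite ler_norml cos_geN1 cos_le1.
have icos := integrable_sqball mcc c1.
have n1 : `|1 : R| <= 1 by rewrite normr1.
have i1 := integrable_sqball (n := n) (h := fun=> 1) (measurable_cst _) (fun=> n1).
have V1 : ballvol n = \int[@mun R n]_u (1 * \1_(sqball 1) u).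
  by rewrite /Rintegral (ballintE (fun=> 1)) ballint1.
have -> : ballcos a / ballvol n - 1 = (ballcos a - ballvol n) / ballvol n.
  by field; rewrite gt_eqF.
rewrite normrM normfV (gtr0_norm V0) ler_pdivrMr//.
have nK : `|K| <= K by rewrite ger0_norm// sumr_ge0.
have iK := integrable_sqball (n := n) (h := fun=> K) (measurable_cst _) (fun=> nK).
have iB : (@mun R n).-integrable setT
    (EFin \o (fun u => cos (cosangle a u) * \1_(sqball 1) u - 1 * \1_(sqball 1) u)).
  by have := integrableB measurableT icos i1.
rewrite {1}V1 -RintegralB//.
apply: le_trans (le_normr_Rintegral measurableT iB) _.
have -> : K * ballvol n = \int[@mun R n]_u (K * \1_(sqball 1) u).
  rewrite V1 -RintegralZl//; apply: eq_Rintegral => u _; by rewrite mul1r.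
apply: le_Rintegral => //.
  apply: (le_integrable measurableT _ _ iB); last by move=> u _; rewrite /= normr_id.
  apply/measurable_EFinP; apply: measurableT_comp => //; apply/measurable_EFinP.
  exact: measurable_int iB.
move=> u _; rewrite -mulrBl normrM [X in _ * X]ger0_norm ?indicE ?ler0n// ler_wpM2r ?ler0n//.
exact: le_trans (norm_cosB1_le _) (cosangle_le _ _).
Qed.

Lemma eta_formula_cvg0 n (x : n.-tuple R) : (0 < n)%N ->
  (fun s : R => eta_formula n s x) @ 0^'+ --> (1 : R).
Proof.
move=> n0; set C := 2 * pi * \sum_(i < n) `|tnth x i|.
have C0 (b : R) : (fun s : R => 1 + s * b) @ 0^'+ --> (1 : R).
  apply: cvg_at_right_filter; rewrite -[X in _ --> X]addr0 -[X in _ --> _ + X](mul0r b).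
  by apply: cvgD; [exact: cvg_cst|apply: cvgMl; exact: cvg_id].
apply: (squeeze_cvgr _ (C0 (- C)) (C0 C)).
near=> s; have s0 : 0 < s by near: s; exact: nbhs_right_gt.
rewrite eta_formula_ballcos//.
have := ballcos_dist (vscale (2 * pi * s) x).
have -> : \sum_(i < n) `|tnth (vscale (2 * pi * s) x) i| = s * C.
  rewrite /C !mulr_sumr; apply: eq_bigr => i _; rewrite tnth_vscale normrM.
  by rewrite ger0_norm ?mulr_ge0 ?pi_ge0 ?ltW//; ring.
by rewrite ler_norml => /andP[h1 h2]; apply/andP; split; lra.
Unshelve. all: by end_near. Qed.

End spherical_average.

(** * Limits of averages over the lens [B_R] and its translate *)

Section autocorrelation.
Context {R : realType}.
Notation rT := (measurableTypeR R).

Lemma integral_indic_sqball n (t : R) : 0 < t ->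
  (\int[@mun R n]_(u in sqball t) (1 : R)%:E)%E = (t `^ (n%:R / 2) * ballvol n)%:E.
Proof.
move=> t0.
rewrite (@integral_sqball_homogeneous R n (fun=> 1) 0 t (measurable_cst _) (fun=> ler01) _ t0).
  by rewrite addn0 ballint1 EFinM.
by move=> s u _; rewrite mulr1.
Qed.

Lemma mun_sqball n (t : R) : 0 < t ->
  (mun n) (@sqball R n t) = (t `^ (n%:R / 2) * ballvol n)%:E.
Proof.
move=> t0; rewrite -integral_indic_sqball// integral_cst ?mul1e//; exact: measurable_sqball.
Qed.

Definition sphere_sq n (t : R) : set (n.-tuple rT) := [set u | dotp u u = t].

Lemma measurable_sphere_sq n t : measurable (@sphere_sq n t).
Proof.
rewrite (_ : sphere_sq t = (fun u : n.-tuple rT => dotp u u) @^-1` [set t]); last by [].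
rewrite -[X in measurable X]setTI.
by apply: (measurable_dotp (f := id) (g := id)).
Qed.

Lemma bernoulli_le (e : R) n : 0 <= e <= 1 -> 1 - n%:R * e <= (1 - e) ^+ n.
Proof.
move=> /andP[e0 e1]; elim: n => [|n IH]; first by rewrite mul0r subr0 expr0.
rewrite exprS; apply: (@le_trans _ _ ((1 - e) * (1 - n%:R * e))).
  rewrite -natr1; have : 0 <= n%:R * e * e by rewrite !mulr_ge0.
  lra.
by apply: ler_wpM2l => //; rewrite subr_ge0.
Qed.

Lemma mun_eq0_small n (A : set (n.-tuple rT)) (C : R) : measurable A ->
  (forall e : R, 0 < e < 1 -> (mun n A <= (C * e)%:E)%E) -> mun n A = 0%E.
Proof.
move=> mA H; apply/eqP; rewrite eq_le measure_ge0 andbT.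
have C1 : 0 < `|C| + 1 by rewrite ltr_pwDr.
apply/lee_addgt0Pr => e e0; rewrite add0e.
pose d := Num.min (1 / 2) (e / (`|C| + 1)).
have d0 : 0 < d by rewrite lt_min !divr_gt0.
have d1 : d < 1 by rewrite gt_min; apply/orP; left; lra.
apply: le_trans (H d _) _; first by rewrite d0.
rewrite lee_fin; apply: (@le_trans _ _ ((`|C| + 1) * d)).
  by rewrite ler_pM2r// (le_trans (ler_norm _))// lerDl.
by rewrite -ler_pdivlMl// mulrC ge_min lexx orbT.
Qed.

Lemma sqr_powR_half (s : R) n : 0 <= s -> (s ^+ 2) `^ (n%:R / 2) = s ^+ n.
Proof.
move=> s0; rewrite -(powR_mulrn 2 s0) -powRrM.
have -> : 2%:R * (n%:R / 2) = n%:R :> R by field.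
exact: powR_mulrn.
Qed.

(** The sphere and the ball of radius [1 - e] are disjoint subsets of the unit ball, so the sphere
    has measure at most [(1 - (1-e)^n) V], where [V] is the volume of the unit ball; by Bernoulli
    this is at most [n e V]. *)
Lemma mun_sphere_sq1 n : mun n (@sphere_sq n 1) = 0%E.
Proof.
have mS := @measurable_sphere_sq n 1.
apply: (@mun_eq0_small n _ (n%:R * ballvol n)) => // e /andP[e0 e1].
have h1 : 0 <= 1 - e by lra.
have h2 : 1 - e <= 1 by lra.
have h3 : 1 - e < 1 by lra.
have s0 : 0 < (1 - e) ^+ 2 by rewrite exprn_gt0// subr_gt0.
have mB t := @measurable_sqball R n t.
have : (mun n (sphere_sq 1 `|` sqball ((1 - e) ^+ 2)) <= mun n (@sqball R n 1))%E.
  apply: le_measure; rewrite ?inE//; first exact: measurableU.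
  move=> u [u1|]; first by rewrite /sqball/= (u1 : dotp u u = 1).
  rewrite /sqball/= => /le_trans; apply.
  exact: exprn_ile1.
rewrite measureU//; last first.
  apply/seteqP; split => // u [] /=; rewrite /sqball/= => ->.
  by apply/negP; rewrite -ltNge exprn_ilt1.
rewrite !mun_sqball// powR1 mul1r.
rewrite -[X in (X <= _)%E -> _]/(mun n (sphere_sq 1) + mun n (@sqball R n ((1 - e) ^+ 2)))%E.
rewrite [X in (_ + X <= _)%E -> _](mun_sqball n s0) sqr_powR_half//.
rewrite -leeBrDr// => /le_trans; apply; rewrite -EFinB lee_fin.
have B : 1 - n%:R * e <= (1 - e) ^+ n by apply: bernoulli_le; rewrite !ltW.
have V0 := @ballvol_gt0 R n; have := ler_wpM2r (ltW V0) B; lra.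
Qed.

Lemma mun_sphere_sq0 n : (0 < n)%N -> mun n (@sphere_sq n 0) = 0%E.
Proof.
move=> n0; have mS := @measurable_sphere_sq n 0.
apply: (@mun_eq0_small n _ (ballvol n)) => // e /andP[e0 e1].
have s0 : 0 < e ^+ 2 by rewrite exprn_gt0.
have mB t := @measurable_sqball R n t.
have : (mun n (sphere_sq 0) <= mun n (@sqball R n (e ^+ 2)))%E.
  apply: le_measure; rewrite ?inE// => u u0; rewrite /sqball/= (u0 : dotp u u = 0); exact: ltW.
rewrite mun_sqball// => /le_trans; apply; rewrite lee_fin.
rewrite sqr_powR_half; last exact: ltW.
rewrite [leLHS]mulrC ler_pM2l ?ballvol_gt0//.
rewrite -(prednK n0) exprS ler_piMr ?(ltW e0)//.
by apply: exprn_ile1; rewrite ?(ltW e0) ?(ltW e1).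
Qed.

Lemma dotp_vsub n (u x : n.-tuple R) :
  dotp (vsub u x) (vsub u x) = dotp u u - 2 * dotp x u + dotp x x.
Proof.
rewrite /dotp mulr_sumr -sumrB -big_split/=; apply: eq_bigr => i _.
by rewrite !tnth_mktuple; ring.
Qed.

(* [|r u| - |r u - x|] tends to [<x, u>/|u|] as [r] tends to infinity, at rate [1/r]. *)
Lemma enorm_shift_bounds n (x u : n.-tuple R) (r : R) : 1 <= r -> 0 < enorm u ->
  let b := enorm u in let P := dotp x u in let X := dotp x x in
  let C1 := (2 * `|P| + X) / b in
  `|r * b - enorm (vsub (vscale r u) x)| <= C1 /\
  `|(r * b - enorm (vsub (vscale r u) x)) - P / b| <= (`|P| * C1 + X * b) / b ^+ 2 / r.
Proof.
move=> r1 b0 b P X C1; set q := enorm _.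
have r0 : 0 < r by lra.
have q0 : 0 <= q by exact: enorm_ge0.
have X0 : 0 <= X by exact: dotpp_ge0.
have qE : q ^+ 2 = r ^+ 2 * b ^+ 2 - 2 * r * P + X.
  rewrite enorm_sqr dotp_vsub !dotp_vscaler dotp_vscalel -enorm_sqr -/b -/P -/X; ring.
have rb0 : 0 < r * b by rewrite mulr_gt0.
(* The difference of norms is rationalized: the difference of squares has no term in [r^2]. *)
have dE : (r * b - q) * (r * b + q) = 2 * r * P - X.
  by transitivity (r ^+ 2 * b ^+ 2 - q ^+ 2); [ring|rewrite qE; ring].
have b1 : `|r * b - q| <= C1.
  rewrite /C1 ler_pdivlMr// -(ler_pM2l r0).
  apply: (@le_trans _ _ (`|r * b - q| * (r * b + q))).
    rewrite [leLHS]mulrCA ler_wpM2l// lerDl//.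
  have s0 : 0 <= r * b + q by lra.
  rewrite -[X in _ * X](ger0_norm s0) -normrM dE.
  apply: le_trans (ler_normB _ _) _; rewrite !normrM (ger0_norm X0) (gtr0_norm r0).
  rewrite (ger0_norm (_ : 0 <= 2 :> R))//.
  have : 0 <= (r - 1) * X by rewrite mulr_ge0// subr_ge0.
  lra.
split => //.
(* Subtracting the limit cancels the leading term, and the first bound controls what remains; the
   divisor [b (r b + q) >= r b^2] supplies the rate [1/r]. *)
have E : (r * b - q - P / b) * (b * (r * b + q)) = P * (r * b - q) - X * b.
  transitivity (b * ((r * b - q) * (r * b + q)) - P * (r * b + q)).
    by field; rewrite gt_eqF.
  by rewrite dE; ring.
have s0 : 0 < b * (r * b + q) by rewrite mulr_gt0// ltr_wpDr.
rewrite -(ler_pM2r s0) -{1}(gtr0_norm s0) -normrM E.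
apply: (@le_trans _ _ (`|P| * C1 + X * b)).
  apply: le_trans (ler_normB _ _) _; rewrite normrM.
  have Xb : 0 <= X * b by rewrite mulr_ge0// ltW.
  by rewrite (ger0_norm Xb) lerD2r ler_wpM2l.
have C0 : 0 <= `|P| * C1 + X * b.
  have hC1 : 0 <= C1 := le_trans (normr_ge0 _) b1.
  by apply: addr_ge0; apply: mulr_ge0 => //; exact: ltW.
rewrite -[leLHS]mulr1 -!mulrA ler_wpM2l//.
have -> : (b ^+ 2)^-1 * (r^-1 * (b * (r * b + q))) = 1 + q / (r * b).
  by field; rewrite !gt_eqF.
by rewrite lerDl divr_ge0// ltW.
Qed.

End autocorrelation.

(** * Convergence of the rescaled averages *)

Section lens_average.
Context {R : realType}.
Notation rT := (measurableTypeR R).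
Variables (n : nat) (n0 : (0 < n)%N) (r : R) (x : n.-tuple R) (phi : R -> R).
Hypothesis phic : continuous phi.
Hypothesis phi1 : forall t, `|phi t| <= 1.

Definition phase (y : n.-tuple R) : R := 2 * pi * r * (enorm y - enorm (vsub y x)).

(* For [phi = cos] and [phi = sin]: real and imaginary part of the integrand of
   the convolution that defines the autocorrelation at [x]. *)
Definition lens_fun (rho : R) (y : n.-tuple R) : R :=
  phi (phase y) * (\1_(sqball (rho ^+ 2)) y * \1_(sqball (rho ^+ 2)) (vsub y x)).

Lemma measurable_phi : measurable_fun setT phi.
Proof. exact: continuous_measurable_fun. Qed.

Lemma measurable_vsub : measurable_fun setT (fun y : n.-tuple rT => vsub y x : n.-tuple rT).
Proof.
apply/measurable_fun_tnthP => i.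
rewrite (_ : _ \o _ = (fun y => tnth y i - tnth x i)).
  by apply: measurable_funB => //; exact: measurable_tnth.
by apply/funext => y /=; rewrite tnth_mktuple.
Qed.

Lemma measurable_lens_fun rho : measurable_fun setT (lens_fun rho : n.-tuple rT -> R).
Proof.
have mv := measurable_vsub; have mB := @measurable_sqball R n (rho ^+ 2).
have m1 : measurable_fun setT (\1_(@sqball R n (rho ^+ 2)) : n.-tuple rT -> R) by exact: measurable_indic.
apply: measurable_funM; last first.
  by apply: measurable_funM => //; exact: (measurableT_comp m1 mv).
apply: (measurableT_comp measurable_phi); apply: measurable_funM => //.
apply: measurable_funB; first exact: measurable_enorm.
exact: (measurableT_comp (@measurable_enorm R n) mv).
Qed.

(** After [y = rho u] with [rho > 0] the first indicator is that of the unit ball, independent of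
    [rho]; as [|phi| <= 1] it is the majorant for dominated convergence. *)
Definition lens_scaled (rho : R) (u : n.-tuple R) : R := lens_fun rho (vscale rho u).

Lemma measurable_vscale s : measurable_fun setT (fun u : n.-tuple rT => vscale s u : n.-tuple rT).
Proof. exact: measurable_taff. Qed.

Lemma measurable_lens_scaled rho : measurable_fun setT (lens_scaled rho : n.-tuple rT -> R).
Proof. exact: (measurableT_comp (measurable_lens_fun rho) (measurable_vscale rho)). Qed.

Lemma sqball_vscale rho (u : n.-tuple R) : 0 < rho ->
  (\1_(@sqball R n (rho ^+ 2)) (vscale rho u) : R) = \1_(@sqball R n 1) u.
Proof.
move=> r0; rewrite !indicE; congr (nat_of_bool _)%:R.
have r2 : 0 < rho ^+ 2 by rewrite exprn_gt0.
by apply/idP/idP; rewrite !inE /sqball/= dotp_vscalel dotp_vscaler mulrA -expr2 ger_pMr.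
Qed.

Lemma lens_scaled_le rho (u : n.-tuple R) : 0 < rho ->
  `|lens_scaled rho u| <= 1 * \1_(@sqball R n 1) u.
Proof.
move=> r0; rewrite /lens_scaled /lens_fun sqball_vscale// normrM ler_pM//.
have i01 (S : set (n.-tuple rT)) (v : n.-tuple R) : 0 <= (\1_S v : R) <= 1.
  by rewrite indicE ler0n -[leRHS]/(1%:R) ler_nat leq_b1.
rewrite ger0_norm ?mulr_ge0 ?(andP (i01 _ _)).1// ler_piMr ?(andP (i01 _ _)).1 ?(andP (i01 _ _)).2//.
Qed.

Lemma integrable_sqball1 : (mun n).-integrable setT
  (EFin \o (fun u : n.-tuple rT => 1 * \1_(@sqball R n 1) u)).
Proof.
have e1 : `|1 : R| <= 1 by rewrite normr1.
exact: (integrable_sqball (h := fun=> 1) (measurable_cst _) (fun=> e1)).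
Qed.

Lemma integrable_lens_scaled rho : 0 < rho ->
  (mun n).-integrable setT (EFin \o (lens_scaled rho : n.-tuple rT -> R)).
Proof.
move=> r0; apply: (le_integrable measurableT _ _ integrable_sqball1).
  by apply/measurable_EFinP; exact: measurable_lens_scaled.
move=> u _; rewrite /= lee_fin (le_trans (lens_scaled_le u r0))//.
exact: ler_norm.
Qed.

Lemma lens_funE rho (y : n.-tuple R) : 0 < rho ->
  lens_fun rho y = lens_scaled rho (vscale rho^-1 y).
Proof.
move=> r0; rewrite /lens_scaled; congr lens_fun; apply: eq_from_tnth => i.
by rewrite !tnth_vscale mulVKf// gt_eqF.
Qed.

Lemma integrable_lens_fun rho : 0 < rho ->
  (mun n).-integrable setT (EFin \o (lens_fun rho : n.-tuple rT -> R)).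
Proof.
move=> r0; have ri : rho^-1 != 0 by rewrite invr_eq0 gt_eqF.
have := integrable_taff [tuple 0 | i < n] ri (integrable_lens_scaled r0).
by congr (integrable _ _ _); apply/funext => y; rewrite /= lens_funE.
Qed.

Lemma Rintegral_lens_fun rho : 0 < rho ->
  \int[mun n]_y lens_fun rho y = rho ^+ n * \int[mun n]_u lens_scaled rho u.
Proof.
move=> r0; have ri : rho^-1 != 0 by rewrite invr_eq0 gt_eqF.
have := Rintegral_taff [tuple 0 | i < n] ri (integrable_lens_scaled r0).
rewrite ger0_norm ?invr_ge0 ?ltW// invrK => <-.
by apply: eq_Rintegral => y _; rewrite lens_funE.
Qed.

Definition sphere_fun (u : n.-tuple R) : R :=
  phi (cosangle (vscale (2 * pi * r) x) u) * \1_(@sqball R n 1) u.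

(** Outside the closed unit ball everything is 0. Inside, away from the origin, the phase converges
    and the second indicator is eventually 1. On the unit sphere the second indicator depends on the
    sign of [<x, u>], which is why it is excluded. *)
Lemma lens_scaled_cvg (rho : nat -> R) (u : n.-tuple R) :
  (forall k, 1 <= rho k) -> rho @ \oo --> +oo ->
  dotp u u != 0 -> dotp u u != 1 ->
  lens_scaled (rho k) u @[k --> \oo] --> sphere_fun u.
Proof.
move=> r1 ry N0 N1.
have r0 k : 0 < rho k by rewrite (lt_le_trans _ (r1 k)).
have [Nlt|Nge] := ltP (dotp u u) 1; last first.
  have z : \1_(@sqball R n 1) u = 0 :> R.
    rewrite indicE memNset// /sqball/= => h.
    by move: N1; rewrite eq_le h Nge.
  rewrite /sphere_fun z mulr0.
  rewrite (_ : (fun k => _) = (fun=> 0)); first exact: cvg_cst.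
  by apply/funext => k; rewrite /lens_scaled /lens_fun sqball_vscale// z mul0r mulr0.
have z : \1_(@sqball R n 1) u = 1 :> R by rewrite indicE mem_set// /sqball/= ltW.
have b0 : 0 < enorm u by rewrite sqrtr_gt0 lt0r N0 dotpp_ge0.
have b1 : enorm u < 1.
  by rewrite -(@expr_lt1 _ 2)// ?enorm_ge0// enorm_sqr.
rewrite /sphere_fun z mulr1.
set b := enorm u in b0 b1.
set C1 := (2 * `|dotp x u| + dotp x x) / b.
set C2 := (`|dotp x u| * C1 + dotp x x * b) / b ^+ 2.
have H k := enorm_shift_bounds x (r1 k) b0; rewrite /= -/b -/C1 -/C2 in H.
have rinv : (rho k)^-1 @[k --> \oo] --> 0 by apply/gtr0_cvgV0 => //; exact: nearW.
have cd : rho k * b - enorm (vsub (vscale (rho k) u) x) @[k --> \oo] --> dotp x u / b.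
  apply/subr_cvg0; apply: norm_cvg0.
  apply: (squeeze_cvgr (f := fun=> 0) (h := fun k => C2 / rho k)).
  - by apply: nearW => k; rewrite normr_ge0 (H k).2.
  - exact: cvg_cst.
  - by rewrite -[X in _ --> X](mulr0 C2); apply: cvgMr.
have cph : phi (phase (vscale (rho k) u)) @[k --> \oo] -->
    phi (cosangle (vscale (2 * pi * r) x) u).
  have -> : cosangle (vscale (2 * pi * r) x) u = 2 * pi * r * (dotp x u / b).
    by rewrite /cosangle dotp_vscalel mulrA.
  apply: (@continuous_cvg _ _ _ _ _ _ phi); first exact: phic.
  apply: cvgMr; move: cd; apply: cvg_trans; apply: near_eq_cvg; near=> k.
  by rewrite enorm_vscale.
move: cph; apply: cvg_trans; apply: near_eq_cvg; near=> k.
rewrite /lens_scaled /lens_fun sqball_vscale// z mul1r.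
suff -> : \1_(@sqball R n (rho k ^+ 2)) (vsub (vscale (rho k) u) x) = 1 :> R by rewrite mulr1.
have rk0 := ltW (r0 k).
rewrite indicE mem_set// /sqball/= -enorm_sqr lerXn2r ?nnegrE ?enorm_ge0//.
have [+ _] := H k; rewrite ler_norml => /andP[h _].
(* For such [rho k] one has [|rho u - x| <= rho b + C1 <= rho], so the translated point stays in the
   ball. *)
have : C1 / (1 - b) <= rho k by near: k; move/cvgryPge : ry; apply.
rewrite ler_pdivrMr ?subr_gt0// mulrBr mulr1 => h2.
by apply: (@le_trans _ _ (rho k * b + C1)); lra.
Unshelve. all: by end_near. Qed.

Lemma measurable_sphere_fun : measurable_fun setT (sphere_fun : n.-tuple rT -> R).
Proof.
apply: measurable_funM; last by apply: measurable_indic; exact: measurable_sqball.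
exact: (measurableT_comp measurable_phi (measurable_cosangle _)).
Qed.

Lemma lens_scaled_integral_cvg (rho : nat -> R) :
  (forall k, 1 <= rho k) -> rho @ \oo --> +oo ->
  \int[mun n]_u lens_scaled (rho k) u @[k --> \oo] --> \int[mun n]_u sphere_fun u.
Proof.
move=> r1 ry; have r0 k : 0 < rho k by rewrite (lt_le_trans _ (r1 k)).
have mf k : measurable_fun setT (fun u : n.-tuple rT => (lens_scaled (rho k) u)%:E).
  by apply/measurable_EFinP; exact: measurable_lens_scaled.
have mF : measurable_fun setT (fun u : n.-tuple rT => (sphere_fun u)%:E).
  by apply/measurable_EFinP; exact: measurable_sphere_fun.
have cF : {ae mun n, forall u, setT u ->
    (lens_scaled (rho k) u)%:E @[k --> \oo] --> (sphere_fun u)%:E}.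
  (* The exceptional null set consists of the origin, where [u/|u|] is undefined, and the unit
     sphere. *)
  exists (@sphere_sq R n 0 `|` @sphere_sq R n 1); split.
  - by apply: measurableU; exact: measurable_sphere_sq.
  - apply/eqP; rewrite eq_le measure_ge0 andbT.
    apply: le_trans (measureU2 _ _ _) _; [exact: measurable_sphere_sq|exact: measurable_sphere_sq|].
    by rewrite [X in (X + _)%E]mun_sphere_sq0// [X in (_ + X)%E]mun_sphere_sq1 adde0.
  - move=> u /= nc; apply: contrapT => /not_orP[N0 N1]; apply: nc => _.
    apply: cvg_EFin; first exact: nearW.
    by apply: lens_scaled_cvg => //; apply/eqP.
have dF : {ae mun n, forall u k, setT u ->
    (`|(lens_scaled (rho k) u)%:E| <= (1 * \1_(@sqball R n 1) u)%:E)%E}.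
  by apply: aeW => u k _; rewrite lee_fin lens_scaled_le.
have [ic _ cv] := dominated_convergence measurableT mf mF cF integrable_sqball1 dF.
have fc := integrable_fin_num measurableT ic.
rewrite -(fineK fc) in cv.
exact: (fine_cvg cv).
Qed.

Lemma lens_average_cvg :
  (\int[mun n]_y lens_fun rho y / (rho ^+ n * ballvol n)) @[rho --> +oo] -->
  \int[mun n]_u sphere_fun u / ballvol n.
Proof.
apply/cvg_pinftyP => u uy.
(* The limit at infinity is tested on sequences. The maximum enforces [1 <= rho k] for every [k], as
   the norm bounds require, and changes only finitely many terms. *)
pose rho k := Num.max 1 (u k).
have r1 k : 1 <= rho k by rewrite le_max lexx.
have ur : \forall k \near \oo, u k = rho k.
  have : \forall k \near \oo, 1 <= u k by move/cvgryPge : uy; apply.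
  by apply: filterS => k uk; rewrite /rho max_r.
have ry : rho @ \oo --> +oo.
  apply/cvgryPge => A; have : \forall k \near \oo, A <= u k by move/cvgryPge : uy; apply.
  by apply: filterS => k uk; rewrite le_max uk orbT.
have c : \int[mun n]_u lens_scaled (rho k) u / ballvol n @[k --> \oo] --> \int[mun n]_u sphere_fun u / ballvol n.
  by apply: cvgMl; exact: lens_scaled_integral_cvg.
move: c; apply: cvg_trans; apply: near_eq_cvg; apply: filterS ur => k ->.
have r0 : 0 < rho k by rewrite (lt_le_trans _ (r1 k)).
rewrite Rintegral_lens_fun//; have V0 := @ballvol_gt0 R n.
have rn : 0 < rho k ^+ n by rewrite exprn_gt0.
by field; rewrite !gt_eqF.
Qed.

End lens_average.

(** * Fourier inversion at the origin *)

Section separately_continuous.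
Context {R : realType}.
Notation rT := (measurableTypeR R).

Lemma setcoordE n (x : n.-tuple R) i t j :
  tnth (setcoord x i t) j = if j == i then t else tnth x j.
Proof. by rewrite tnth_mktuple. Qed.

Lemma setcoord_id n (x : n.-tuple R) i s t :
  setcoord (setcoord x i s) i t = setcoord x i t.
Proof. by apply: eq_from_tnth => j; rewrite !setcoordE; case: eqP. Qed.

Lemma setcoord_self n (x : n.-tuple R) i : setcoord x i (tnth x i) = x.
Proof. by apply: eq_from_tnth => j; rewrite setcoordE; case: eqP => [->|]. Qed.

Lemma setcoord_ord0 n s t (x : n.-tuple R) :
  setcoord (tcons (s, x)) ord0 t = tcons (t, x).
Proof.
apply: eq_from_tnth => j; rewrite setcoordE.
case: (unliftP ord0 j) => [k ->|->]; last by rewrite eqxx tnth0.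
by rewrite eq_sym (negbTE (neq_lift _ _)) !tnthS.
Qed.

Lemma setcoord_lift n s t (x : n.-tuple R) i :
  setcoord (tcons (s, x)) (lift ord0 i) t = tcons (s, setcoord x i t).
Proof.
apply: eq_from_tnth => j; rewrite setcoordE.
case: (unliftP ord0 j) => [k ->|->]; last by rewrite (negbTE (neq_lift _ _)) !tnth0.
by rewrite (inj_eq lift_inj) !tnthS setcoordE.
Qed.

Lemma measurable_bigcup_countType d (T : measurableType d) (I : countType) (F : I -> set T) :
  (forall i, measurable (F i)) -> measurable (\bigcup_i F i).
Proof.
move=> mF.
rewrite (_ : \bigcup_i F i = \bigcup_(k : nat) (if unpickle k is Some i then F i else set0)).
  by apply: bigcupT_measurable => k; case: unpickle.
apply/seteqP; split => [x [i _ Fi]|x [k _]].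
  by exists (pickle i) => //; rewrite pickleK.
by case: unpickle => // i Fi; exists i.
Qed.

(** The first variable is rounded down to a multiple of [1/(k+1)]. On each of countably many strips
    the rounded function depends measurably on the second variable alone, and by continuity it tends
    to [g]. *)
Lemma measurable_caratheodory d (T : measurableType d) (g : rT * T -> R) :
  (forall x, continuous (fun t : R => g (t, x))) ->
  (forall t, measurable_fun setT (fun x => g (t, x))) ->
  measurable_fun setT g.
Proof.
move=> gc gm.
pose q (k : nat) (t : R) : R := (Num.floor (k.+1%:R * t))%:~R / k.+1%:R.
have qc t : q k t @[k --> \oo] --> t.
  apply/cvgrPdist_le => e e0; near=> k.
  have k0 : 0 < k.+1%:R :> R by [].
  have := floor_itv (k.+1%:R * t); rewrite intrD1.
  rewrite /q; move: (Num.floor _)%:~R => z /andP[h2 h1].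
  have -> : t - z / k.+1%:R = (k.+1%:R * t - z) / k.+1%:R by field; rewrite gt_eqF.
  rewrite ger0_norm ?divr_ge0 ?subr_ge0// ler_pdivrMr//.
  have : 1 / e <= k.+1%:R.
    near: k; exists (Num.truncn (1 / e)) => // k /= Nk.
    by rewrite (le_trans (ltW (Num.Theory.truncnS_gt _)))// ler_nat ltnS.
  rewrite ler_pdivrMr// mulrC; lra.
apply: (measurable_fun_cvg (h := fun k p => g (q k p.1, p.2))) => //; last first.
  move=> [t x] _ /=.
  by apply: (cvg_comp (fun k => q k t) (fun s => g (s, x)) (qc t)); exact: gc.
move=> k _ B mB; rewrite setTI.
pose F (z : int) : set (rT * T) :=
  [set p | Num.floor (k.+1%:R * p.1) = z] `&` [set p | B (g (z%:~R / k.+1%:R, p.2))].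
rewrite (_ : _ @^-1` B = \bigcup_z F z); last first.
  apply/seteqP; split => [p Bp|p [z _ [<- //]]].
  by exists (Num.floor (k.+1%:R * p.1)).
apply: measurable_bigcup_countType => z; apply: measurableI.
  have mfl : measurable_fun setT (fun p : rT * T => k.+1%:R * p.1) by apply: measurable_funM.
  rewrite (_ : [set p | _] = (fun p : rT * T => k.+1%:R * p.1) @^-1` `[z%:~R, (z + 1)%:~R[%classic).
    by rewrite -[X in measurable X]setTI; apply: mfl.
  apply/seteqP; split => p /=; rewrite in_itv/=.
    by move=> <-; exact: floor_itv.
  by move=> /floor_def.
rewrite (_ : [set p | _] = setT `*` ((fun x => g (z%:~R / k.+1%:R, x)) @^-1` B)).
  apply: measurableX => //; rewrite -[X in measurable X]setTI; exact: gm.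
by apply/seteqP; split => [p|p []].
Unshelve. all: by end_near. Qed.

(** Splitting off one coordinate at a time, with the previous lemma as inductive step. It makes
    Schwartz functions measurable without joint continuity. *)
Lemma measurable_separately_continuous n (f : n.-tuple rT -> R) :
  (forall i x, continuous (fun t : R => f (setcoord x i t))) -> measurable_fun setT f.
Proof.
elim: n f => [|n IH] f fc.
  rewrite (_ : f = cst (f [tuple])); first exact: measurable_cst.
  by apply/funext => x; rewrite (tuple0 x).
rewrite (_ : f = (fun p => f (tcons p)) \o @tuncons R n); last first.
  by apply/funext => x /=; rewrite tunconsK.
apply: measurableT_comp; last exact: measurable_tuncons.
apply: measurable_caratheodory => [x|t].
  have := fc ord0 (tcons (0, x)).
  by under eq_fun do rewrite setcoord_ord0.
apply: IH => i x.
have := fc (lift ord0 i) (tcons (t, x)).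
by under eq_fun do rewrite setcoord_lift.
Qed.

End separately_continuous.

(** * An integrable product weight *)

Section decay.
Context {R : realType}.
Notation rT := (measurableTypeR R).
Notation lam := (@lebesgue_measure R).

(* Integrable majorant for Schwartz functions and their Fourier transforms. *)
Definition cauchyw n (x : n.-tuple R) : R := \prod_(i < n) (1 + tnth x i ^+ 2)^-1.

Lemma cauchyw_ge0 n (x : n.-tuple R) : 0 <= cauchyw x.
Proof. by apply: prodr_ge0 => i _; rewrite invr_ge0 addr_ge0// sqr_ge0. Qed.

Lemma oneDsq_gt0 (t : R) : 0 < 1 + t ^+ 2.
Proof. by rewrite ltr_pwDl// sqr_ge0. Qed.

Lemma measurable_inv_oneDsq : measurable_fun setT (fun t : R => (1 + t ^+ 2)^-1).
Proof.
apply: continuous_measurable_fun => t.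
apply: cvgV; first by rewrite gt_eqF// oneDsq_gt0.
by apply: cvgD; [exact: cvg_cst|exact: exprn_continuous].
Qed.

Lemma measurable_cauchyw n : measurable_fun setT (@cauchyw n : n.-tuple rT -> R).
Proof.
apply: measurable_prod => i *; apply: (measurableT_comp measurable_inv_oneDsq).
exact: measurable_tnth.
Qed.

Lemma cauchyw_cons n t (x : n.-tuple R) :
  cauchyw (tcons (t, x)) = (1 + t ^+ 2)^-1 * cauchyw x.
Proof.
rewrite /cauchyw big_ord_recl tnth0; congr (_ * _).
by apply: eq_bigr => i _; rewrite tnthS.
Qed.

Lemma integral_inv_oneDsq : (\int[lam]_t ((1 + t ^+ 2)^-1)%:E)%E = pi%:E :> \bar R.
Proof.
have h := @ge0_symfun_integralT R (fun t => (1 + t ^+ 2)^-1).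
rewrite h//.
- rewrite (_ : \int[lam]_(x in _) _ = (pi / 2)%:E)%E.
    by rewrite -EFinM; congr EFin; field.
  by rewrite -integral0y_oneDsqr set_itvcy.
- by move=> t; rewrite invr_ge0 ltW// oneDsq_gt0.
- by move=> t; apply: cvgV; [rewrite gt_eqF// oneDsq_gt0|apply: cvgD; [exact: cvg_cst|exact: exprn_continuous]].
- by move=> t; rewrite /= sqrrN.
Qed.

Lemma integral_cauchyw n : (\int[@mun R n]_x (cauchyw x)%:E)%E = (pi ^+ n)%:E.
Proof.
elim: n => [|n IH].
  rewrite integral_dirac//; last by apply/measurable_EFinP; exact: measurable_cauchyw.
  by rewrite diracT mul1e /cauchyw big_ord0 expr0.
have mi : measurable_fun setT (fun t : R => ((1 + t ^+ 2)^-1)%:E).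
  by apply/measurable_EFinP; exact: measurable_inv_oneDsq.
have i0 (t : R) : 0 <= (1 + t ^+ 2)^-1 by rewrite invr_ge0 ltW// oneDsq_gt0.
rewrite ge0_integral_mun_cons//; last first.
- by move=> x; rewrite lee_fin cauchyw_ge0.
- by apply/measurable_EFinP; exact: measurable_cauchyw.
under eq_integral => t _.
  under eq_integral => x _ do rewrite cauchyw_cons EFinM.
  rewrite ge0_integralZl_EFin//; last 2 first.
  - by move=> x _; rewrite lee_fin cauchyw_ge0.
  - by apply/measurable_EFinP; exact: measurable_cauchyw.
  rewrite IH muleC; over.
have p0 : 0 <= pi ^+ n :> R by rewrite exprn_ge0// pi_ge0.
rewrite ge0_integralZl_EFin//.
  by rewrite integral_inv_oneDsq -EFinM exprSr.
by move=> t _; rewrite lee_fin i0.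
Qed.

Lemma integrable_cauchyw n : (@mun R n).-integrable setT (EFin \o @cauchyw n).
Proof.
apply/integrableP; split; first by apply/measurable_EFinP; exact: measurable_cauchyw.
under eq_integral do rewrite /= ger0_norm ?cauchyw_ge0//.
by rewrite integral_cauchyw ltry.
Qed.

Lemma integrable_le_cauchyw n (h : n.-tuple rT -> R) (C : R) :
  measurable_fun setT h -> (forall x, `|h x| <= C * cauchyw x) ->
  (@mun R n).-integrable setT (EFin \o h).
Proof.
move=> mh hC; apply: (le_integrable measurableT _ _
   (integrableZl measurableT C (integrable_cauchyw n))).
  exact/measurable_EFinP.
by move=> x _; rewrite /= lee_fin (le_trans (hC x))// ler_norm.
Qed.

(** Lets a majorant at the intermediate point of a mean value argument be replaced by one at [x]
    itself. *)
Lemma cauchyw_setcoord n (x : n.-tuple R) i s : `|s| <= 1 ->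
  cauchyw (setcoord x i (tnth x i + s)) <= 3 * cauchyw x.
Proof.
move=> s1; rewrite /cauchyw (bigD1 i)//= [X in _ <= _ * X](bigD1 i)//= mulrA.
rewrite setcoordE eqxx.
rewrite (eq_bigr (fun j => (1 + tnth x j ^+ 2)^-1)) => [|j ji]; last first.
  by rewrite setcoordE (negbTE ji).
rewrite ler_wpM2r//; first by apply: prodr_ge0 => j _; rewrite invr_ge0 ltW// oneDsq_gt0.
rewrite -[leLHS]mul1r ler_pdivrMr ?oneDsq_gt0// mulrAC ler_pdivlMr ?oneDsq_gt0// mul1r.
have s2 : s ^+ 2 <= 1 by rewrite -(real_normK (num_real s)) exprn_ile1.
(* With [t = tnth x i], [3 (1 + (t+s)^2) - (1 + t^2)] equals [(2t + 3s)^2/2 + 2 - 3 s^2/2], which is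
   positive for [|s| <= 1]. *)
have := sqr_ge0 (2 * tnth x i + 3 * s); nra.
Qed.

(** Converts the Euclidean decay in the definition of [schwartz], taken with [k = 2n], into decay
    like the product weight. *)
Lemma inv_cauchyw_le n (x : n.-tuple R) :
  \prod_(i < n) (1 + tnth x i ^+ 2) <= (1 + enorm x) ^+ (2 * n).
Proof.
rewrite exprM -[X in _ <= _ ^+ X]card_ord -prodr_const; apply: ler_prod => i _.
rewrite ltW ?oneDsq_gt0//=.
have h := tnth_le_enorm x i; have e0 := enorm_ge0 x.
have : tnth x i ^+ 2 <= enorm x ^+ 2.
  by rewrite -(real_normK (num_real (tnth x i))) lerXn2r ?nnegrE.
rewrite sqrrD expr1n; lra.
Qed.

End decay.

(** * Schwartz functions and the decay of their transforms *)

Section schwartz_theory.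
Context {R : realType}.
Notation rT := (measurableTypeR R).
Variable n : nat.
Implicit Types f g : n.-tuple R -> R.

Lemma pderivs_cat (l1 l2 : seq 'I_n) f : pderivs (l1 ++ l2) f = pderivs l1 (pderivs l2 f).
Proof. by elim: l1 => //= i l1 ->. Qed.

Lemma schwartz_pderiv i f : schwartz f -> schwartz (pderiv i f).
Proof. by move=> sf l; have := sf (l ++ [:: i]); rewrite pderivs_cat. Qed.

Lemma schwartz_is_derive f i (x : n.-tuple R) (t : R) : schwartz f ->
  is_derive t 1 (fun s : R => f (setcoord x i s)) (pderiv i f (setcoord x i t)).
Proof.
move=> sf; have [/(_ i (setcoord x i t)) + _] := sf [::].
rewrite /pderivable /pderiv setcoordE eqxx /=.
have -> : (fun s => f (setcoord (setcoord x i t) i s)) = (fun s => f (setcoord x i s)).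
  by apply/funext => s; rewrite setcoord_id.
by move=> D; rewrite derive1E; apply: DeriveDef.
Qed.

Lemma schwartz_measurable f : schwartz f -> measurable_fun setT (f : n.-tuple rT -> R).
Proof.
move=> sf; apply: measurable_separately_continuous => i x t.
apply: differentiable_continuous; apply/derivable1_diffP.
by have [] := schwartz_is_derive i x t sf.
Qed.

Lemma schwartz_le_cauchyw f : schwartz f ->
  exists2 C : R, 0 <= C & forall x : n.-tuple R, `|f x| <= C * cauchyw x.
Proof.
move=> /(_ [::])[_ /(_ (2 * n)%N)[C hC]]; exists C.
  by apply: le_trans (hC (@vzero R n)); rewrite mulr_ge0// exprn_ge0// addr_ge0// enorm_ge0.
move=> x; have p0 : 0 < \prod_(i < n) (1 + tnth x i ^+ 2).
  by apply: prodr_gt0 => i _; exact: oneDsq_gt0.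
rewrite /cauchyw prodfV ler_pdivlMr// mulrC.
by apply: le_trans (hC x); rewrite ler_wpM2r// inv_cauchyw_le.
Qed.

(** The difference quotients in direction [i] have integral 0 by translation invariance and converge
    to [G']. This replaces integration by parts, without boundary terms. *)
Lemma integral_pderiv0 (G G' : n.-tuple R -> R) (i : 'I_n) (C : R) :
  measurable_fun setT (G : n.-tuple rT -> R) ->
  (mun n).-integrable setT (EFin \o (G : n.-tuple rT -> R)) ->
  (forall (x : n.-tuple R) (t : R), is_derive t 1 (fun s : R => G (setcoord x i s)) (G' (setcoord x i t))) ->
  (forall x : n.-tuple R, `|G' x| <= C * cauchyw x) ->
  measurable_fun setT (G' : n.-tuple rT -> R) ->
  \int[mun n]_x G' x = 0.
Proof.
move=> mG iG dG G'C mG'.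
have C0 : 0 <= C * cauchyw (@vzero R n) by apply: le_trans (G'C _).
have {}C0 : 0 <= C.
  by move: C0; rewrite pmulr_lge0// /cauchyw prodr_gt0// => j _; rewrite invr_gt0 oneDsq_gt0.
pose h (k : nat) : R := k.+1%:R^-1.
have h0 k : 0 < h k by rewrite invr_gt0.
have h1 k : h k <= 1 by rewrite invf_le1// ler1n.
pose e k : n.-tuple R := [tuple if j == i then h k else 0 | j < n].
have te k (x : n.-tuple R) : taff 1 (e k) x = setcoord x i (tnth x i + h k).
  apply: eq_from_tnth => j; rewrite !tnth_mktuple mul1r.
  by case: eqP => [->|_] //; rewrite addr0.
have n1 : 1 != 0 :> R by exact: oner_neq0.
have iGe k := integrable_taff (e k) n1 iG.
pose D k (x : n.-tuple R) := (h k)^-1 * (G (taff 1 (e k) x) - G x).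
have iD k : (mun n).-integrable setT (EFin \o (D k : n.-tuple rT -> R)).
  exact: (integrableZl measurableT (h k)^-1 (integrableB measurableT (iGe k) iG)).
have D0 k : \int[mun n]_x D k x = 0.
  rewrite RintegralZl//; last exact: (integrableB measurableT (iGe k) iG).
  rewrite RintegralB//; last exact: iGe.
  rewrite (Rintegral_taff (e k) n1 iG) normr1 invr1 expr1n mul1r subrr mulr0 //.
have mD k : measurable_fun setT (fun x : n.-tuple rT => (D k x)%:E) by exact: (measurable_int _ (iD k)).
have mG'E : measurable_fun setT (fun x : n.-tuple rT => (G' x)%:E) by exact/measurable_EFinP.
have hc : h k @[k --> \oo] --> 0 by exact: cvg_harmonic.
have cD : {ae mun n, forall x, setT x -> (D k x)%:E @[k --> \oo] --> (G' x)%:E}.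
  apply: aeW => x _; apply: cvg_EFin; first exact: nearW.
  have := dG x (tnth x i); rewrite setcoord_self => dx.
  have [dd dv] := dx.
  have : (fun k => (h k)^-1 *: (G (setcoord x i (h k *: 1 + tnth x i)) - G (setcoord x i (tnth x i)))) @ \oo --> G' x.
    rewrite -dv.
    apply: (cvg_comp h (fun s : R => s^-1 *: (G (setcoord x i (s *: 1 + tnth x i)) - G (setcoord x i (tnth x i))))); last exact: dd.
    move=> A [eps eps0 epsA].
    have he : \forall k \near \oo, `|h k| < eps by move/cvgr0Pnorm_lt : hc; apply.
    apply: filterS he => k hk; apply: epsA; last by rewrite /= gt_eqF.
    by rewrite /ball_/= sub0r normrN.
  apply: cvg_trans; apply: near_eq_cvg; apply: nearW => k.
  by rewrite /= /D te setcoord_self /GRing.scale/= mulr1 [h k + _]addrC.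
(* By the mean value theorem a quotient is the value of [G'] at a point within distance 1 of [x]
   along coordinate [i]; the factor 3 is that of [cauchyw_setcoord]. *)
have dD : {ae mun n, forall x k, setT x -> (`|(D k x)%:E| <= (3 * C * cauchyw x)%:E)%E}.
  apply: aeW => x k _; rewrite lee_fin /D te.
  have lt1 : tnth x i < tnth x i + h k by rewrite ltrDl.
  have cG : {within `[tnth x i, tnth x i + h k], continuous (fun s => G (setcoord x i s))}.
    apply: continuous_subspaceT => t; apply: differentiable_continuous; apply/derivable1_diffP.
    by have [] := dG x t.
  have [c cI E] := MVT lt1 (fun t _ => dG x t) cG.
  rewrite -[X in _ - G X](setcoord_self x i) E [tnth x i + _]addrC addrK mulrCA mulVf ?gt_eqF// mulr1.
  apply: le_trans (G'C _) _; rewrite [3 * C]mulrC -mulrA ler_wpM2l//.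
  have -> : setcoord x i c = setcoord x i (tnth x i + (c - tnth x i)) by rewrite addrC subrK.
  apply: cauchyw_setcoord; move: cI; rewrite in_itv/= => /andP[c1 c2].
  by rewrite ger0_norm ?subr_ge0 ?(ltW c1)//; have := h1 k; lra.
have i3 : (mun n).-integrable setT (fun x : n.-tuple rT => (3 * C * cauchyw x)%:E).
  by have := integrableZl measurableT (3 * C) (integrable_cauchyw n).
have [ic _ cv] := dominated_convergence measurableT mD mG'E cD i3 dD.
have fc := integrable_fin_num measurableT ic.
rewrite -(fineK fc) in cv.
have E : (fun k => \int[mun n]_x D k x) @ \oo --> \int[mun n]_x G' x by exact: (fine_cvg cv).
rewrite (_ : (fun k => _) = cst 0) in E; last by apply/funext => k; exact: D0.
exact: (cvg_unique (@Rhausdorff R) E (cvg_cst _)).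
Qed.

(* For real [f] the Fourier transform is [fcos f - i * fsin f]. *)
Definition fcos f (xi : n.-tuple R) : R := \int[mun n]_y (f y * cos (2 * pi * dotp xi y)).
Definition fsin f (xi : n.-tuple R) : R := \int[mun n]_y (f y * sin (2 * pi * dotp xi y)).

Lemma measurable_cos2 : measurable_fun setT (@cos R).
Proof. by apply: continuous_measurable_fun; exact: continuous_cos. Qed.

Lemma measurable_sin2 : measurable_fun setT (@sin R).
Proof. by apply: continuous_measurable_fun; exact: continuous_sin. Qed.

Lemma measurable_twopidotp (xi : n.-tuple R) :
  measurable_fun setT (fun y : n.-tuple rT => 2 * pi * dotp xi y).
Proof. by apply: measurable_funM => //; exact: measurable_dotpl. Qed.

Lemma schwartz_mul_bounded f (w : R -> R) (xi : n.-tuple R) : schwartz f ->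
  measurable_fun setT w -> (forall t, `|w t| <= 1) ->
  (mun n).-integrable setT (EFin \o (fun y : n.-tuple rT => f y * w (2 * pi * dotp xi y))).
Proof.
move=> sf mw w1; have [C C0 hC] := schwartz_le_cauchyw sf.
apply: (integrable_le_cauchyw (C := C)).
  apply: measurable_funM; first exact: schwartz_measurable.
  exact: (measurableT_comp mw (measurable_twopidotp xi)).
move=> y; rewrite normrM -[leRHS]mulr1 ler_pM// .
Qed.

Lemma cos_norm_le1 (t : R) : `|cos t| <= 1.
Proof. by rewrite ler_norml cos_geN1 cos_le1. Qed.

Lemma sin_norm_le1 (t : R) : `|sin t| <= 1.
Proof. by rewrite ler_norml sin_geN1 sin_le1. Qed.

Lemma integrable_fcos f xi : schwartz f ->
  (mun n).-integrable setT (EFin \o (fun y : n.-tuple rT => f y * cos (2 * pi * dotp xi y))).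
Proof. by move=> sf; apply: schwartz_mul_bounded => //; [exact: measurable_cos2|exact: cos_norm_le1]. Qed.

Lemma integrable_fsin f xi : schwartz f ->
  (mun n).-integrable setT (EFin \o (fun y : n.-tuple rT => f y * sin (2 * pi * dotp xi y))).
Proof. by move=> sf; apply: schwartz_mul_bounded => //; [exact: measurable_sin2|exact: sin_norm_le1]. Qed.

Lemma dotp_setcoord (xi x : n.-tuple R) i t :
  dotp xi (setcoord x i t) = tnth xi i * t + (dotp xi x - tnth xi i * tnth x i).
Proof.
rewrite /dotp (bigD1 i)//= setcoordE eqxx; congr (_ + _).
rewrite [in RHS](bigD1 i)//= [X in _ = X - _]addrC addrK.
by apply: eq_bigr => j ji; rewrite setcoordE (negbTE ji).
Qed.

Lemma is_derive_phase (xi x : n.-tuple R) (i : 'I_n) (t : R) :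
  is_derive t 1 (fun s : R => 2 * pi * dotp xi (setcoord x i s)) (2 * pi * tnth xi i).
Proof.
have -> : (fun s => 2 * pi * dotp xi (setcoord x i s)) =
    (2 * pi * tnth xi i) \*: (@id R) + cst (2 * pi * (dotp xi x - tnth xi i * tnth x i)).
  by apply/funext => s; rewrite dotp_setcoord mulrDr mulrA.
have D := is_deriveD (is_deriveZ (2 * pi * tnth xi i) (is_derive_id t 1))
  (is_derive_cst (2 * pi * (dotp xi x - tnth xi i * tnth x i)) t 1).
by apply: is_derive_eq D _; rewrite /GRing.scale/= mulr1 addr0.
Qed.

(** The [i]-th derivative of [f cos(2 pi <xi,y>)] has integral 0, and the product rule splits it
    into the two terms. *)
Lemma fcos_pderiv f i xi : schwartz f ->
  fcos (pderiv i f) xi = 2 * pi * tnth xi i * fsin f xi.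
Proof.
move=> sf; have sf' := schwartz_pderiv i sf.
have [C C0 hC] := schwartz_le_cauchyw sf; have [C' C0' hC'] := schwartz_le_cauchyw sf'.
set p := 2 * pi * tnth xi i.
pose G y := f y * cos (2 * pi * dotp xi y).
pose G' y := pderiv i f y * cos (2 * pi * dotp xi y) - p * (f y * sin (2 * pi * dotp xi y)).
have E : \int[mun n]_y G' y = 0.
  apply: (@integral_pderiv0 G G' i (C' + `|p| * C)).
  - by apply/measurable_EFinP; exact: measurable_int (integrable_fcos xi sf).
  - exact: integrable_fcos.
  - move=> x t.
    have D1 := schwartz_is_derive i x t sf.
    have D2 := is_derive_phase xi x i t.
    have D3 := @is_derive1_comp R cos (fun s => 2 * pi * dotp xi (setcoord x i s)) t _ _ (is_derive_cos _) D2.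
    have := is_deriveM D1 D3; rewrite /G' /GRing.scale/= -/p.
    by move=> D; apply: is_derive_eq D _; ring.
  - move=> x; rewrite /G' [leRHS]mulrDl; apply: le_trans (ler_normB _ _) _; apply: lerD.
      by rewrite normrM -[leRHS]mulr1 ler_pM// cos_norm_le1.
    by rewrite normrM (normrM (f x)) -[leRHS]mulrA ler_wpM2l// -[leRHS]mulr1 ler_pM// sin_norm_le1.
  - apply: measurable_funB.
      by apply/measurable_EFinP; exact: measurable_int (integrable_fcos xi sf').
    apply: measurable_funM => //.
    by apply/measurable_EFinP; exact: measurable_int (integrable_fsin xi sf).
move: E; rewrite RintegralB//; last 2 first.
- exact: integrable_fcos.
- by have := integrableZl measurableT p (integrable_fsin xi sf).
by rewrite RintegralZl//; [move/eqP; rewrite subr_eq0 => /eqP|exact: integrable_fsin].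
Qed.

Lemma fsin_pderiv f i xi : schwartz f ->
  fsin (pderiv i f) xi = - (2 * pi * tnth xi i * fcos f xi).
Proof.
move=> sf; have sf' := schwartz_pderiv i sf.
have [C C0 hC] := schwartz_le_cauchyw sf; have [C' C0' hC'] := schwartz_le_cauchyw sf'.
set p := 2 * pi * tnth xi i.
pose G y := f y * sin (2 * pi * dotp xi y).
pose G' y := pderiv i f y * sin (2 * pi * dotp xi y) + p * (f y * cos (2 * pi * dotp xi y)).
have E : \int[mun n]_y G' y = 0.
  apply: (@integral_pderiv0 G G' i (C' + `|p| * C)).
  - by apply/measurable_EFinP; exact: measurable_int (integrable_fsin xi sf).
  - exact: integrable_fsin.
  - move=> x t.
    have D1 := schwartz_is_derive i x t sf.
    have D2 := is_derive_phase xi x i t.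
    have D3 := @is_derive1_comp R sin (fun s => 2 * pi * dotp xi (setcoord x i s)) t _ _ (is_derive_sin _) D2.
    have := is_deriveM D1 D3; rewrite /G' /GRing.scale/= -/p.
    by move=> D; apply: is_derive_eq D _; ring.
  - move=> x; rewrite /G' [leRHS]mulrDl; apply: le_trans (ler_normD _ _) _; apply: lerD.
      by rewrite normrM -[leRHS]mulr1 ler_pM// sin_norm_le1.
    by rewrite normrM (normrM (f x)) -[leRHS]mulrA ler_wpM2l// -[leRHS]mulr1 ler_pM// cos_norm_le1.
  - apply: measurable_funD.
      by apply/measurable_EFinP; exact: measurable_int (integrable_fsin xi sf').
    apply: measurable_funM => //.
    by apply/measurable_EFinP; exact: measurable_int (integrable_fcos xi sf).
move: E; rewrite RintegralD//; last 2 first.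
- exact: integrable_fsin.
- by have := integrableZl measurableT p (integrable_fcos xi sf).
by rewrite RintegralZl//; [move/eqP; rewrite addr_eq0 => /eqP|exact: integrable_fcos].
Qed.

Lemma fcos_fsin_bounded f : schwartz f ->
  exists K : R, forall xi, `|fcos f xi| <= K /\ `|fsin f xi| <= K.
Proof.
move=> sf; have [C C0 hC] := schwartz_le_cauchyw sf.
exists (\int[mun n]_y (C * cauchyw y)) => xi.
have iC : (mun n).-integrable setT (EFin \o (fun y : n.-tuple rT => C * cauchyw y)).
  by have := integrableZl measurableT C (integrable_cauchyw n).
have H (g : n.-tuple rT -> R) : (mun n).-integrable setT (EFin \o g) ->
    (forall y, `|g y| <= C * cauchyw y) ->
    `|\int[mun n]_y g y| <= \int[mun n]_y (C * cauchyw y).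
  move=> ig gC; apply: le_trans (le_normr_Rintegral measurableT ig) _.
  apply: le_Rintegral => //.
  apply: (le_integrable measurableT _ _ ig); last by move=> u _; rewrite /= normr_id.
  apply/measurable_EFinP; apply: measurableT_comp => //; apply/measurable_EFinP.
  exact: measurable_int ig.
split; apply: H; rewrite ?integrable_fcos ?integrable_fsin// => y;
  by rewrite normrM -[leRHS]mulr1 ler_pM// ?cos_norm_le1 ?sin_norm_le1.
Qed.

(** Two derivatives in direction [i] lead back to the same transform, multiplied by
    [-(2 pi xi_i)^2]. The induction hypothesis is used for [f] and for its second derivative, and
    the two bounds add up to the factor [1 + (2 pi xi_i)^2]. *)
Lemma fcos_fsin_decay f (l : seq 'I_n) : schwartz f ->
  exists K : R, forall xi,
    (\prod_(i <- l) (1 + (2 * pi * tnth xi i) ^+ 2)) * `|fcos f xi| <= K /\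
    (\prod_(i <- l) (1 + (2 * pi * tnth xi i) ^+ 2)) * `|fsin f xi| <= K.
Proof.
elim: l f => [|i l IH] f sf.
  have [K hK] := fcos_fsin_bounded sf; exists K => xi.
  by rewrite big_nil !mul1r.
have sf1 := schwartz_pderiv i sf; have sf2 := schwartz_pderiv i sf1.
have [K1 h1] := IH _ sf; have [K2 h2] := IH _ sf2.
exists (K1 + K2) => xi; rewrite !big_cons.
set P := \prod_(j <- l) _; set p := 2 * pi * tnth xi i.
have P0 : 0 <= P by apply: prodr_ge0 => j _; rewrite ltW// oneDsq_gt0.
have [h1c h1s] := h1 xi; have [h2c h2s] := h2 xi.
have Ec : fcos (pderiv i (pderiv i f)) xi = - (p ^+ 2 * fcos f xi).
  by rewrite fcos_pderiv// fsin_pderiv// -/p; ring.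
have Es : fsin (pderiv i (pderiv i f)) xi = - (p ^+ 2 * fsin f xi).
  by rewrite fsin_pderiv// fcos_pderiv// -/p; ring.
have p2 : `|p ^+ 2| = p ^+ 2 by rewrite ger0_norm// sqr_ge0.
rewrite -/P Ec normrN normrM p2 in h2c.
rewrite -/P Es normrN normrM p2 in h2s.
rewrite -/P in h1c h1s.
by split; lra.
Qed.

(** The list of all coordinates, each taken once, gives the full product; [2 pi >= 1] allows the
    scale to be dropped. *)
Lemma fcos_fsin_cauchyw f : schwartz f ->
  exists K : R, forall xi : n.-tuple R,
    `|fcos f xi| <= K * cauchyw xi /\ `|fsin f xi| <= K * cauchyw xi.
Proof.
move=> sf; have [K hK] := fcos_fsin_decay (index_enum 'I_n) sf; exists K => xi.
have p0 : 0 < \prod_(i < n) (1 + tnth xi i ^+ 2).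
  by apply: prodr_gt0 => i _; exact: oneDsq_gt0.
have [hc hs] := hK xi; rewrite /cauchyw prodfV !ler_pdivlMr//.
have le : \prod_(i < n) (1 + tnth xi i ^+ 2) <= \prod_(i < n) (1 + (2 * pi * tnth xi i) ^+ 2).
  apply: ler_prod => i _; rewrite ltW ?oneDsq_gt0//= lerD2l exprMn ler_peMl ?sqr_ge0//.
  rewrite -[leLHS](expr1n _ 2) lerXn2r ?nnegrE ?mulr_ge0 ?pi_ge0//.
  have := @pi_ge2 R; lra.
by split; rewrite mulrC; [apply: le_trans hc|apply: le_trans hs]; rewrite ler_wpM2r.
Qed.

End schwartz_theory.

(** * Gaussian regularization and inversion *)

Section inversion.
Context {R : realType}.
Notation rT := (measurableTypeR R).
Variable n : nat.
Implicit Types f g : n.-tuple R -> R.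

Lemma lipschitz1 (phi phi' : R -> R) (K a b : R) :
  (forall t : R, is_derive t 1 phi (phi' t)) -> (forall t, `|phi' t| <= K) ->
  `|phi b - phi a| <= K * `|b - a|.
Proof.
move=> dphi hK; wlog ab : a b / a < b => [H|].
  case: (ltgtP a b) => [|ba|->]; first exact: H.
    by rewrite distrC [X in _ * X]distrC; exact: H.
  by rewrite !subrr !normr0 mulr0.
have cphi : {within `[a, b], continuous phi}.
  apply: continuous_subspaceT => t; apply: differentiable_continuous; apply/derivable1_diffP.
  by have [] := dphi t.
have [c _ ->] := MVT ab (fun t _ => dphi t) cphi.
by rewrite normrM ler_wpM2r.
Qed.

(** Continuity at the origin from bounded first partial derivatives: the points [hyb m] join 0 to
    [x] by switching on one coordinate at a time, and each step is a one-variable mean value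
    estimate. *)
Lemma schwartz_lipschitz0 f : schwartz f ->
  exists K : R, forall x : n.-tuple R, `|f x - f (@vzero R n)| <= K * \sum_(i < n) `|tnth x i|.
Proof.
move=> sf.
have [K hK] : exists K, forall (i : 'I_n) (x : n.-tuple R), `|pderiv i f x| <= K.
  have /choice[Ki hKi] : forall i : 'I_n, exists K, forall x : n.-tuple R, `|pderiv i f x| <= K.
    move=> i; have [_ /(_ 0%N)[C hC]] := sf [:: i]; exists C => x.
    by have := hC x; rewrite expr0 mul1r.
  exists (\sum_(i < n) `|Ki i|) => i x; apply: le_trans (hKi i x) _.
  by rewrite (bigD1 i)//= (le_trans (ler_norm _))// lerDl sumr_ge0.
exists K => x.
pose hyb (m : nat) : n.-tuple R := [tuple if (i < m)%N then tnth x i else 0 | i < n].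
have h0 : hyb 0%N = vzero R n by apply: eq_from_tnth => i; rewrite !tnth_mktuple.
have hn : hyb n = x by apply: eq_from_tnth => i; rewrite !tnth_mktuple ltn_ord.
suff H m : (m <= n)%N -> `|f (hyb m) - f (vzero R n)| <= K * \sum_(i < n | (i < m)%N) `|tnth x i|.
  have := H n (leqnn n); rewrite hn.
  by rewrite (eq_bigl xpredT)// => i; rewrite ltn_ord.
elim: m => [_|m IH mn]; first by rewrite h0 subrr normr0 big_pred0// mulr0.
set i := Ordinal mn.
have e1 : hyb m.+1 = setcoord (hyb m) i (tnth x i).
  apply: eq_from_tnth => j; rewrite setcoordE !tnth_mktuple ltnS leq_eqVlt.
  by rewrite -(inj_eq val_inj) /=; case: eqP => [jm|//]; congr tnth; exact: val_inj.
have e0 : hyb m = setcoord (hyb m) i 0.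
  apply: eq_from_tnth => j; rewrite setcoordE !tnth_mktuple.
  by case: eqP => [->|//]; rewrite /= ltnn.
have -> : f (hyb m.+1) - f (vzero R n) = (f (hyb m.+1) - f (hyb m)) + (f (hyb m) - f (vzero R n)) by ring.
apply: le_trans (ler_normD _ _) _.
rewrite (bigD1 i)//= mulrDr; apply: lerD.
  rewrite e1 {2}e0 -[X in _ <= _ * `|X|]subr0.
  exact: (lipschitz1 0 (tnth x i) (fun t => schwartz_is_derive i (hyb m) t sf) (fun t => hK i _)).
apply: le_trans (IH (ltnW mn)) _; rewrite le_eqVlt; apply/orP; left; apply/eqP; congr (_ * _).
apply: eq_bigl => j; rewrite ltnS [in RHS]leq_eqVlt -(inj_eq val_inj) /=.
by case: ltngtP.
Qed.

Lemma cauchyw_le1 (x : n.-tuple R) : cauchyw x <= 1.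
Proof.
rewrite /cauchyw; apply: prodr_ile1 => i _.
by rewrite invr_ge0 ltW ?oneDsq_gt0//= invf_le1 ?oneDsq_gt0// lerDl sqr_ge0.
Qed.

Lemma measurable_phase2 : measurable_fun setT
  (fun p : n.-tuple rT * n.-tuple rT => 2 * pi * dotp p.1 p.2).
Proof. by apply: measurable_funM => //; apply: measurable_dotp. Qed.

Lemma measurable_fcos f : schwartz f -> measurable_fun setT (fcos f : n.-tuple rT -> R).
Proof.
move=> sf; rewrite (_ : fcos f = (fun xi => iint (fun y : n.-tuple rT => f y * cos (2 * pi * dotp xi y)))).
  apply: (measurable_iint (F := fun p : n.-tuple rT * n.-tuple rT => f p.2 * cos (2 * pi * dotp p.1 p.2))).
  apply: measurable_funM; first exact: (measurableT_comp (schwartz_measurable sf) measurable_snd).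
  exact: (measurableT_comp (@measurable_cos2 R) measurable_phase2).
by apply/funext => xi; rewrite iintE//; exact: integrable_fcos.
Qed.

Lemma measurable_fsin f : schwartz f -> measurable_fun setT (fsin f : n.-tuple rT -> R).
Proof.
move=> sf; rewrite (_ : fsin f = (fun xi => iint (fun y : n.-tuple rT => f y * sin (2 * pi * dotp xi y)))).
  apply: (measurable_iint (F := fun p : n.-tuple rT * n.-tuple rT => f p.2 * sin (2 * pi * dotp p.1 p.2))).
  apply: measurable_funM; first exact: (measurableT_comp (schwartz_measurable sf) measurable_snd).
  exact: (measurableT_comp (@measurable_sin2 R) measurable_phase2).
by apply/funext => xi; rewrite iintE//; exact: integrable_fsin.
Qed.

Lemma integrable_fcos_xi f : schwartz f -> (mun n).-integrable setT (EFin \o (fcos f : n.-tuple rT -> R)).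
Proof.
move=> sf; have [K hK] := fcos_fsin_cauchyw sf.
by apply: (integrable_le_cauchyw (measurable_fcos sf)) => xi; exact: (hK xi).1.
Qed.

Lemma integrable_fsin_xi f : schwartz f -> (mun n).-integrable setT (EFin \o (fsin f : n.-tuple rT -> R)).
Proof.
move=> sf; have [K hK] := fcos_fsin_cauchyw sf.
by apply: (integrable_le_cauchyw (measurable_fsin sf)) => xi; exact: (hK xi).2.
Qed.

Lemma integral_fsin f : schwartz f -> \int[mun n]_xi fsin f xi = 0.
Proof.
move=> sf; apply: Rintegral_odd => [|xi]; first exact: integrable_fsin_xi.
rewrite /fsin -[RHS]mulN1r -RintegralZl//; last exact: integrable_fsin.
by apply: eq_Rintegral => y _; rewrite dotp_vscalel mulN1r mulrN sinN mulrN mulN1r.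
Qed.

Lemma gauss_cos_scaled (h : R) (y : n.-tuple R) : 0 < h ->
  (mun n).-integrable setT (EFin \o (fun xi : n.-tuple rT => cos (2 * pi * dotp xi y) * gauss (vscale h xi))) /\
  \int[mun n]_xi (cos (2 * pi * dotp xi y) * gauss (vscale h xi)) =
  h^-1 ^+ n * (Num.sqrt pi ^+ n * gauss (vscale (pi / h) y)).
Proof.
move=> h0; have hn : h != 0 by rewrite gt_eqF.
have [ig Eg] := gauss_cos (vscale (2 * pi / h) y).
have e xi : cos (dotp (vscale (2 * pi / h) y) (vscale h xi)) * gauss (vscale h xi) =
    cos (2 * pi * dotp xi y) * gauss (vscale h xi).
  by rewrite dotp_vscalel dotp_vscaler mulrA divfK// dotpC.
split.
  have := integrable_taff [tuple 0 | i < n] hn ig.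
  by congr (integrable _ _ _); apply/funext => xi; rewrite /= -[taff _ _ xi]/(vscale h xi) e.
have := Rintegral_taff [tuple 0 | i < n] hn ig.
rewrite gtr0_norm// Eg => E0.
transitivity (h^-1 ^+ n * (Num.sqrt pi ^+ n * expR (- (dotp (vscale (2 * pi / h) y) (vscale (2 * pi / h) y) / 4)))).
  by rewrite -E0; apply: eq_Rintegral => xi _; rewrite -[taff _ _ xi]/(vscale h xi) e.
congr (_ * (_ * expR (- _))); rewrite !dotp_vscalel !dotp_vscaler; by field.
Qed.

Lemma measurable_gauss_vscale h : measurable_fun setT (fun xi : n.-tuple rT => gauss (vscale h xi)).
Proof.
exact: (measurableT_comp (@measurable_gauss R n) (@measurable_taff R n h [tuple 0 | i < n])).
Qed.

(** Without the Gaussian the double integral is not absolutely convergent; with it the integrand is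
    dominated by [C cauchyw(y) gauss(h xi)] and Fubini applies. Integrating in [xi] first yields a
    Gaussian in [y] of width proportional to [h]. *)
Lemma regularized_inversion f (h : R) : schwartz f -> 0 < h ->
  \int[mun n]_xi (fcos f xi * gauss (vscale h xi)) =
  (Num.sqrt pi)^-1 ^+ n * \int[mun n]_z (f (vscale (h / pi) z) * gauss z).
Proof.
move=> sf h0; have hn : h != 0 by rewrite gt_eqF.
have [C C0 hC] := schwartz_le_cauchyw sf.
have mf := schwartz_measurable sf.
pose F (p : n.-tuple rT * n.-tuple rT) : R := f p.2 * cos (2 * pi * dotp p.1 p.2) * gauss (vscale h p.1).
have mg1 : measurable_fun setT (fun p : n.-tuple rT * n.-tuple rT => gauss (vscale h p.1)).
  exact: (measurableT_comp (measurable_gauss_vscale h) measurable_fst).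
have mF : measurable_fun setT F.
  apply: measurable_funM => //; apply: measurable_funM.
    exact: (measurableT_comp mf measurable_snd).
  exact: (measurableT_comp (@measurable_cos2 R) measurable_phase2).
have igs : (mun n).-integrable setT (EFin \o (fun xi : n.-tuple rT => gauss (vscale h xi))).
  exact: (integrable_taff [tuple 0 | i < n] hn (integrable_gauss n)).
have iF : (mun n \x mun n)%E.-integrable setT (EFin \o F).
  apply/integrable12ltyP; first exact/measurable_EFinP.
  apply: (@le_lt_trans _ _ (\int[mun n]_xi ((C * pi ^+ n)%:E * (gauss (vscale h xi))%:E)))%E; last first.
    have := integrableZl measurableT (C * pi ^+ n) igs.
    move=> /integrableP[_]; apply: le_lt_trans; rewrite le_eqVlt; apply/orP; left; apply/eqP.
    apply: eq_integral => xi _; rewrite gee0_abs// mule_ge0// lee_fin ?gauss_ge0//.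
    by rewrite mulr_ge0// exprn_ge0// pi_ge0.
  apply: ge0_le_integral => //.
  - by move=> xi _; exact: integral_ge0.
  - apply: (measurable_fun_fubini_tonelli_F (fun p => `|(EFin \o F) p|)%E) => //.
    by apply: measurableT_comp => //; exact/measurable_EFinP.
  - by apply: measurable_funeM; apply/measurable_EFinP; exact: measurable_gauss_vscale.
  - move=> xi _.
    apply: (@le_trans _ _ (\int[mun n]_y ((C * gauss (vscale h xi))%:E * (cauchyw y)%:E)))%E.
      apply: ge0_le_integral => //.
      + apply: measurableT_comp => //; apply/measurable_EFinP.
        by apply: (measurableT_comp mF); exact: measurable_pair1.
      + by apply: measurable_funeM; apply/measurable_EFinP; exact: measurable_cauchyw.
      + move=> y _; rewrite /F/= lee_fin !normrM (ger0_norm (gauss_ge0 _)).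
        rewrite [leRHS]mulrAC ler_wpM2r ?gauss_ge0// -[leRHS]mulr1.
        by rewrite ler_pM// cos_norm_le1.
    rewrite ge0_integralZl_EFin//; last 3 first.
    - by move=> y _; rewrite lee_fin cauchyw_ge0.
    - by apply/measurable_EFinP; exact: measurable_cauchyw.
    - by rewrite mulr_ge0// gauss_ge0.
    by rewrite integral_cauchyw -!EFinM lee_fin mulrAC.
have L xi : (\int[mun n]_y (F (xi, y))%:E)%E = (fcos f xi * gauss (vscale h xi))%:E.
  under eq_integral do rewrite /F/= mulrC EFinM.
  have ic := integrable_fcos xi sf.
  rewrite (integralZl measurableT ic) [in RHS]mulrC EFinM /fcos /Rintegral fineK//.
  exact: (integrable_fin_num measurableT ic).
have Rr y : (\int[mun n]_xi (F (xi, y))%:E)%E =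
    (f y * (h^-1 ^+ n * (Num.sqrt pi ^+ n * gauss (vscale (pi / h) y))))%:E.
  have [ig <-] := gauss_cos_scaled y h0.
  under eq_integral do rewrite /F/= -mulrA EFinM.
  rewrite (integralZl measurableT ig) EFinM /Rintegral fineK//.
  exact: (integrable_fin_num measurableT ig).
have := Fubini iF.
under eq_integral do rewrite L.
under [RHS]eq_integral do rewrite Rr.
move=> E; rewrite {1}/Rintegral E -[LHS]/(Rintegral _ _ _).
pose phi (z : n.-tuple rT) := f (vscale (h / pi) z) * gauss z.
have pi0 : pi != 0 :> R by rewrite gt_eqF// pi_gt0.
have iphi : (mun n).-integrable setT (EFin \o phi).
  apply: (le_integrable measurableT _ _ (integrableZl measurableT C (integrable_gauss n))).
    apply/measurable_EFinP; apply: measurable_funM; last exact: measurable_gauss.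
    exact: (measurableT_comp mf (@measurable_taff R n (h / pi) [tuple 0 | i < n])).
  move=> z _; rewrite /= lee_fin /phi !normrM ler_wpM2r//.
  by rewrite (le_trans (hC _))// (ger0_norm C0) ler_piMr// cauchyw_le1.
have ph0 : pi / h != 0 by rewrite mulf_neq0// invr_eq0.
have := Rintegral_taff [tuple 0 | i < n] ph0 iphi.
rewrite gtr0_norm ?divr_gt0 ?pi_gt0// => E2.
(* The substitution [z = (pi/h) y] contributes [h/pi] per coordinate, and
   [h^-1 sqrt pi h / pi = 1 / sqrt pi]. *)
transitivity ((h^-1 * Num.sqrt pi) ^+ n * \int[mun n]_y phi (taff (pi / h) [tuple 0 | i < n] y)).
  rewrite -RintegralZl//; last exact: (integrable_taff [tuple 0 | i < n] ph0 iphi).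
  apply: eq_Rintegral => y _; rewrite -[taff _ _ y]/(vscale (pi / h) y) /phi exprMn.
  have -> : vscale (h / pi) (vscale (pi / h) y) = y.
    by apply: eq_from_tnth => i; rewrite !tnth_vscale mulrA -invf_div mulVf ?mul1r.
  by ring.
rewrite E2 mulrA -exprMn; congr (_ ^+ n * _).
have sp : Num.sqrt pi * Num.sqrt pi = pi :> R by rewrite -expr2 sqr_sqrtr// pi_ge0.
have s0 : Num.sqrt pi != 0 :> R by rewrite sqrtr_eq0 -ltNge pi_gt0.
rewrite -{2}sp; field.
by rewrite hn s0.
Qed.

(** Both sides of [regularized_inversion] pass to the limit along [h = 1/(k+1)], with different
    majorants: on the left the decay of [fcos f], on the right the boundedness of [f] against the
    Gaussian. *)
Lemma fcos_inversion f : schwartz f -> \int[mun n]_xi fcos f xi = f (vzero R n).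
Proof.
move=> sf; have [C C0 hC] := schwartz_le_cauchyw sf.
have mf := schwartz_measurable sf.
pose h (k : nat) : R := k.+1%:R^-1.
have h0 k : 0 < h k by rewrite invr_gt0.
have hc : h k @[k --> \oo] --> 0 by exact: cvg_harmonic.
have gle1 (z : n.-tuple R) : gauss z <= 1 by rewrite /gauss -expR0 ler_expR oppr_le0 dotpp_ge0.
have c1 : \int[mun n]_xi (fcos f xi * gauss (vscale (h k) xi)) @[k --> \oo] --> \int[mun n]_xi fcos f xi.
  have ic := integrable_fcos_xi sf.
  have mc := measurable_fcos sf.
  have m1 k : measurable_fun setT (fun xi : n.-tuple rT => (fcos f xi * gauss (vscale (h k) xi))%:E).
    by apply/measurable_EFinP; apply: measurable_funM => //; exact: measurable_gauss_vscale.
  have m2 : measurable_fun setT (fun xi : n.-tuple rT => (fcos f xi)%:E) by exact/measurable_EFinP.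
  have cD : {ae mun n, forall xi, setT xi ->
      (fcos f xi * gauss (vscale (h k) xi))%:E @[k --> \oo] --> (fcos f xi)%:E}.
    apply: aeW => xi _; apply: cvg_EFin; first exact: nearW.
    rewrite -[X in _ --> X]mulr1; apply: cvgMr.
    rewrite -expR0 -oppr0 -(mul0r (dotp xi xi)) -{1}(mul0r 0).
    apply: (@continuous_cvg _ _ _ _ _ _ expR); first exact: continuous_expR.
    apply: cvgN; under eq_fun do rewrite dotp_vscalel dotp_vscaler mulrA.
    by apply: cvgMl; apply: cvgM.
  have [K hK] := fcos_fsin_cauchyw sf.
  have iK : (mun n).-integrable setT (fun xi : n.-tuple rT => (K * cauchyw xi)%:E).
    by have := integrableZl measurableT K (integrable_cauchyw n).
  have dD : {ae mun n, forall xi k, setT xi ->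
      (`|(fcos f xi * gauss (vscale (h k) xi))%:E| <= (K * cauchyw xi)%:E)%E}.
    apply: aeW => xi k _; rewrite lee_fin normrM (ger0_norm (gauss_ge0 _)).
    by rewrite (le_trans _ (hK xi).1)// ler_piMr.
  have [ic2 _ cv] := dominated_convergence measurableT m1 m2 cD iK dD.
  have fc := integrable_fin_num measurableT ic2.
  rewrite -(fineK fc) in cv.
  exact: (fine_cvg cv).
have c2 : \int[mun n]_z (f (vscale (h k / pi) z) * gauss z) @[k --> \oo] -->
    f (vzero R n) * Num.sqrt pi ^+ n.
  rewrite -(@Rintegral_gauss R n) -RintegralZl//; last exact: integrable_gauss.
  have m1 k : measurable_fun setT (fun z : n.-tuple rT => (f (vscale (h k / pi) z) * gauss z)%:E).
    apply/measurable_EFinP; apply: measurable_funM; last exact: measurable_gauss.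
    exact: (measurableT_comp mf (@measurable_taff R n _ [tuple 0 | i < n])).
  have m2 : measurable_fun setT (fun z : n.-tuple rT => (f (vzero R n) * gauss z)%:E).
    by apply/measurable_EFinP; apply: measurable_funM => //; exact: measurable_gauss.
  have [K hK] := schwartz_lipschitz0 sf.
  have cD : {ae mun n, forall z, setT z ->
      (f (vscale (h k / pi) z) * gauss z)%:E @[k --> \oo] --> (f (vzero R n) * gauss z)%:E}.
    apply: aeW => z _; apply: cvg_EFin; first exact: nearW.
    apply: cvgMl; apply/subr_cvg0; apply: norm_cvg0.
    apply: (squeeze_cvgr (f := fun=> 0) (h := fun k => h k * (K / pi * \sum_(i < n) `|tnth z i|))).
    - apply: nearW => k; rewrite normr_ge0 (le_trans (hK _))//.
      rewrite le_eqVlt; apply/orP; left; apply/eqP.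
      rewrite (eq_bigr (fun i => h k / pi * `|tnth z i|)) => [|i _]; last first.
        by rewrite tnth_vscale normrM (ger0_norm (_ : 0 <= h k / pi))// divr_ge0 ?pi_ge0// ltW.
      by rewrite -mulr_sumr; ring.
    - exact: cvg_cst.
    - by rewrite -[X in _ --> X](mul0r (K / pi * \sum_(i < n) `|tnth z i|)); apply: cvgMl.
  have iK : (mun n).-integrable setT (fun z : n.-tuple rT => (C * gauss z)%:E).
    by have := integrableZl measurableT C (integrable_gauss n).
  have dD : {ae mun n, forall z k, setT z ->
      (`|(f (vscale (h k / pi) z) * gauss z)%:E| <= (C * gauss z)%:E)%E}.
    apply: aeW => z k _; rewrite lee_fin normrM (ger0_norm (gauss_ge0 _)) ler_wpM2r ?gauss_ge0//.
    by rewrite (le_trans (hC _))// ler_piMr// cauchyw_le1.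
  have [ic2 _ cv] := dominated_convergence measurableT m1 m2 cD iK dD.
  have fc := integrable_fin_num measurableT ic2.
  rewrite -(fineK fc) in cv.
  exact: (fine_cvg cv).
have s0 : Num.sqrt pi != 0 :> R by rewrite sqrtr_eq0 -ltNge pi_gt0.
apply: (cvg_unique _ c1); first exact: Rhausdorff.
rewrite (_ : (fun k => _) = (fun k => (Num.sqrt pi)^-1 ^+ n *
   \int[mun n]_z (f (vscale (h k / pi) z) * gauss z))); last first.
  by apply/funext => k; exact: regularized_inversion.
have -> : f (vzero R n) = (Num.sqrt pi)^-1 ^+ n * (f (vzero R n) * Num.sqrt pi ^+ n).
  by rewrite exprVn; field; rewrite expf_neq0.
exact: cvgMr.
Qed.

End inversion.

(** * The natural autocorrelation *)

Section natural_autocorrelation.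
Context {R : realType}.
Notation rT := (measurableTypeR R).
Local Open Scope complex_scope.

(** Positivity of the radius matters: for a negative one [cball] is empty, while [sqball] sees only
    the square. The limit at infinity concerns positive radii. *)
Lemma cball_sqball n (rad : R) (y : n.-tuple R) : 0 < rad ->
  `[< @cball R n rad y >] = (y \in @sqball R n (rad ^+ 2)).
Proof.
move=> r0; have r1 := ltW r0.
have E : (enorm y <= rad) = (dotp y y <= rad ^+ 2) by rewrite -enorm_sqr ler_pXn2r ?nnegrE ?enorm_ge0.
by apply/asboolP/idP => [h|/set_mem h]; [apply/mem_set|]; move: h; rewrite /cball /sqball/= E.
Qed.

Lemma vol_cball n (rad : R) : 0 < rad -> vol (@cball R n rad) = rad ^+ n * ballvol n.
Proof.
move=> r0; rewrite /vol.
have -> : (fun x : n.-tuple R => \1_(@cball R n rad) x) = (fun x => \1_(@sqball R n (rad ^+ 2)) x : R).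
  by apply/funext => x; rewrite !indicE -cball_sqball//; congr (nat_of_bool _)%:R; rewrite /in_mem/= /mem_set/=.
have mB := @measurable_sqball R n (rad ^+ 2).
have r2 : 0 < rad ^+ 2 by rewrite exprn_gt0.
rewrite iintE.
  rewrite /Rintegral integral_indic// setIT [X in fine X](mun_sqball n r2) sqr_powR_half//; exact: ltW.
apply/integrableP; split; first by apply/measurable_EFinP; exact: measurable_indic.
under eq_integral do rewrite /= ger0_norm ?indicE ?ler0n//.
under eq_integral do rewrite -indicE.
by rewrite integral_indic// setIT [X in (X < _)%E](mun_sqball n r2) ltry.
Qed.

Lemma vopp_vsub n (x y : n.-tuple R) : vopp (vsub x y) = vsub y x.
Proof. by apply: eq_from_tnth => i; rewrite !tnth_mktuple opprB. Qed.

Lemma expi_mul_conj (a b : R) : expi a * conjc (expi b) = expi (a - b).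
Proof. by apply/eqP; rewrite eq_complex /= cosB sinB mulrN opprK mulrN addrC [X in _ && (_ == X)]addrC eqxx/= addrC eqxx. Qed.

Lemma divr_complex (a b c : R) : (a +i* b) / c%:C = (a / c) +i* (b / c).
Proof. by rewrite -fmorphV; apply/eqP; rewrite eq_complex /= !mulr0 subr0 add0r !eqxx. Qed.

(** [tilde] evaluated at [x - y] is the conjugate at [y - x], so the two phases are subtracted and
    the two restrictions cut out the lens. *)
Lemma conv_integrand n r (x y : n.-tuple R) rad : 0 < rad ->
  restr (spherical_wave r) rad y * tilde (restr (spherical_wave r) rad) (vsub x y) =
  lens_fun r x cos rad y +i* lens_fun r x sin rad y.
Proof.
move=> r0; rewrite /tilde vopp_vsub /restr !cball_sqball// /lens_fun !indicE.
case: ifPn => _; last by rewrite !mul0r !mulr0.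
case: ifPn => _; last by rewrite conjc0 !mulr0.
rewrite /spherical_wave expi_mul_conj !mulr1 /expi /phase.
by rewrite mulrBr.
Qed.

Lemma conv_lens n r (x : n.-tuple R) rad : 0 < rad ->
  Defs.conv (restr (spherical_wave r) rad) (tilde (restr (spherical_wave r) rad)) x =
  iint (lens_fun r x cos rad) +i* iint (lens_fun r x sin rad).
Proof.
move=> r0; rewrite /Defs.conv /cint.
by congr Complex; congr iint; apply/funext => y; rewrite conv_integrand.
Qed.

Lemma autocorr_approxE n r (x : n.-tuple R) rad : 0 < rad ->
  autocorr_approx (spherical_wave r) x rad =
  (\int[mun n]_y lens_fun r x cos rad y / (rad ^+ n * ballvol n)) +i*
  (\int[mun n]_y lens_fun r x sin rad y / (rad ^+ n * ballvol n)).
Proof.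
move=> r0; rewrite /autocorr_approx conv_lens// vol_cball//.
rewrite divr_complex !iintE//.
- apply: integrable_lens_fun => //; [exact: continuous_sin|exact: sin_norm_le1].
- apply: integrable_lens_fun => //; [exact: continuous_cos|exact: cos_norm_le1].
Qed.

Lemma sphere_fun_sin0 n r (x : n.-tuple R) : \int[mun n]_u sphere_fun r x sin u = 0.
Proof.
have ms : measurable_fun setT (fun u : n.-tuple rT => sin (cosangle (vscale (2 * pi * r) x) u)).
  apply: (measurableT_comp (@measurable_sin2 R)); exact: measurable_cosangle.
have i1 := integrable_sqball ms (fun u => sin_norm_le1 _).
apply: Rintegral_odd => // u; rewrite /sphere_fun.
have -> : cosangle (vscale (2 * pi * r) x) (vscale (-1) u) = - cosangle (vscale (2 * pi * r) x) u.
  rewrite /cosangle dotp_vscaler mulN1r mulNr; congr (- (_ / _)).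
  by rewrite /enorm dotp_vscalel dotp_vscaler mulN1r mulN1r opprK.
have -> : \1_(@sqball R n 1) (vscale (-1) u) = \1_(@sqball R n 1) u :> R.
  rewrite !indicE; congr (nat_of_bool _)%:R.
  by apply/idP/idP; rewrite !inE /sqball/= dotp_vscalel dotp_vscaler !mulN1r opprK.
by rewrite sinN mulNr.
Qed.

Lemma spherical_wave_autocorrelation n r (x : n.-tuple R) : (0 < n)%N ->
  has_natural_autocorrelation_at (spherical_wave r) x
    (ballcos (vscale (2 * pi * r) x) / ballvol n)%:C.
Proof.
move=> n0; split.
  have c := lens_average_cvg (r := r) (x := x) n0 (@continuous_cos R) (@cos_norm_le1 R).
  move: c; apply: cvg_trans; apply: near_eq_cvg.
  have : \forall rad \near +oo, 0 < rad :> R by exact: nbhs_pinfty_gt.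
  by apply: filterS => rad r0; rewrite /comp autocorr_approxE.
have c := lens_average_cvg (r := r) (x := x) n0 (@continuous_sin R) (@sin_norm_le1 R).
rewrite sphere_fun_sin0 mul0r in c.
move: c; apply: cvg_trans; apply: near_eq_cvg.
have : \forall rad \near +oo, 0 < rad :> R by exact: nbhs_pinfty_gt.
by apply: filterS => rad r0; rewrite /comp autocorr_approxE.
Qed.

(** The constant 1 is the spherical wave with [r = 0], which the preceding lemma covers. *)
Lemma one_autocorrelation n (x : n.-tuple R) : (0 < n)%N ->
  has_natural_autocorrelation_at (fun _ : n.-tuple R => 1 : R[i]) x 1.
Proof.
move=> n0; have := @spherical_wave_autocorrelation n 0 x n0.
rewrite ballcos_dotp0 ?divff ?gt_eqF ?ballvol_gt0//; last first.
  by move=> u; rewrite dotp_vscalel mulr0 mul0r.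
rewrite (_ : spherical_wave 0 = (fun _ : n.-tuple R => 1 : R[i]))//.
by apply/funext => y; rewrite /spherical_wave mulr0 mul0r /expi cos0 sin0.
Qed.

(** Passes from convergence to the function defined by [lim], whose Fourier transform the theorem
    speaks of. *)
Lemma natural_autocorrelation1 n : (0 < n)%N ->
  natural_autocorrelation (fun _ : n.-tuple R => 1 : R[i]) = (fun=> 1).
Proof.
move=> n0; apply/funext => x; have [cr ci] := one_autocorrelation x n0.
rewrite /natural_autocorrelation.
have -> : lim (@complex.Re R \o autocorr_approx (fun=> 1) x @ +oo) = 1 by apply/cvg_lim.
by have -> : lim (@complex.Im R \o autocorr_approx (fun=> 1) x @ +oo) = 0 by apply/cvg_lim.
Qed.

End natural_autocorrelation.

(** * The Fourier transform of the constant function 1 *)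

Section fourier_dirac.
Context {R : realType}.
Notation rT := (measurableTypeR R).
Variable n : nat.
Implicit Types f : n.-tuple R -> R.
Local Open Scope complex_scope.

(** Real and imaginary part of [exp(-i theta) (f1 + i f2)]. The sine transforms are odd in [xi] and
    later integrate to 0, so inversion is needed for the cosine transforms only. *)
Lemma fourier_cfun_of f1 f2 (xi : n.-tuple R) : schwartz f1 -> schwartz f2 ->
  fourier (cfun_of f1 f2) xi =
  (fcos f1 xi + fsin f2 xi) +i* (fcos f2 xi - fsin f1 xi).
Proof.
move=> s1 s2; rewrite /fourier /cint; congr Complex.
  rewrite /fcos /fsin -RintegralD//; try exact: integrable_fcos; try exact: integrable_fsin.
  rewrite -iintE; last first.
    exact: (integrableD measurableT (integrable_fcos xi s1) (integrable_fsin xi s2)).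
  congr iint; apply/funext => y /=.
  by rewrite cosN sinN mulNr opprK mulrC [sin _ * _]mulrC.
rewrite /fcos /fsin -RintegralB//; try exact: integrable_fcos; try exact: integrable_fsin.
rewrite -iintE; last first.
  exact: (integrableB measurableT (integrable_fcos xi s2) (integrable_fsin xi s1)).
congr iint; apply/funext => y /=.
by rewrite cosN sinN mulNr mulrC [sin _ * _]mulrC.
Qed.

Lemma fourier_is_dirac0_cst1 : fourier_is_dirac0 (fun _ : n.-tuple R => 1 : R[i]).
Proof.
move=> f1 f2 s1 s2; rewrite /cint /cfun_of.
have E : (fun xi : n.-tuple R => 1 * fourier (fun x => f1 x +i* f2 x) xi) =
  (fun xi => (fcos f1 xi + fsin f2 xi) +i* (fcos f2 xi - fsin f1 xi)).
  by apply/funext => xi; rewrite mul1r -(fourier_cfun_of xi s1 s2).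
congr Complex.
  rewrite [X in iint X](_ : _ = (fun xi => fcos f1 xi + fsin f2 xi)); last first.
    by apply/funext => xi; have /(congr1 (fun h => complex.Re (h xi))) := E.
  rewrite iintE; last first.
    exact: (integrableD measurableT (integrable_fcos_xi s1) (integrable_fsin_xi s2)).
  rewrite RintegralD//; last 2 first.
  - exact: integrable_fcos_xi.
  - exact: integrable_fsin_xi.
  by rewrite fcos_inversion// integral_fsin// addr0.
rewrite [X in iint X](_ : _ = (fun xi => fcos f2 xi - fsin f1 xi)); last first.
  by apply/funext => xi; have /(congr1 (fun h => complex.Im (h xi))) := E.
rewrite iintE; last first.
  exact: (integrableB measurableT (integrable_fcos_xi s2) (integrable_fsin_xi s1)).
rewrite RintegralB//; last 2 first.
- exact: integrable_fcos_xi.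
- exact: integrable_fsin_xi.
by rewrite fcos_inversion// integral_fsin// subr0.
Qed.

End fourier_dirac.

Theorem theorem1 (R : realType) (d : nat) (r : R) :
  (1 <= d)%N -> 0 < r ->
  (* the natural autocorrelation of the spherical wave exists everywhere
     and is given by the Bessel formula *)
  (forall x : d.-tuple R,
     has_natural_autocorrelation_at (spherical_wave r) x
       ((eta_formula d r x)%:C)%C)
  /\
  (* as r -> 0+, the formula converges (pointwise) to 1 *)
  (forall x : d.-tuple R,
     (fun s : R => eta_formula d s x) @ 0^'+ --> (1 : R))
  /\
  (* r = 0, i.e. f = 1: eta = 1 everywhere ... *)
  (forall x : d.-tuple R,
     has_natural_autocorrelation_at (fun _ : d.-tuple R => 1 : R[i]) x 1)
  /\
  (* ... and its Fourier transform is delta_0 *)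
  fourier_is_dirac0 (natural_autocorrelation (fun _ : d.-tuple R => 1 : R[i])).
Proof.
move=> d0 r0; split=> [x|].
  by rewrite eta_formula_ballcos//; exact: spherical_wave_autocorrelation.
split=> [x|]; first exact: eta_formula_cvg0.
split=> [x|]; first exact: one_autocorrelation.
by rewrite natural_autocorrelation1//; exact: fourier_is_dirac0_cst1.
Qed.
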